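(* Let $d\ge2$, $\gamma>0$ and $\beta>-1$, and let $Z$ be the polytope part of the typical cell of the $\beta$-Voronoi tessellation in $\mathbb R^d$. Then there exists a constant $c>0$ such that for all integers $n\ge d+1$, $$\mathbb P(Z\in\mathcal P_n)>\big(c\,n^{-\frac2{d-1}}\big)^n,$$ where $\mathcal P_n$ is the set of polytopes in $\mathbb R^d$ with exactly $n$ facets.
   Context: Let $\mu_\beta(\mathrm dv,\mathrm dh)=\gamma c_{d+1,\beta}h^\beta\mathbb 1\{h\ge0\}\,\mathrm dv\,\mathrm dh$ on $\mathbb R^d\times\mathbb R$, $c_{d+1,\beta}=\frac{\Gamma(\frac{d+1}2+\beta+1)}{\pi^{(d+1)/2}\Gamma(\beta+1)}$, and let $\eta_\beta$ be a Poisson point process with intensity measure $\mu_\beta$. For $X\subset\mathbb R^d\times\mathbb R$ and $(v,h)\in X$ the Laguerre cell is $\mathscr C_X(v,h)=\{w\in\mathbb R^d:\|w-v\|^2+h\le\|w-v'\|^2+h'\ \forall(v',h')\in X\}$ (possibly empty). The $\beta$-Voronoi tessellation consists of the nonempty cells $\mathscr C_{\eta_\beta}(v,h)$, $(v,h)\in\eta_\beta$. Let $\mathbb K$ be the space of nonempty compact convex subsets of $\mathbb R^d$ with the Hausdorff metric and $\widehat{\mathbb K}_{\mathbf o}=(\{\mathbf o\}\times\mathbb R)\times\mathbb K$, with $\mathbf o$ the origin. The typical cell $\widehat Z=((\mathbf o,h_Z),Z)$ is a random element of $\widehat{\mathbb K}_{\mathbf o}$ with distribution $$\mathbb P(\widehat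 Z\in D)=\frac1{\Lambda_\beta}\mathbb E\big|\{x=(v,h)\in\eta_\beta:\ v\in[0,1]^d,\ (x,\mathscr C_{\eta_\beta}(x))\in D+v\}\big|$$ for Borel $D\subset\widehat{\mathbb K}_{\mathbf o}$, where $((\mathbf o,h),K)+v=((v,h),K+v)$ and $\Lambda_\beta\in(0,\infty)$ is the expected number of $(v,h)\in\eta_\beta$ with $v\in[0,1]^d$ and $\mathscr C_{\eta_\beta}(v,h)\neq\emptyset$ (equivalently the expected number of vertices in $[0,1]^d$ of the dual $\beta$-Delaunay triangulation). Almost surely $Z$ is a polytope. *)

(* Defs.v *)
From HB Require Import structures.
From mathcomp Require Import all_boot all_order all_algebra.
From mathcomp Require Import all_classical all_reals all_analysis.
From mathcomp Require Import measurable_realfun.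
From mathcomp Require Import ring lra.
Set Implicit Arguments.
Unset Strict Implicit.
Unset Printing Implicit Defensive.
Import Order.TTheory GRing.Theory Num.Theory.
Import numFieldNormedType.Exports.
Local Open Scope classical_set_scope.
Local Open Scope ring_scope.

Section euclidean.
Context {R : realType} {d : nat}.
Implicit Types (u w x y : 'rV[R]_d) (A : set 'rV[R]_d).

Definition dotp u w : R := \sum_(i < d) u 0 i * w 0 i.

(* The norm of the library on 'rV is the sup norm; it induces the same
   topology as this one. *)
Definition enorm w : R := Num.sqrt (dotp w w).

Lemma dotp_ge0 w : 0 <= dotp w w.
Proof. by apply: sumr_ge0 => i _; rewrite -expr2 sqr_ge0. Qed.

Lemma enorm_ge0 w : 0 <= enorm w.
Proof. exact: sqrtr_ge0. Qed.

Lemma sqr_enorm w : enorm w ^+ 2 = dotp w w.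
Proof. by rewrite sqr_sqrtr ?dotp_ge0. Qed.

Lemma enorm0 : enorm 0 = 0.
Proof.
by rewrite /enorm /dotp big1 ?sqrtr0// => i _; rewrite mxE mul0r.
Qed.

Lemma enormN w : enorm (- w) = enorm w.
Proof.
by congr Num.sqrt; apply: eq_bigr => i _; rewrite !mxE mulrNN.
Qed.

Lemma coord_le_enorm w i : `|w 0 i| <= enorm w.
Proof.
rewrite -sqrtr_sqr ler_sqrt ?dotp_ge0// /dotp (bigD1 i)//= -expr2 lerDl.
by apply: sumr_ge0 => j _; rewrite -expr2 sqr_ge0.
Qed.

Lemma dotp_sqr_le u w : dotp u w ^+ 2 <= dotp u u * dotp w w.
Proof.
have [w0|w0] := eqVneq (dotp w w) 0.
  suff -> : dotp u w = 0 by rewrite w0 mulr0 expr0n.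
  rewrite /dotp big1// => i _.
  have := coord_le_enorm w i; rewrite /enorm w0 sqrtr0 normr_le0 => /eqP ->.
  by rewrite mulr0.
have wp : 0 < dotp w w by rewrite lt_neqAle eq_sym w0 dotp_ge0.
rewrite -subr_ge0 -(pmulr_rge0 _ wp).
have -> : dotp w w * (dotp u u * dotp w w - dotp u w ^+ 2) =
  \sum_(i < d) (dotp w w * u 0 i - dotp u w * w 0 i) ^+ 2.
  rewrite (eq_bigr (fun i => dotp w w ^+ 2 * (u 0 i * u 0 i)
    - 2 * dotp w w * dotp u w * (u 0 i * w 0 i)
    + dotp u w ^+ 2 * (w 0 i * w 0 i))); last by move=> i _; ring.
  rewrite big_split/= sumrB -!mulr_sumr -/(dotp u u) -/(dotp u w) -/(dotp w w).
  ring.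
by apply: sumr_ge0 => i _; exact: sqr_ge0.
Qed.

Lemma enormD u w : enorm (u + w) <= enorm u + enorm w.
Proof.
rewrite -(ler_pXn2r (n := 2))// ?nnegrE ?addr_ge0 ?enorm_ge0//.
have -> : enorm (u + w) ^+ 2 = enorm u ^+ 2 + 2 * dotp u w + enorm w ^+ 2.
  rewrite !sqr_enorm {1}/dotp (eq_bigr (fun i => u 0 i * u 0 i
    + 2 * (u 0 i * w 0 i) + w 0 i * w 0 i)); last first.
    by move=> i _; rewrite !mxE; ring.
  by rewrite !big_split/= -mulr_sumr.
suff : dotp u w <= enorm u * enorm w by nra.
apply: le_trans (ler_norm _) _.
by rewrite -sqrtr_sqr -sqrtrM ?dotp_ge0// ler_sqrt ?mulr_ge0 ?dotp_ge0// dotp_sqr_le.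
Qed.

Lemma enormB_sym x y : enorm (x - y) = enorm (y - x).
Proof. by rewrite -opprB enormN. Qed.

Lemma enormB_triangle y x z : enorm (x - z) <= enorm (x - y) + enorm (y - z).
Proof. by have := enormD (x - y) (y - z); rewrite addrA subrK. Qed.

Definition convex_hull A : set 'rV[R]_d :=
  smallest (fun C : set 'rV[R]_d => convex_set C) A.

Definition affine_hull A : set 'rV[R]_d :=
  [set w | exists n (a : 'I_n -> 'rV[R]_d) (t : 'I_n -> R),
    [/\ forall i, A (a i), \sum_(i < n) t i = 1 &
        w = \sum_(i < n) t i *: a i]].

(* k-dimensional affine subspaces *)
Definition flat (k : nat) A :=
  exists (x : 'rV[R]_d) (V : 'M[R]_d),
    \rank V = k /\ A = [set w | (w - x <= V)%MS].

(* The dimension of a set is that of its affine hull. *)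
Definition has_dim (k : nat) A := flat k (affine_hull A).

Definition polytope A :=
  exists S : set 'rV[R]_d, [/\ finite_set S, S !=set0 & A = convex_hull S].

(* u = 0 is allowed, so that set0 and A are (improper) faces of A. *)
Definition face A (F : set 'rV[R]_d) :=
  exists (u : 'rV[R]_d) (a : R),
    (forall w, A w -> dotp u w <= a) /\ F = [set w | A w /\ dotp u w = a].

(* A face of dimension dim A - 1. *)
Definition facet A (F : set 'rV[R]_d) :=
  face A F /\ exists2 k : nat, has_dim k.+1 A & has_dim k F.

Definition polytope_with_facets (n : nat) : set (set 'rV[R]_d) :=
  [set A | polytope A /\ ([set F | facet A F] #= `I_n)%card].

Definition convex_body A := [/\ A !=set0, compact A & convex_set A].

Definition point_dist x A : R := inf [set enorm (x - y) | y in A].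

Definition excess A B : R := sup [set point_dist x B | x in A].

Definition hausdorff_dist A B : R := Num.max (excess A B) (excess B A).

Lemma point_dist_lb x A : lbound [set enorm (x - y) | y in A] 0.
Proof. by move=> _ [y _ <-]; exact: enorm_ge0. Qed.

Lemma point_dist_ge0 x A : A !=set0 -> 0 <= point_dist x A.
Proof.
by move=> [a Aa]; apply: lb_le_inf (@point_dist_lb x A); exists (enorm (x - a)), a.
Qed.

Lemma point_dist_le x y A : A y -> point_dist x A <= enorm (x - y).
Proof.
by move=> Ay; apply: ge_inf; [exists 0; exact: point_dist_lb|exists y].
Qed.

Lemma point_dist_adherent x A e : A !=set0 -> 0 < e ->
  exists2 y, A y & enorm (x - y) < point_dist x A + e.
Proof.
move=> [a Aa] e0.
have [||_ [y Ay <-] ye] := @inf_adherent R [set enorm (x - y) | y in A] e.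
- exact: e0.
- split; first by exists (enorm (x - a)), a.
  by exists 0; exact: point_dist_lb.
- by exists y.
Qed.

Lemma point_dist_sub x y A : A !=set0 ->
  point_dist x A <= enorm (x - y) + point_dist y A.
Proof.
move=> A0; apply/ler_addgt0Pr => e e0.
have [z Az yz] := point_dist_adherent y A0 e0.
have := point_dist_le x Az; have := enormB_triangle y x z; lra.
Qed.

Lemma compact_enorm_bounded A x : compact A ->
  exists M, forall y, A y -> enorm (y - x) <= M.
Proof.
move=> cA.
have cf : continuous (fun y : 'rV[R]_d => enorm (y - x)).
  move=> y; apply: (@continuous_comp _ _ _ (fun y => dotp (y - x) (y - x))); last first.
    exact: sqrt_continuous.
  apply: cvg_big => [||i _]; [exact: add_continuous|exact: nbhs_filter|].
  have ci : (z - x) 0 i @[z --> y] --> (y - x) 0 i.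
    have -> : (fun z : 'rV[R]_d => (z - x) 0 i) = (fun z => z 0 i - x 0 i).
      by apply/funext => z; rewrite !mxE.
    rewrite !mxE; apply: (@cvgB _ _ _ _ (nbhs_filter y)).
      by have := @coord_continuous R 1 d 0 i y.
    exact: (@cvg_cst _ _ _ _ (nbhs_filter y)).
  exact: (@cvgM _ _ (nbhs y) (nbhs_filter y) _ _ _ _ ci ci).
have /compact_bounded[M [Mr MP]] :
    compact [set enorm (y - x) | y in A].
  by apply: continuous_compact => //; exact: continuous_subspaceT.
exists (M + 1) => y Ay; apply: le_trans (ler_norm _) _.
by apply: (MP (M + 1)); [rewrite ltrDl|exists y].
Qed.

Lemma excess_ub x A B : compact A -> B !=set0 -> A x ->
  point_dist x B <= excess A B.
Proof.
move=> cA B0 Ax; apply: ub_le_sup; last by exists x.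
have [b Bb] := B0.
have [M MP] := compact_enorm_bounded b cA.
exists M => _ [y Ay <-].
exact: le_trans (point_dist_le y Bb) (MP _ Ay).
Qed.

Lemma excess_le A B M : A !=set0 -> (forall x, A x -> point_dist x B <= M) ->
  excess A B <= M.
Proof.
move=> [a Aa] AM; apply: ge_sup; first by exists (point_dist a B), a.
by move=> _ [x Ax <-]; exact: AM.
Qed.

Lemma excessxx A : A !=set0 -> compact A -> excess A A = 0.
Proof.
move=> A0 cA; apply/eqP; rewrite eq_le; apply/andP; split.
  by apply: excess_le => // x Ax; have := point_dist_le x Ax; rewrite subrr enorm0.
have [a Aa] := A0; apply: le_trans (excess_ub cA A0 Aa).
exact: point_dist_ge0.
Qed.

Lemma excess_triangle B A C : A !=set0 -> B !=set0 -> C !=set0 ->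
  compact A -> compact B -> excess A C <= excess A B + excess B C.
Proof.
move=> A0 B0 C0 cA cB; apply: excess_le => // x Ax.
apply/ler_addgt0Pr => e e0.
have [y By xy] := point_dist_adherent x B0 e0.
have := point_dist_sub x y C0; have := excess_ub cA B0 Ax.
have := excess_ub cB C0 By; lra.
Qed.

Lemma excess0_sub A B : compact A -> B !=set0 -> compact B ->
  excess A B <= 0 -> A `<=` B.
Proof.
move=> cA B0 cB AB0 x Ax.
apply: (compact_closed (@norm_hausdorff _ _) cB).
move=> U /nbhs_ballP[e /= e0 eU].
have xB : point_dist x B <= 0 by exact: le_trans (excess_ub cA B0 Ax) AB0.
have [y By xy] := point_dist_adherent x B0 e0.
exists y; split => //; apply: eU; split => // i j; rewrite (ord1 i) /ball/=.
have := coord_le_enorm (x - y) j; rewrite !mxE; lra.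
Qed.

End euclidean.

(* The space of nonempty compact convex sets with the Hausdorff metric. *)
Record body (R : realType) (d : nat) := Body {
  body_set :> set 'rV[R]_d ;
  body_setP : convex_body body_set }.

Section body_metric.
Context {R : realType} {d : nat}.
Implicit Types K L M : body R d.

HB.instance Definition _ := gen_eqMixin (body R d).
HB.instance Definition _ := gen_choiceMixin (body R d).

Let body_dist K L : R := hausdorff_dist K L.

Let bodyP K : ((K : set _) !=set0) /\ compact K.
Proof. by case: (body_setP K). Qed.

Let body_distxx K : body_dist K K = 0.
Proof.
have [K0 cK] := bodyP K.
by rewrite /body_dist /hausdorff_dist excessxx// maxxx.
Qed.

Let body_dist_eq0 K L : body_dist K L = 0 -> K = L.
Proof.
have [[K0 cK] [L0 cL]] := (bodyP K, bodyP L).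
move=> KL0; have : body_dist K L <= 0 by rewrite KL0.
rewrite /body_dist /hausdorff_dist ge_max => /andP[KL LK].
have E : body_set K = L by apply/seteqP; split; exact: excess0_sub.
case: K L E {K0 cK L0 cL KL0 KL LK} => [K pK] [L pL] /= E.
by move: pL; rewrite -E => pL; congr Body; exact: Prop_irrelevance.
Qed.

Let body_dist_sym K L : body_dist K L = body_dist L K.
Proof. exact: maxC. Qed.

Let body_dist_triangle L K M :
  body_dist K M <= body_dist K L + body_dist L M.
Proof.
have [[K0 cK] [[L0 cL] [M0 cM]]] := (bodyP K, (bodyP L, bodyP M)).
rewrite /body_dist /hausdorff_dist ge_max; apply/andP; split.
  apply: le_trans (excess_triangle K0 L0 M0 cK cL) _.
  by apply: lerD; rewrite le_max lexx.
apply: le_trans (excess_triangle M0 L0 K0 cM cL) _.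
by rewrite addrC; apply: lerD; rewrite le_max lexx orbT.
Qed.

HB.instance Definition _ := isMetric.Build R (body R d)
  body_distxx body_dist_eq0 body_dist_sym body_dist_triangle.

Lemma body_mdistE K L : mdist K L = hausdorff_dist K L.
Proof. by []. Qed.

End body_metric.

Definition borel {T : topologicalType} : set (set T) := <<s open >>.

Section laguerre.
Context {R : realType} {d : nat}.
Implicit Types (X : set ('rV[R]_d * R)%type) (x : ('rV[R]_d * R)%type).

Definition laguerre_cell X x : set 'rV[R]_d :=
  [set w | forall y, X y ->
    enorm (w - x.1) ^+ 2 + x.2 <= enorm (w - y.1) ^+ 2 + y.2].

End laguerre.

Section intensity.
Context {R : realType}.

Definition Gamma (s : R) : R :=
  \int[lebesgue_measure]_(t in `]0, +oo[) (t `^ (s - 1) * expR (- t)).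

(* Iterated integration: on Borel sets this is the d-fold product of the
   one-dimensional Lebesgue measure. *)
Fixpoint lebesgue_rV (d : nat) : set 'rV[R]_d -> \bar R :=
  match d with
  | 0 => fun A => (\1_A (0 : 'rV[R]_0))%:E
  | d'.+1 => fun A =>
      (\int[lebesgue_measure]_t
         lebesgue_rV [set w : 'rV[R]_d' | A (row_mx (t%:M : 'rV[R]_1) w)])%E
  end.

Definition beta_const (n : nat) (beta : R) : R :=
  Gamma (n%:R / 2 + beta + 1) / (pi `^ (n%:R / 2) * Gamma (beta + 1)).

Definition beta_intensity (d : nat) (gamma beta : R)
    (A : set ('rV[R]_d * R)%type) : \bar R :=
  (\int[lebesgue_measure]_(h in `[0%R, +oo[)
     ((gamma * beta_const d.+1 beta * h `^ beta)%:E *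
      lebesgue_rV [set v | A (v, h)]))%E.

End intensity.

Section point_process.
Context {R : realType} {disp : measure_display} {Omega : measurableType disp}.
Variable P : probability Omega R.
Context {T : topologicalType}.
Implicit Types (eta : Omega -> set T) (B : set T) (mu : set T -> \bar R).

Definition npoints eta B (omega : Omega) : \bar R := counting (eta omega `&` B).

(* A random locally finite set; no multiplicities, as mu is diffuse here. *)
Definition point_process eta :=
  (forall omega B, compact B -> finite_set (eta omega `&` B)) /\
  (forall B, borel B -> measurable_fun setT (npoints eta B)).

(* The Poisson probabilities are written out because the library's poisson_pmf
   takes the value 1 for every k at rate 0. *)
Definition poisson_process mu eta :=
  [/\ point_process eta,
      forall B, borel B -> (mu B < +oo)%E -> forall k : nat,
        P [set omega | npoints eta B omega = k%:R%:E] =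
        (fine (mu B) ^+ k / k`!%:R * expR (- fine (mu B)))%:E &
      forall (m : nat) (B : 'I_m -> set T), (forall i, borel (B i)) ->
        trivIset setT B ->
        forall A : 'I_m -> set (\bar R), (forall i, measurable (A i)) ->
        P (\bigcap_(i in setT) (npoints eta (B i) @^-1` A i)) =
        (\prod_(i < m) P (npoints eta (B i) @^-1` A i))%E].

End point_process.

Section typical_cell.
Context {R : realType} {d : nat}.
Context {disp disp' : measure_display}.
Context {Omega : measurableType disp} {Omega' : measurableType disp'}.
Variables (P : probability Omega R) (eta : Omega -> set ('rV[R]_d * R)%type).
Variable P' : probability Omega' R.
Implicit Types D : set ('rV[R]_d * R * body R d)%type.

Definition unit_cube : set 'rV[R]_d := [set v | forall i, 0 <= v 0 i <= 1].

(* The subspace ({o} x R) x K of (R^d x R) x K; it is closed, so its Borel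
   subsets are the Borel subsets of the whole space that it contains. *)
Definition centred_bodies : set ('rV[R]_d * R * body R d)%type :=
  [set z | z.1.1 = 0].

Definition translate D (v : 'rV[R]_d) : set ('rV[R]_d * R * set 'rV[R]_d)%type :=
  [set ((z.1.1 + v, z.1.2), [set w + v | w in body_set z.2]) | z in D].

Definition cell_intensity : \bar R :=
  (\int[P]_omega counting [set x | [/\ eta omega x, unit_cube x.1 &
     laguerre_cell (eta omega) x !=set0]])%E.

(* D := centred_bodies gives total mass 1, which rules out the values 0 and +oo
   of cell_intensity. *)
Definition typical_cell (Zhat : Omega' -> ('rV[R]_d * R * body R d)%type) :=
  [/\ forall omega, centred_bodies (Zhat omega),
      forall D, borel D -> measurable (Zhat @^-1` D) &
      forall D, borel D -> D `<=` centred_bodies ->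
        P' (Zhat @^-1` D) =
        (cell_intensity^-1 *
         \int[P]_omega counting [set x | [/\ eta omega x, unit_cube x.1 &
           translate D x.1 (x, laguerre_cell (eta omega) x)]])%E].

End typical_cell.

(* Main.v *)
Require Import Defs.
From HB Require Import structures.
From mathcomp Require Import finmap.
From mathcomp Require Import all_boot all_order all_algebra.
From mathcomp Require Import all_classical all_reals all_analysis.
From mathcomp Require Import measurable_realfun borel_hierarchy.
From mathcomp Require Import ring lra zify.
Set Implicit Arguments.
Unset Strict Implicit.
Unset Printing Implicit Defensive.
Import Order.TTheory GRing.Theory Num.Theory.
Import numFieldNormedType.Exports.
Local Open Scope classical_set_scope.
Local Open Scope ring_scope.

(** The expected number of cells in the definition of the typical cell is bounded
    from below by the probability of one explicit configuration of sites around
    the origin that forces a cell to have exactly [n] facets.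

    Write [n = d + m] and choose [rho] with [rho ^ (d + 2 + 2 beta) = n]; then a set
    of width [rho] and height [rho ^ 2] has intensity of order [n]. The
    configuration has one core site of small height near the origin, [d] coarse
    sites near the points [- rho e_k], and [m] fine sites. The coarse sites confine
    the core cell to a translated orthant. The fine ones lie in [m] directions of
    the positive orthant that are separated by [delta], of order
    [n ^ (- 1 / (d - 1))], and their heights make the bisector with the core nearly
    tangent to the sphere of radius [rho]. If the errors are small against
    [delta ^ 2], each of the [n] constraints is violated by a point satisfying the
    others strictly. So none is redundant, and the core cell, which is bounded, is a
    polytope with exactly [n] facets ([polyhedron_facets], [cell_polytope]). It has
    diameter of order [rho]: only the sites in a region of intensity at most [C n]
    could cut it ([laguerre_cell_pattern], [beta_intensity_region]).

    Hence the cell appears as soon as each box holds one site and the rest of the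
    region is empty. By independence the probability of this is the product of the
    intensities of the boxes times the exponential of minus the intensity of the
    region ([poisson_pattern]), and the latter is at least [exp (- C n)]. A fine
    site has room [rho delta] in each of [d - 1] directions, [rho delta ^ 2]
    radially and [rho ^ 2] in height. The intensity of its box is therefore of order
    [n delta ^ (d - 1) delta ^ 2], at least a multiple of [n ^ (- 2 / (d - 1))]
    ([fine_shell_measure]). The coarse boxes have intensity bounded from below, and
    the core box only contributes a fixed power of [n], so all other factors are
    exponential at worst.

    Two points concern the definition of the typical cell. Its total mass is one,
    so the expected number of cells is positive and finite, and the constant in the
    intensity is positive ([cell_intensity_fin_pos], [intensity_factor_gt0]). And
    its distribution is only given on Borel sets, so polytopes with [n] facets have
    to form one ([borel_polytope_with_facets]). They are the polytopes with at least
    [n] but not with at least [n + 1] facets. Those with at least [n] facets are a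
    countable union of closed sets, as the image, under the continuous map from
    point configurations to their hulls, of configurations for which [n] hyperplanes
    support different facets; this is expressed by equations, inequalities and
    ranks. *)

(** * Inner products, convex hulls and dimension *)

Section dot_product.
Context {R : realType} {d : nat}.
Implicit Types (u w x y : 'rV[R]_d).

Lemma dotpC u w : dotp u w = dotp w u.
Proof. by apply: eq_bigr => i _; rewrite mulrC. Qed.

Lemma dotpDr u x y : dotp u (x + y) = dotp u x + dotp u y.
Proof. by rewrite -big_split; apply: eq_bigr => i _; rewrite mxE mulrDr. Qed.

Lemma dotpZr u (t : R) x : dotp u (t *: x) = t * dotp u x.
Proof. by rewrite mulr_sumr; apply: eq_bigr => i _; rewrite mxE mulrCA. Qed.

Lemma dotp0r u : dotp u 0 = 0.
Proof. by rewrite -(scale0r 0) dotpZr mul0r. Qed.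

Lemma dotpNr u x : dotp u (- x) = - dotp u x.
Proof. by rewrite -scaleN1r dotpZr mulN1r. Qed.

Lemma dotpBr u x y : dotp u (x - y) = dotp u x - dotp u y.
Proof. by rewrite dotpDr dotpNr. Qed.

Lemma dotpDl u x y : dotp (x + y) u = dotp x u + dotp y u.
Proof. by rewrite !(dotpC _ u) dotpDr. Qed.

Lemma dotpZl u (t : R) x : dotp (t *: x) u = t * dotp x u.
Proof. by rewrite !(dotpC _ u) dotpZr. Qed.

Lemma dotpBl u x y : dotp (x - y) u = dotp x u - dotp y u.
Proof. by rewrite !(dotpC _ u) dotpBr. Qed.

Lemma dotp_sumr u (I : Type) (r : seq I) (P : pred I) (F : I -> 'rV[R]_d) :
  dotp u (\sum_(i <- r | P i) F i) = \sum_(i <- r | P i) dotp u (F i).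
Proof. by apply: (big_morph _ (dotpDr u) (dotp0r u)). Qed.

Lemma dotp_eq0 u : dotp u u = 0 -> u = 0.
Proof.
move=> u0; apply/rowP => i; rewrite mxE.
by have := coord_le_enorm u i; rewrite /enorm u0 sqrtr0 normr_le0 => /eqP.
Qed.

Lemma mulmx_tr_dotp u w : u *m w^T = (dotp u w)%:M.
Proof.
apply/matrixP => i j; rewrite !ord1 !mxE mulr1n.
by apply: eq_bigr => k _; rewrite mxE.
Qed.

Lemma continuous_dotp u : continuous (dotp u).
Proof.
move=> x; apply: cvg_big => [||i _]; [exact: add_continuous|exact: nbhs_filter|].
by apply: (@cvgM _ _ (nbhs x) _ (fun=> u 0 i)); [exact: cvg_cst|have := @coord_continuous R 1 d 0 i x].
Qed.

Lemma enormZ (t : R) x : 0 <= t -> enorm (t *: x) = t * enorm x.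
Proof.
move=> t0; rewrite /enorm dotpZl dotpZr mulrA -expr2 sqrtrM ?sqr_ge0//.
by rewrite sqrtr_sqr ger0_norm.
Qed.

End dot_product.

Section convexity.
Context {R : realType} {d : nat}.
Implicit Types (u w x y : 'rV[R]_d) (A : set 'rV[R]_d).

Lemma convex_setP A : convex_set A <->
  forall x y (t : R), 0 <= t <= 1 -> A x -> A y -> A (t *: x + (1 - t) *: y).
Proof.
split=> [cA x y t /andP[t0 t1] Ax Ay|cA x y l].
  have tP : Itv.spec (@Itv.num_sem R) (Itv.Real `[0, 1]%Z) t.
    by apply/and3P; split; rewrite ?ger0_real//= in_itv/= t0.
  have := cA x y (Itv.mk tP).
  by rewrite !inE; apply.
by rewrite !inE => Ax Ay; apply: (cA x y l%:num) => //; rewrite ge0 le1.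
Qed.

Definition simplex (n : nat) : set ('I_n -> R) :=
  [set t | (forall i, 0 <= t i) /\ \sum_i t i = 1].

Definition hull_of (n : nat) (a : 'I_n -> 'rV[R]_d) : set 'rV[R]_d :=
  [set w | exists2 t, simplex t & w = \sum_i t i *: a i].

Lemma convex_set_sum A n (a : 'I_n -> 'rV[R]_d) (t : 'I_n -> R) :
  convex_set A -> (forall i, t i != 0 -> A (a i)) -> simplex t ->
  A (\sum_i t i *: a i).
Proof.
move=> /convex_setP cA; elim: n a t => [|n IH] a t Aa [t0 t1].
  by move: t1; rewrite big_ord0 => /eqP; rewrite eq_sym oner_eq0.
rewrite big_ord_recl; move: t1; rewrite big_ord_recl => t1.
have [s0|s0] := eqVneq (\sum_(i < n) t (lift ord0 i)) 0.
  have ti i : t (lift ord0 i) = 0.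
    have /psumr_eq0P := s0; apply => // j _; exact: t0.
  rewrite big1 ?addr0 => [|i _]; last by rewrite ti scale0r.
  move: t1; rewrite s0 addr0 => t1; rewrite t1 scale1r; apply: Aa.
  by rewrite t1 oner_eq0.
set s := \sum_(i < n) _ in t1 s0.
have sE : s = 1 - t ord0 by rewrite -t1 addrC addKr.
have sp : 0 < s by rewrite lt_neqAle eq_sym s0; apply: sumr_ge0.
have -> : \sum_(i < n) t (lift ord0 i) *: a (lift ord0 i) =
    (1 - t ord0) *: \sum_(i < n) (t (lift ord0 i) / s) *: a (lift ord0 i).
  rewrite scaler_sumr; apply: eq_bigr => i _.
  by rewrite scalerA -sE mulrC divfK.
have IHn : A (\sum_(i < n) (t (lift ord0 i) / s) *: a (lift ord0 i)).
  apply: IH => [i|]; last first.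
    split=> [i|]; first by rewrite divr_ge0// ltW.
    by rewrite -mulr_suml divff.
  by rewrite mulf_eq0 negb_or => /andP[+ _]; exact: Aa.
have [t00|t00] := eqVneq (t ord0) 0.
  by rewrite t00 scale0r add0r subr0 scale1r.
by apply: cA => //; [rewrite t0/= -subr_ge0 -sE ltW|exact: Aa].
Qed.

Lemma hull_of_convex n (a : 'I_n -> 'rV[R]_d) : convex_set (hull_of a).
Proof.
apply/convex_setP => x y t /andP[t0 t1] [s [s0 s1] ->] [r [r0 r1] ->].
exists (fun i => t * s i + (1 - t) * r i).
  split=> [i|]; first by rewrite addr_ge0// mulr_ge0// subr_ge0.
  by rewrite big_split/= -!mulr_sumr s1 r1 !mulr1 addrC subrK.
rewrite !scaler_sumr -big_split; apply: eq_bigr => i _.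
by rewrite !scalerA scalerDl.
Qed.

Lemma simplex_delta n (i : 'I_n) : simplex (fun j => (j == i)%:R).
Proof.
split=> [j|]; first exact: ler0n.
by rewrite (bigD1 i)//= eqxx big1 ?addr0// => j /negbTE ->.
Qed.

Lemma sum_delta n (a : 'I_n -> 'rV[R]_d) i :
  \sum_j (j == i)%:R *: a j = a i.
Proof.
rewrite (bigD1 i)//= eqxx scale1r big1 ?addr0// => j /negbTE ->.
by rewrite scale0r.
Qed.

Lemma hull_of_in n (a : 'I_n -> 'rV[R]_d) i : hull_of a (a i).
Proof. by exists (fun j => (j == i)%:R); rewrite ?sum_delta//; exact: simplex_delta. Qed.

(** Convex combinations, unlike the smallest convex superset, depend continuously
    on the points. *)
Lemma convex_hullE n (a : 'I_n -> 'rV[R]_d) :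
  convex_hull (range a) = hull_of a.
Proof.
apply/seteqP; split=> [w|w [t st ->]].
  apply; split; first exact: hull_of_convex.
  by move=> _ [i _ <-]; exact: hull_of_in.
move=> C [cC aC]; apply: convex_set_sum => // i _.
by apply: aC; exists i.
Qed.

Lemma convex_set0 : convex_set (set0 : set 'rV[R]_d).
Proof. exact/convex_setP. Qed.

Lemma convex_hull_sub A : A `<=` convex_hull A.
Proof. exact: sub_smallest. Qed.

Lemma convex_hull_convex A : convex_set (convex_hull A).
Proof.
apply/convex_setP => x y t t01 Ax Ay C [cC AC].
by have /convex_setP := cC; apply => //; [exact: Ax|exact: Ay].
Qed.

Lemma polytopeP A :
  polytope A <-> exists n (a : 'I_n.+1 -> 'rV[R]_d), A = hull_of a.
Proof.
split=> [[S [fS [s0 Ss0] ->]]|[n [a ->]]]; last first.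
  exists (range a); split; [exact: finite_image|by exists (a ord0), ord0|].
  by rewrite convex_hullE.
have /finite_seqP[s Es] := fS.
have s0s : s0 \in s by move: Ss0; rewrite Es.
exists (size s).-1, (fun i => nth s0 s i); rewrite -convex_hullE; congr convex_hull.
rewrite Es; apply/seteqP; split=> [x /= xs|_ [i _ <-]].
  have := xs; rewrite -index_mem => xs'.
  have szs : (index x s < (size s).-1.+1)%N by case: (size s) xs'.
  by exists (Ordinal szs) => //=; rewrite nth_index.
by apply: mem_nth; apply: leq_trans (ltn_ord i) _; rewrite prednK//; case: (s) s0s.
Qed.

End convexity.

Section dimension.
Context {R : realType} {d : nat}.
Implicit Types (u w x y : 'rV[R]_d) (A B : set 'rV[R]_d) (V : 'M[R]_d).

Lemma affine_hull_sub_flat A x V : A `<=` [set w | (w - x <= V)%MS] ->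
  affine_hull A `<=` [set w | (w - x <= V)%MS].
Proof.
move=> AV _ [n [a [t [Aa t1 ->]]]] /=.
have -> : \sum_(i < n) t i *: a i - x = \sum_(i < n) t i *: (a i - x).
  under [RHS]eq_bigr do rewrite scalerBr.
  by rewrite sumrB -scaler_suml t1 scale1r.
by apply: summx_sub => i _; apply: scalemx_sub; exact: AV.
Qed.

Lemma flat_dir_sub x x' V V' : [set w | (w - x <= V)%MS] `<=` [set w | (w - x' <= V')%MS] ->
  (V <= V')%MS.
Proof.
move=> sub; apply/row_subP => i.
have h1 : (x - x' <= V')%MS by apply: sub; rewrite /= subrr sub0mx.
have h2 : (x + row i V - x' <= V')%MS.
  by apply: sub => /=; rewrite addrC addKr row_sub.
have -> : row i V = (x + row i V - x') - (x - x').
  by rewrite opprB addrA subrK [x + _]addrC addrK.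
by rewrite addmx_sub// eqmx_opp.
Qed.

Lemma flat_sub_eq k k' A B : flat k A -> flat k' B -> A `<=` B ->
  (k <= k')%N /\ (k = k' -> A = B).
Proof.
move=> [x [V [rV ->]]] [x' [V' [rV' ->]]] AB.
have VV' := flat_dir_sub AB; split; first by rewrite -rV -rV' mxrankS.
move=> kk'; apply/seteqP; split => // w /= wx'.
have V'V : (V' <= V)%MS by rewrite -(mxrank_leqif_sup VV').2 rV rV' kk'.
have h1 : (x - x' <= V')%MS by apply: AB; rewrite /= subrr sub0mx.
have -> : w - x = (w - x') - (x - x') by rewrite opprB addrA subrK.
by apply: submx_trans V'V; rewrite addmx_sub// eqmx_opp.
Qed.

Lemma flat_dim_uniq k k' A : flat k A -> flat k' A -> k = k'.
Proof.
move=> kA k'A; apply/eqP; rewrite eqn_leq.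
by rewrite (flat_sub_eq kA k'A _).1// (flat_sub_eq k'A kA _).1.
Qed.

(** A set has the dimension of a flat that contains it as soon as it contains,
    around one of its points, a nontrivial dilation of every point of the flat:
    that point of the flat is then an affine combination of two points. *)
Lemma has_dim_dilation k A x V z : \rank V = k ->
  A `<=` [set w | (w - x <= V)%MS] -> A z ->
  (forall w, (w - x <= V)%MS -> exists2 s : R, s != 0 & A (z + s *: (w - z))) ->
  has_dim k A.
Proof.
move=> rV AV Az dil; exists x, V; split => //; apply/seteqP; split.
  exact: affine_hull_sub_flat.
move=> w /= /dil[s s0 As].
exists 2%N, (fun i : 'I_2 => if i == ord0 then z else z + s *: (w - z)),
  (fun i : 'I_2 => if i == ord0 then 1 - s^-1 else s^-1); split.
- by move=> i; case: ifP.
- by rewrite big_ord_recl big_ord1 /= subrK.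
- rewrite big_ord_recl big_ord1 /= scalerDr scalerA mulVf// scale1r.
  by rewrite scalerBl scale1r addrA subrK subrKC.
Qed.

Lemma has_dim_ne k (A : set 'rV[R]_d) : has_dim k A -> A !=set0.
Proof.
move=> [y [V [_]]] /seteqP[_ /(_ y)] /=; rewrite subrr sub0mx => /(_ isT).
move=> [n [p [t [pA t1 _]]]]; case: n p t pA t1 => [p t _|n p t pA _].
  by rewrite big_ord0 => /eqP; rewrite eq_sym oner_eq0.
by exists (p ord0).
Qed.


Lemma hyperplane_flat u (b : R) x : u != 0 -> dotp u x = b ->
  \rank (kermx u^T) = d.-1 /\
  [set w | dotp u w = b] = [set w | (w - x <= kermx u^T)%MS].
Proof.
move=> u0 uxb; split.
  rewrite mxrank_ker mxrank_tr.
  have -> : \rank u = 1%N.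
    apply/eqP; rewrite eqn_leq rank_leq_row/= lt0n mxrank_eq0.
    exact: u0.
  by rewrite subn1.
have memE w : (w - x <= kermx u^T)%MS = (dotp u w == b).
  apply/sub_kermxP/eqP.
    rewrite mulmx_tr_dotp dotpC dotpBr uxb => /matrixP/(_ 0 0).
    by rewrite !mxE mulr1n => /subr0_eq.
  move=> uw; rewrite mulmx_tr_dotp dotpC dotpBr uxb uw subrr.
  by apply/matrixP => i j; rewrite !mxE mul0rn.
by apply/seteqP; split=> w /=; rewrite memE => /eqP.
Qed.

End dimension.

(** * Bounded polyhedra and their facets *)

Section polyhedron.
Context {R : realType} {d N : nat}.
Variables (a : 'I_N -> 'rV[R]_d) (b : 'I_N -> R).
Implicit Types (u w x y z : 'rV[R]_d).

Definition polyhedron : set 'rV[R]_d := [set w | forall j, dotp (a j) w <= b j].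

Lemma polyhedron_convex : convex_set polyhedron.
Proof.
apply/convex_setP => x y t /andP[t0 t1] Px Py j.
rewrite dotpDr !dotpZr; have := Px j; have := Py j; nra.
Qed.

Lemma polyhedron_closed : closed polyhedron.
Proof.
have -> : polyhedron = \bigcap_(j in setT) (dotp (a j) @^-1` [set r | r <= b j]).
  by apply/seteqP; split=> [w Pw j _|w Pw j]; [exact: Pw|exact: (Pw j I)].
apply: closed_bigI => j _; apply: preimage_closed => [x _|]; last exact: closed_le.
exact: continuous_dotp.
Qed.

(** All slacks are positive, so that a step below each slack divided by the rate at
    which it is consumed is admissible; [S^-1] is such a step. *)
Lemma dilation_strict (P : pred 'I_N) z w :
  (forall j, P j -> dotp (a j) z < b j) ->
  exists2 s : R, 0 < s & forall j, P j -> dotp (a j) (z + s *: (w - z)) <= b j.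
Proof.
move=> zP; pose c j := `|dotp (a j) (w - z)| / (b j - dotp (a j) z).
pose S := 1 + \sum_(j | P j) c j.
have c0 j : P j -> 0 <= c j.
  by move=> Pj; rewrite divr_ge0// ltW// subr_gt0 zP.
have S1 : 1 <= S by rewrite lerDl sumr_ge0.
have S0 : 0 < S by lra.
exists S^-1 => [|j Pj]; first by rewrite invr_gt0.
rewrite dotpDr dotpZr -lerBrDl.
apply: le_trans (_ : S^-1 * `|dotp (a j) (w - z)| <= _).
  by rewrite ler_wpM2l ?ler_norm// invr_ge0 ltW.
rewrite ler_pdivrMl// -ler_pdivrMr ?subr_gt0 ?zP//.
rewrite /S (bigD1 j)//= -/(c j).
have : 0 <= \sum_(i | P i && (i != j)) c i.
  by apply: sumr_ge0 => i /andP[/c0].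
lra.
Qed.

Hypothesis b0 : forall j, 0 < b j.

Lemma polyhedron0 : polyhedron 0.
Proof. by move=> j; rewrite dotp0r ltW. Qed.

Lemma polyhedron_has_dim : has_dim d polyhedron.
Proof.
apply: (@has_dim_dilation _ _ _ _ 0 1%:M 0); rewrite ?mxrank1//.
- by move=> w _ /=; exact: submx1.
- exact: polyhedron0.
move=> w _; have [j _|s s0 sP] := @dilation_strict predT 0 w.
  by rewrite dotp0r.
by exists s; rewrite ?gt_eqF// => j; exact: sP.
Qed.

Section vertices.
Variable M : R.
Hypothesis bounded : forall w, polyhedron w -> forall i, `|w 0 i| <= M.

Definition active w : 'M[R]_(N, d) :=
  \matrix_j (if dotp (a j) w == b j then a j else 0).

Definition vertex : set 'rV[R]_d := [set w | polyhedron w /\ \rank (active w) = d].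

Lemma row_active w j : row j (active w) = if dotp (a j) w == b j then a j else 0.
Proof. exact: rowK. Qed.

(** A vertex is the only solution of its active equations, hence determined by
    the set of these. *)
Lemma vertex_finite : finite_set vertex.
Proof.
pose f (I : {set 'I_N}) : 'rV[R]_d :=
  xget 0 [set w | vertex w /\ [set j | dotp (a j) w == b j]%SET = I].
apply: (@sub_finite_set _ _ (f @` setT)); last exact: finite_image.
move=> w vw; exists [set j | dotp (a j) w == b j]%SET => //.
rewrite /f; case: xgetP => [w' _ [/= [Pw' rw'] E]|/(_ w)]; last by case.
have act j : (dotp (a j) w' == b j) = (dotp (a j) w == b j).
  by have /setP/(_ j) := E; rewrite !inE.
case: vw => Pw rw.
have : (w' - w)^T = 0.
  have rf : row_full (active w) by rewrite /row_full rw.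
  have /row_fullP[B BA] := rf.
  rewrite -[LHS]mul1mx -BA -mulmxA; suff -> : active w *m (w' - w)^T = 0.
    by rewrite mulmx0.
  apply/row_matrixP => j; rewrite row_mul row0 row_active.
  case: ifP => [wj|_]; last by rewrite mul0mx.
  rewrite mulmx_tr_dotp dotpBr; have := wj; rewrite -act => /eqP ->.
  by rewrite (eqP wj) subrr; apply/matrixP => p q; rewrite !mxE mul0rn.
by move=> /(congr1 trmx); rewrite trmxK trmx0 => /subr0_eq.
Qed.

(** Following a direction orthogonal to all active normals, a point reaches,
    since the polyhedron is bounded, a new active constraint. *)
Lemma next_active w u : polyhedron w -> u != 0 -> active w *m u^T = 0 ->
  exists2 t : R, 0 <= t & polyhedron (w + t *: u) /\
    (\rank (active w) < \rank (active (w + t *: u)))%N.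
Proof.
move=> Pw u0 actu.
have actu0 j : dotp (a j) w = b j -> dotp (a j) u = 0.
  move=> /eqP wj; have /(congr1 (row j)) := actu.
  rewrite row_mul row_active wj row0 mulmx_tr_dotp => /matrixP/(_ 0 0).
  by rewrite !mxE mulr1n.
have [j0 j0P] : exists j, 0 < dotp (a j) u.
  apply: contrapT => /forallNP uneg.
  have Pt (t : R) : 0 <= t -> polyhedron (w + t *: u).
    move=> t0 j; rewrite dotpDr dotpZr.
    by have := Pw j; have /negP := uneg j; rewrite -leNgt; nra.
  have [i ui] : exists i, u 0 i != 0.
    by apply/existsP; apply: contraNT u0; rewrite negb_exists => /forallP u0;
       apply/eqP/rowP => i; apply/eqP; rewrite mxE; have := u0 i; rewrite negbK.
  have ui0 : 0 < `|u 0 i| by rewrite normr_gt0.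
  have M0 : 0 <= M := le_trans (normr_ge0 _) (bounded Pw i).
  pose t := (2 * M + 1) / `|u 0 i|.
  have t0 : 0 <= t by rewrite divr_ge0//; lra.
  have := bounded (Pt t t0) i; rewrite !mxE => wtu.
  have : `|t * u 0 i| = 2 * M + 1.
    by rewrite normrM (ger0_norm t0) /t divfK// gt_eqF.
  have := bounded Pw i; have := ler_normB (w 0 i + t * u 0 i) (w 0 i).
  rewrite addrC addKr; lra.
pose F j := (b j - dotp (a j) w) / dotp (a j) u.
case: (@arg_minP _ _ _ j0 (fun j => 0 < dotp (a j) u) F) => //= j1 j1P minF.
exists (F j1); first by apply: divr_ge0; [rewrite subr_ge0; exact: Pw|exact: ltW].
have F0 : 0 <= F j1 by apply: divr_ge0; [rewrite subr_ge0; exact: Pw|exact: ltW].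
have PF : polyhedron (w + F j1 *: u).
  move=> j; rewrite dotpDr dotpZr; have [uj|uj] := ltP 0 (dotp (a j) u).
    by rewrite -lerBrDl -ler_pdivlMr// minF.
  by have := Pw j; nra.
split => //; suff : (active w < active (w + F j1 *: u))%MS.
  by rewrite ltmxErank => /andP[].
apply/andP; split.
  apply/row_subP => j; rewrite row_active; case: ifP => [/eqP wj|_]; last exact: sub0mx.
  have <- : row j (active (w + F j1 *: u)) = a j.
    by rewrite row_active dotpDr dotpZr wj actu0// mulr0 addr0 eqxx.
  exact: row_sub.
apply/negP => sub.
have : (a j1 <= active w)%MS.
  apply: submx_trans sub.
  have <- : row j1 (active (w + F j1 *: u)) = a j1.
    rewrite row_active dotpDr dotpZr ifT//.
    by rewrite /F divfK ?subrKC// gt_eqF.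
  exact: row_sub.
move=> /submxP[D Dj]; have : a j1 *m u^T = 0 by rewrite Dj -mulmxA actu mulmx0.
rewrite mulmx_tr_dotp => /matrixP/(_ 0 0); rewrite !mxE mulr1n => /eqP.
by rewrite gt_eqF.
Qed.

(** Induction on the corank of the active normals: a point other than a vertex
    lies on a segment whose two ends have more active constraints. *)
Lemma polyhedron_hull : polyhedron = convex_hull vertex.
Proof.
apply/seteqP; split; last first.
  by apply: smallest_sub; [exact: polyhedron_convex|move=> w []].
suff H k w : (d - \rank (active w) <= k)%N -> polyhedron w -> convex_hull vertex w.
  by move=> w; exact: H (leqnn _).
elim: k w => [|k IH] w rk Pw.
  apply: convex_hull_sub; split => //; apply/eqP.
  by rewrite eqn_leq rank_leq_col -subn_eq0 -leqn0.
have [rw|rw] := eqVneq (\rank (active w)) d; first exact: convex_hull_sub.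
have [u u0 actu] : exists2 u : 'rV[R]_d, u != 0 & active w *m u^T = 0.
  have : kermx (active w)^T != 0.
    rewrite -mxrank_eq0 mxrank_ker mxrank_tr -lt0n subn_gt0 ltn_neqAle rw.
    exact: rank_leq_col.
  case/rowV0Pn => u /sub_kermxP uk u0; exists u => //.
  by rewrite -[LHS]trmxK trmx_mul trmxK uk trmx0.
have IHw w' : (\rank (active w) < \rank (active w'))%N -> polyhedron w' ->
    convex_hull vertex w'.
  move=> rww' Pw'; apply: IH => //; have := rank_leq_col (active w'); lia.
have [t t0 [Pt rt]] := next_active Pw u0 actu.
have [||s s0 [Ps rs]] := next_active Pw (u := - u).
- by rewrite oppr_eq0.
- by rewrite linearN/= mulmxN actu oppr0.
have [ts0|ts0] := eqVneq (t + s) 0.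
  have t00 : t = 0 by lra.
  by move: rt; rewrite t00 scale0r addr0 ltnn.
have tsp : 0 < t + s by rewrite lt_neqAle eq_sym ts0 addr_ge0.
have -> : w = (s / (t + s)) *: (w + t *: u) + (1 - s / (t + s)) *: (w + s *: - u).
  rewrite !scalerDr addrACA -scalerDl subrKC scale1r -[LHS]addr0; congr (_ + _).
  rewrite !scalerA scalerN -scalerBl.
  have -> : s / (t + s) * t - (1 - s / (t + s)) * s = 0 by field.
  by rewrite scale0r.
have /convex_setP := @convex_hull_convex R d vertex; apply.
- apply/andP; split; first by apply: divr_ge0 => //; exact: ltW.
  by rewrite ler_pdivrMr// mul1r; lra.
- exact: IHw.
- exact: IHw.
Qed.

Lemma polyhedron_polytope : polytope polyhedron.
Proof.
exists vertex; split; [exact: vertex_finite| |exact: polyhedron_hull].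
apply/set0P/eqP => v0; have := polyhedron0; rewrite polyhedron_hull v0.
by move=> /(_ set0); apply; split => //; exact: convex_set0.
Qed.

Lemma polyhedron_body : convex_body polyhedron.
Proof.
split; [by exists 0; exact: polyhedron0| |exact: polyhedron_convex].
apply: bounded_closed_compact; last exact: polyhedron_closed.
exists `|M|; split; first exact: num_real.
move=> r Mr w /= Pw; rewrite [(`|w|)]mx_normrE.
apply: bigmax_le => [|[i j] _ /=]; first by apply: le_trans (ltW Mr).
rewrite (ord1 i); apply: le_trans (bounded Pw j) _.
by apply: le_trans (ler_norm _) (ltW Mr).
Qed.

End vertices.

Section facets.
(** No inequality is redundant: the point [x j] violates only the [j]-th one. *)
Variable x : 'I_N -> 'rV[R]_d.
Hypothesis xj : forall j, b j < dotp (a j) (x j).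
Hypothesis xi : forall i j, i != j -> dotp (a i) (x j) < b i.

Definition facet_of j : set 'rV[R]_d := [set w | polyhedron w /\ dotp (a j) w = b j].

(** The segment from the origin to [x j] leaves the polyhedron at [z j], through
    the [j]-th hyperplane alone; hence this hyperplane cuts out a facet. *)
Let z j := (b j / dotp (a j) (x j)) *: x j.

Let ax0 j : 0 < dotp (a j) (x j).
Proof. by have := b0 j; have := xj j; lra. Qed.

Let zj j : dotp (a j) (z j) = b j.
Proof. by rewrite dotpZr divfK// gt_eqF. Qed.

Let zi i j : i != j -> dotp (a i) (z j) < b i.
Proof.
move=> ij; rewrite dotpZr; have := xi ij; have := b0 i; have := b0 j.
have t1 : b j / dotp (a j) (x j) < 1 by rewrite ltr_pdivrMr// mul1r.
have t0 : 0 < b j / dotp (a j) (x j) by rewrite divr_gt0.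
move: t1 t0; set t := _ / _ => t1 t0 bj bi.
have [|] := ltP 0 (dotp (a i) (x j)); nra.
Qed.

Let Pz j : polyhedron (z j).
Proof. by move=> i; have [->|/zi/ltW//] := eqVneq i j; rewrite zj. Qed.

Let a_neq0 j : a j != 0.
Proof. by apply/eqP => aj0; have := ax0 j; rewrite aj0 dotpC dotp0r ltxx. Qed.

Let aff_facet j : has_dim d.-1 (facet_of j) /\
  flat d.-1 [set w | dotp (a j) w = b j].
Proof.
have [rk E] := hyperplane_flat (a_neq0 j) (zj j).
split; last by exists (z j), (kermx (a j)^T).
apply: (has_dim_dilation (x := z j) (z := z j) rk).
- by rewrite -E => w [].
- by split => //; exact: zj.
move=> w wE; have {wE} : [set w | dotp (a j) w = b j] w by rewrite E.
move=> /= wj.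
have [i /=|s s0 sP] := @dilation_strict [pred i | i != j] (z j) w; first exact: zi.
have sj : dotp (a j) (z j + s *: (w - z j)) = b j.
  by rewrite dotpDr dotpZr dotpBr zj wj subrr mulr0 addr0.
exists s; rewrite ?gt_eqF//; split => // i; have [->|ij] := eqVneq i j.
  by rewrite sj.
exact: sP.
Qed.

Let d_gt0 (j : 'I_N) : (0 < d)%N.
Proof. by rewrite lt0n; apply/eqP => d0; have := ax0 j; rewrite /dotp big1 ?ltxx// => i _; have := ltn_ord i; rewrite {2}d0. Qed.

Lemma facet_ofP j : facet polyhedron (facet_of j).
Proof.
split; first by exists (a j), (b j); split => // w; exact.
exists d.-1; last exact: (aff_facet j).1.
by rewrite prednK ?(d_gt0 j)//; exact: polyhedron_has_dim.
Qed.

Lemma facet_of_inj : injective facet_of.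
Proof.
move=> i j E; apply/eqP; apply: contraT => ij.
have : facet_of i (z i) by split => //; exact: zj.
by rewrite E => -[_] jz; have := zi (i := j) (j := i); rewrite eq_sym ij jz ltxx => /(_ isT).
Qed.

(** A facet cannot meet the interior, so by convexity it lies in one of the
    bounding hyperplanes; both span the same hyperplane. *)
Lemma facet_polyhedronP F : facet polyhedron F -> exists j, F = facet_of j.
Proof.
move=> [[u [c [uc FE]]] [k dP dF]].
have kd : k.+1 = d by exact: flat_dim_uniq dP polyhedron_has_dim.
have Fne : F !=set0 := has_dim_ne dF.
have FP w : F w -> polyhedron w by rewrite FE => -[].
have [j Fj] : exists j, F `<=` [set w | dotp (a j) w = b j].
  apply: contrapT => /forallNP Fn.
  have {}Fn j : exists w, F w /\ dotp (a j) w < b j.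
    have /existsNP[w /not_implyP[Fw wj]] := Fn j.
    by exists w; split => //; rewrite lt_neqAle; apply/andP; split; [exact/eqP|exact: FP].
  have {Fn}[y yF] := choice Fn.
  have [f Ff] := Fne.
  pose p (i : 'I_N.+1) := if unlift ord0 i is Some j then y j else f.
  pose q : R := N.+1%:R^-1.
  have q0 : 0 < q by rewrite invr_gt0 ltr0n.
  have qs : simplex (fun _ : 'I_N.+1 => q).
    split=> [_|]; first exact: ltW.
    by rewrite sumr_const card_ord -mulr_natl divff// pnatr_eq0.
  have pF i : F (p i) by rewrite /p; case: unliftP => [j _|_//]; have [] := yF j.
  pose m := \sum_i q *: p i.
  have um : dotp u m = c.
    rewrite dotp_sumr (eq_bigr (fun=> q * c)).
      by rewrite -mulr_suml qs.2 mul1r.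
    by move=> i _; rewrite dotpZr; have := pF i; rewrite FE => -[_ ->].
  have mi j : dotp (a j) m < b j.
    rewrite dotp_sumr -[ltRHS]mul1r -qs.2 mulr_suml.
    rewrite (bigD1 (lift ord0 j))//= [ltRHS](bigD1 (lift ord0 j))//=.
    apply: ltr_leD.
      by rewrite dotpZr ltr_pM2l// /p liftK; have [] := yF j.
    by apply: ler_sum => i _; rewrite dotpZr ler_pM2l//; exact: FP.
  have c0 : u = 0.
    have [i _|s s0 sP] := @dilation_strict predT m (m + u); first exact: mi.
    have := uc (m + s *: (m + u - m)) (fun j => sP j isT).
    rewrite dotpDr um dotpZr [m + u]addrC addrK gerDl pmulr_rle0// => uu.
    by apply: dotp_eq0; apply/eqP; rewrite eq_le uu dotp_ge0.
  have FP' : F = polyhedron.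
    rewrite FE; apply/seteqP; split=> w; first by case.
    by move: um; rewrite c0 dotpC dotp0r => <- ?; split => //; rewrite dotpC dotp0r.
  by move: dF; rewrite FP' => /(flat_dim_uniq dP)/eqP; rewrite eqn_leq ltnn.
exists j; have [rk hE] := hyperplane_flat (a_neq0 j) (zj j).
have affj : affine_hull F = [set w | dotp (a j) w = b j].
  have sub : affine_hull F `<=` [set w | dotp (a j) w = b j].
    by rewrite hE; apply: affine_hull_sub_flat; rewrite -hE.
  by apply: (flat_sub_eq dF (aff_facet j).2 sub).2; rewrite -kd.
apply/seteqP; split=> [w Fw|w [Pw wj]]; first by split; [exact: FP|exact: Fj].
rewrite FE; split => //.
have : affine_hull F w by rewrite affj.
move=> [n [p [t [pF t1 ->]]]]; rewrite dotp_sumr (eq_bigr (fun i => t i * c)).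
  by rewrite -mulr_suml t1 mul1r.
by move=> i _; rewrite dotpZr; have := pF i; rewrite FE => -[_ ->].
Qed.

Lemma polyhedron_facets (M : R) :
  (forall w, polyhedron w -> forall i, `|w 0 i| <= M) ->
  polytope_with_facets N polyhedron.
Proof.
move=> bd; split; first exact: polyhedron_polytope bd.
have -> : [set F | facet polyhedron F] = range facet_of.
  apply/seteqP; split=> [F /facet_polyhedronP[j ->]|_ [j _ <-]]; first by exists j.
  exact: facet_ofP.
apply: card_eq_trans (_ : [set: 'I_N] #= `I_N)%card.
  by apply: inj_card_eq => i j _ _; exact: facet_of_inj.
by rewrite card_eq_sym card_II.
Qed.

End facets.
End polyhedron.

(** * Borel sets and countable unions of closed sets *)

Section borel_sets.
Context {T : topologicalType}.
Implicit Types A B : set T.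

Lemma borel_open A : open A -> borel A.
Proof. exact: sub_sigma_algebra. Qed.

Lemma borelC A : borel A -> borel (~` A).
Proof. by move=> bA; rewrite -setTD; exact: sigma_algebraCD. Qed.

Lemma borel_closed A : closed A -> borel A.
Proof. by move=> cA; rewrite -(setCK A); apply: borelC; apply: borel_open; rewrite openC. Qed.

Lemma borel_bigcup (F : nat -> set T) : (forall n, borel (F n)) -> borel (\bigcup_n F n).
Proof. exact: sigma_algebra_bigcup. Qed.

Lemma borel_bigcup_ord m (B : 'I_m -> set T) : (forall i, borel (B i)) -> borel (\bigcup_i B i).
Proof.
move=> bB; have -> : \bigcup_i B i = \bigcup_n (if insub n is Some i then B i else set0).
  apply/seteqP; split=> [x [i _ Bx]|x [n _]]; first by exists i => //; rewrite valK.
  by case: insubP => // i _ _ Bx; exists i.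
apply: borel_bigcup => n; case: insubP => // _.
by apply: borel_closed; exact: closed0.
Qed.

Lemma borelU A B : borel A -> borel B -> borel (A `|` B).
Proof.
move=> bA bB; rewrite -bigcup2E; apply: borel_bigcup => -[|[|n]]//=.
by apply: borel_closed; exact: closed0.
Qed.

Lemma borelI A B : borel A -> borel B -> borel (A `&` B).
Proof. by move=> bA bB; rewrite -[_ `&` _]setCK setCI; apply: borelC; apply: borelU; exact: borelC. Qed.

Lemma borelD A B : borel A -> borel B -> borel (A `\` B).
Proof. by move=> bA bB; rewrite setDE; apply: borelI => //; exact: borelC. Qed.

Lemma Fsigma_borel A : Fsigma A -> borel A.
Proof. by move=> [F cF ->]; apply: borel_bigcup => n; exact: borel_closed. Qed.

End borel_sets.

Lemma borel_preimage {T U : topologicalType} (f : T -> U) (A : set U) :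
  continuous f -> borel A -> borel (f @^-1` A).
Proof.
move=> cf; apply: (smallest_sub (X := [set B : set U | borel (f @^-1` B)])).
  split=> /=.
  - by rewrite preimage_set0; apply: borel_closed; exact: closed0.
  - by move=> B bB; rewrite setTD preimage_setC; exact: borelC.
  - by move=> F bF; rewrite preimage_bigcup; exact: borel_bigcup.
by move=> B oB /=; apply: borel_open; exact: open_comp.
Qed.

Section Fsigma_sets.
Context {T : topologicalType}.
Implicit Types A B : set T.

Lemma Fsigma_bigcup (I : countType) (S : I -> set T) :
  (forall i, Fsigma (S i)) -> Fsigma (\bigcup_i S i).
Proof.
move=> FS; have {FS}[F FP] := choice (fun i => let: ex_intro2 F cF SE := FS i in
  ex_intro (fun F => (forall n, closed (F n)) /\ S i = \bigcup_n F n) F (conj cF SE)).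
exists (fun n => if unpickle n is Some (i, k) then F i k else set0) => [n|].
  by case: unpickle => [[i k]|]; [exact: (FP i).1|exact: closed0].
apply/seteqP; split=> [x [i _]|x [n _]].
  by rewrite (FP i).2 => -[k _ Fx]; exists (pickle (i, k)) => //=; rewrite pickleK.
case: unpickle => [[i k] Fx|//].
by exists i => //; rewrite (FP i).2; exists k.
Qed.

Lemma FsigmaI A B : Fsigma A -> Fsigma B -> Fsigma (A `&` B).
Proof.
move=> [F cF ->] [G cG ->].
have -> : \bigcup_n F n `&` \bigcup_n G n =
    \bigcup_(p : nat * nat) (F p.1 `&` G p.2).
  apply/seteqP; split=> [x [[m _ Fx] [n _ Gx]]|x [[m n] _ [Fx Gx]]].
    by exists (m, n).
  by split; [exists m|exists n].
by apply: Fsigma_bigcup => p; apply: closed_Fsigma; exact: closedI.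
Qed.

Lemma Fsigma_forall (I : finType) (S : I -> set T) :
  (forall i, Fsigma (S i)) -> Fsigma [set x | forall i, S i x].
Proof.
move=> FS.
suff H (s : seq I) : Fsigma [set x | forall i, i \in s -> S i x].
  have := H (enum I); congr Fsigma; apply/seteqP.
  by split=> x Sx i; [apply: Sx; rewrite mem_enum|].
elim: s => [|i s IH].
  have -> : [set x | forall i, i \in [::] -> S i x] = setT by apply/seteqP.
  by apply: closed_Fsigma; exact: closedT.
have -> : [set x | forall j, j \in i :: s -> S j x] =
    S i `&` [set x | forall j, j \in s -> S j x].
  apply/seteqP; split=> [x Sx|x [Six Ssx] j /=].
    by split=> [|j js]; apply: Sx; rewrite inE ?eqxx// js orbT.
  by rewrite inE => /orP[/eqP ->//|]; exact: Ssx.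
exact: FsigmaI.
Qed.

Context {R : realType}.
Implicit Types f : T -> R.

Lemma Fsigma_eq0 f : continuous f -> Fsigma [set x | f x = 0].
Proof.
move=> cf; apply: closed_Fsigma.
exact: (preimage_closed (f := f) (fun x _ => cf x) (@closed_eq R 0)).
Qed.

Lemma Fsigma_lt0 f : continuous f -> Fsigma [set x | f x < 0].
Proof.
move=> cf; exists (fun n => [set x | f x <= - n.+1%:R^-1]) => [n|].
  exact: (preimage_closed (f := f) (fun x _ => cf x) (@closed_le R _)).
apply/seteqP; split=> [x /= fx|x [n _ /= fx]].
  have fx0 : 0 < - f x by rewrite oppr_gt0.
  exists (Num.truncn (- f x)^-1) => //=.
  rewrite lerNr -[leRHS]invrK lef_pV2 ?posrE ?invr_gt0//.
  by rewrite ltW// truncnS_gt.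
by apply: le_lt_trans fx _; rewrite oppr_lt0 invr_gt0 ltr0n.
Qed.

Lemma Fsigma_neq0 f : continuous f -> Fsigma [set x | f x != 0].
Proof.
move=> cf; have -> : [set x | f x != 0] =
    \bigcup_(b : bool) [set x | (if b then f x else - f x) < 0].
  apply/seteqP; split=> [x /= |x [[] _ /=]].
  - by rewrite neq_lt => /orP[fx|fx]; [exists true|exists false; rewrite //= oppr_lt0].
  - by move=> fx; rewrite lt_eqF.
  - by rewrite oppr_lt0 => fx; rewrite gt_eqF.
apply: Fsigma_bigcup => -[]; apply: Fsigma_lt0 => // x.
exact: (continuousN (cf x)).
Qed.

Lemma continuous_sumr (I : finType) (F : I -> T -> R) :
  (forall i, continuous (F i)) -> continuous (fun x => \sum_i F i x).
Proof.
move=> cF x; apply: cvg_big => [|i _]; [exact: add_continuous|].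
exact: cF.
Qed.

Lemma continuous_det n (A : T -> 'M[R]_n) :
  (forall i j, continuous (fun x => A x i j)) -> continuous (fun x => \det (A x)).
Proof.
move=> cA; apply: continuous_sumr => s x.
rewrite /continuous_at; apply: cvgM; first exact: cvg_cst.
apply: cvg_big => [|i _]; [exact: mul_continuous|].
exact: cA.
Qed.

End Fsigma_sets.

(** Continuous images of Borel sets may fail to be Borel, but compact sets exhaust
    a finite-dimensional space, and continuous images of compact sets are closed
    in a Hausdorff space. *)
Lemma Fsigma_image {R : realType} {p : nat} {U : topologicalType}
    (f : 'rV[R]_p -> U) (S : set 'rV[R]_p) :
  hausdorff_space U -> continuous f -> Fsigma S -> Fsigma (f @` S).
Proof.
move=> hU cf [F cF ->].
pose box (n : nat) : set 'rV[R]_p := [set x | forall i, `|x 0 i| <= n%:R].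
have cbox n : closed (box n).
  have -> : box n = \bigcap_(i in setT) [set x : 'rV[R]_p | `|x 0 i| <= n%:R].
    by apply/seteqP; split=> [x bx i _|x bx i]; [exact: bx|exact: (bx i I)].
  apply: closed_bigI => i _.
  apply: (preimage_closed (f := fun x : 'rV[R]_p => `|x 0 i|)) (@closed_le R _) => x _.
  by apply: continuous_comp; [exact: (@coord_continuous R 1 p 0 i x)|exact: norm_continuous].
have -> : f @` (\bigcup_n F n) = \bigcup_(q : nat * nat) (f @` (F q.1 `&` box q.2)).
  apply/seteqP; split=> [_ [x [m _ Fx] <-]|_ [[m n] _ [x [Fx _] <-]]]; last first.
    by exists x => //; exists m.
  pose B := \sum_i `|x 0 i|.
  exists (m, (Num.truncn B).+1) => //; exists x => //; split => // i /=.
  apply: (@le_trans _ _ B).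
    by rewrite /B (bigD1 i)//= lerDl sumr_ge0.
  exact: ltW (truncnS_gt B).
apply: Fsigma_bigcup => q; apply: closed_Fsigma; apply: compact_closed => //.
apply: continuous_compact; first exact: continuous_subspaceT.
apply: bounded_closed_compact; last exact: closedI.
exists q.2%:R; split; first exact: num_real.
move=> r qr x /= [_ bx]; rewrite [(`|x|)]mx_normrE.
apply: bigmax_le => [|[i j] _ /=]; first by apply: le_trans (ltW qr); rewrite ler0n.
by rewrite (ord1 i); apply: le_trans (bx j) (ltW qr).
Qed.

(** * Ranks and dimensions of hulls *)

Section rank_minors.
Context {F : fieldType} {p q : nat}.
Implicit Type A : 'M[F]_(p, q).

Lemma mxrank_mxsub A m n (f : 'I_m -> 'I_p) (g : 'I_n -> 'I_q) :
  (\rank (mxsub f g A) <= \rank A)%N.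
Proof.
have -> : mxsub f g A = (rowsub g (rowsub f A)^T)^T.
  by apply/matrixP => i j; rewrite !mxE.
rewrite mxrank_tr; apply: leq_trans (mxrankS (rowsub_sub g _)) _.
by rewrite mxrank_tr; exact: mxrankS (rowsub_sub f _).
Qed.

Lemma nonzero_minor A k : (k <= \rank A)%N ->
  exists (f : {ffun 'I_k -> 'I_p}) (g : {ffun 'I_k -> 'I_q}), \det (mxsub f g A) != 0.
Proof.
move=> kA; pose f := [ffun i => maxrankfun A (widen_ord kA i)].
have /row_freeP[B AB] := maxrowsub_free A.
have free : row_free (rowsub f A).
  apply/row_freeP; exists (colsub (widen_ord kA) B).
  have -> : rowsub f A = rowsub (widen_ord kA) (rowsub (maxrankfun A) A).
    by apply/matrixP => i j; rewrite !mxE ffunE.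
  rewrite -mxsub_mul AB; apply/matrixP => i j; rewrite !mxE.
  by congr (_%:R); rewrite -val_eqE.
have full : row_full (rowsub f A)^T by rewrite /row_full mxrank_tr.
exists f, (fullrankfun full).
have := fullrowsub_unit full; rewrite unitmxE unitfE -det_tr.
by congr (\det _ != 0); apply/matrixP => i j; rewrite !mxE.
Qed.

(** The minors turn a condition on the rank into polynomial equations and
    inequations in the entries. *)
Lemma mxrank_minors A k : \rank A = k <->
  (exists (f : {ffun 'I_k -> 'I_p}) (g : {ffun 'I_k -> 'I_q}), \det (mxsub f g A) != 0) /\
  forall (f : {ffun 'I_k.+1 -> 'I_p}) (g : {ffun 'I_k.+1 -> 'I_q}), \det (mxsub f g A) = 0.
Proof.
have unit_rank m (f : 'I_m -> 'I_p) (g : 'I_m -> 'I_q) :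
    \det (mxsub f g A) != 0 -> (m <= \rank A)%N.
  move=> det0; apply: leq_trans (mxrank_mxsub A f g).
  by rewrite mxrank_unit// unitmxE unitfE.
split=> [rA|[[f [g fg0]] min0]].
  split=> [|f g]; first by apply: nonzero_minor; rewrite rA.
  by apply/eqP/negPn/negP => /unit_rank; rewrite rA ltnn.
apply/eqP; rewrite eqn_leq (unit_rank _ _ _ fg0) andbT leqNgt.
by apply/negP => /nonzero_minor[f' [g']]; rewrite min0 eqxx.
Qed.

End rank_minors.

Lemma Fsigma_rank {T : topologicalType} {R : realType} p q (A : T -> 'M[R]_(p, q)) k :
  (forall i j, continuous (fun x => A x i j)) -> Fsigma [set x | \rank (A x) = k].
Proof.
move=> cA; have cdet n f g : continuous (fun x => \det (mxsub f g (A x) : 'M[R]_n)).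
  apply: continuous_det => i j.
  by rewrite (_ : (fun _ => _) = (fun x => A x (f i) (g j)))//; apply/funext => x; rewrite mxE.
have -> : [set x | \rank (A x) = k] =
  (\bigcup_(fg : {ffun 'I_k -> 'I_p} * {ffun 'I_k -> 'I_q})
     [set x | \det (mxsub fg.1 fg.2 (A x)) != 0]) `&`
  [set x | forall fg : {ffun 'I_k.+1 -> 'I_p} * {ffun 'I_k.+1 -> 'I_q},
     \det (mxsub fg.1 fg.2 (A x)) = 0].
  apply/seteqP; split=> x /= [].
    move/mxrank_minors => -[[f [g fg]] min0].
    by split=> [|[f' g']]; [exists (f, g)|exact: min0].
  move=> [[f g] _ /= fg] min0; apply/mxrank_minors; split; first by exists f, g.
  by move=> f' g'; exact: (min0 (f', g')).
apply: FsigmaI.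
  by apply: Fsigma_bigcup => fg; apply: Fsigma_neq0; exact: cdet.
by apply: Fsigma_forall => fg; apply: Fsigma_eq0; exact: cdet.
Qed.

Section hulls.
Context {R : realType} {d : nat}.
Implicit Types (u w x y : 'rV[R]_d).

Lemma hull_of_dotp_le n (v : 'I_n -> 'rV[R]_d) u c :
  (forall i, dotp u (v i) <= c) -> forall w, hull_of v w -> dotp u w <= c.
Proof.
move=> uv _ [t [t0 t1] ->]; rewrite dotp_sumr -[leRHS]mul1r -t1 mulr_suml.
by apply: ler_sum => i _; rewrite dotpZr ler_wpM2l.
Qed.

(** A weighted mean of numbers at most [c] equals [c] only if all those with a
    nonzero weight do. *)
Lemma hull_of_face n (v : 'I_n -> 'rV[R]_d) u c (t : 'I_n -> R) :
  (forall i, dotp u (v i) <= c) -> simplex t ->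
  dotp u (\sum_i t i *: v i) = c -> forall i, t i != 0 -> dotp u (v i) = c.
Proof.
move=> uv [t0 t1]; rewrite dotp_sumr => uc i ti.
have : \sum_i t i * (c - dotp u (v i)) = 0.
  under eq_bigr do rewrite mulrBr.
  rewrite sumrB -mulr_suml t1 mul1r -uc.
  by under [X in _ - X]eq_bigr do rewrite -dotpZr; rewrite subrr.
move=> s0.
have H0 j : true -> 0 <= t j * (c - dotp u (v j)) by rewrite mulr_ge0 ?subr_ge0.
have /eqP := psumr_eq0P H0 s0 (i := i) isT.
by rewrite mulf_eq0 (negbTE ti)/= subr_eq0 => /eqP.
Qed.

(** Directions from a base point [i0] to the points indexed by [I]; the zero rows
    keep the format of the matrix independent of [I]. *)
Definition directions n (v : 'I_n -> 'rV[R]_d) (I : {set 'I_n}) (i0 : 'I_n) :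
    'M[R]_(n, d) :=
  \matrix_i (if i \in I then v i - v i0 else 0).

(** If [A] lies between a set of points and its convex hull, its affine hull is
    spanned by these points, so that dimensions become ranks of matrices. *)
Lemma has_dim_directions n (v : 'I_n -> 'rV[R]_d) (I : {set 'I_n}) (i0 : 'I_n)
    (A : set 'rV[R]_d) k :
  i0 \in I -> (forall i, i \in I -> A (v i)) ->
  (forall w, A w -> exists2 t, simplex t &
     w = \sum_i t i *: v i /\ forall i, t i != 0 -> i \in I) ->
  has_dim k A <-> \rank (directions v I i0) = k.
Proof.
move=> i0I vA AI; set W := directions v I i0.
have AW : A `<=` [set w | (w - v i0 <= <<W>>)%MS].
  move=> w /AI[t [t0 t1] [-> tI]] /=.
  have -> : \sum_i t i *: v i - v i0 = \sum_i t i *: (v i - v i0).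
    under [RHS]eq_bigr do rewrite scalerBr.
    by rewrite sumrB -scaler_suml t1 scale1r.
  apply: summx_sub => i _; have [->|/tI iI] := eqVneq (t i) 0.
    by rewrite scale0r sub0mx.
  apply: scalemx_sub; rewrite genmxE.
  by have <- : row i W = v i - v i0; [rewrite rowK iI|exact: row_sub].
have flatW : flat (\rank W) (affine_hull A).
  exists (v i0), <<W>>%MS; split; first by rewrite genmxE.
  apply/seteqP; split; first exact: affine_hull_sub_flat.
  move=> w /=; rewrite genmxE => /submxP[D wD].
  exists n.+1, (fun j => if unlift ord0 j is Some i then
      if i \in I then v i else v i0 else v i0),
    (fun j => if unlift ord0 j is Some i then D 0 i else 1 - \sum_i D 0 i); split.
  - by move=> j; case: unliftP => [i _|_]; [case: ifP => iI|]; exact: vA.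
  - rewrite big_ord_recl unlift_none [X in _ + X](eq_bigr (D 0)) ?subrK// => i _.
    by rewrite liftK.
  rewrite big_ord_recl unlift_none [X in _ + X](eq_bigr (fun i =>
    D 0 i *: (if i \in I then v i else v i0))); last by move=> i _; rewrite liftK.
  have -> : w = v i0 + D *m W by rewrite -wD subrKC.
  rewrite mulmx_sum_row scalerBl scale1r -addrA; congr (_ + _).
  rewrite scaler_suml -sumrN -big_split; apply: eq_bigr => i _ /=.
  rewrite rowK; case: ifP => _; first by rewrite scalerBr addrC.
  by rewrite scaler0 addNr.
split=> [dA|<-//]; exact: flat_dim_uniq flatW dA.
Qed.

(** The hull is a continuous image of the compact simplex. *)
Lemma hull_of_body n (v : 'I_n.+1 -> 'rV[R]_d) : convex_body (hull_of v).
Proof.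
split; [by exists (v ord0); exact: hull_of_in| |exact: hull_of_convex].
pose f (t : 'rV[R]_n.+1) : 'rV[R]_d := \sum_i t 0 i *: v i.
pose S : set 'rV[R]_n.+1 := [set t | simplex (t 0)].
have -> : hull_of v = f @` S.
  apply/seteqP; split=> [_ [t st ->]|_ [t st <-]]; last by exists (t 0).
  exists (\row_i t i); last by apply: eq_bigr => i _; rewrite mxE.
  by have -> : S (\row_i t i) = simplex t; [congr simplex; apply/funext => i; rewrite mxE|].
have cc (i : 'I_n.+1) : continuous (fun t : 'rV[R]_n.+1 => t 0 i).
  exact: (@coord_continuous R 1 n.+1 0 i).
apply: continuous_compact.
  apply: continuous_subspaceT => t.
  apply: cvg_big => [||i _]; [exact: add_continuous|exact: nbhs_filter|].
  by apply: (@cvgZ _ _ _ (nbhs t)); [exact: (cc i t)|exact: (@cvg_cst _ _ _ _ (nbhs_filter t))].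
apply: bounded_closed_compact.
  exists 1; split; first exact: num_real.
  move=> r r1 t /= [t0 t1]; rewrite [(`|t|)]mx_normrE.
  apply: bigmax_le => [|[i j] _ /=]; first by apply: le_trans (ltW r1); rewrite ler01.
  rewrite (ord1 i) ger0_norm//; apply: le_trans (ltW r1).
  by rewrite -t1 (bigD1 j)//= lerDl sumr_ge0.
have -> : S = \bigcap_(i in setT) [set t : 'rV[R]_n.+1 | 0 <= t 0 i] `&`
    [set t : 'rV[R]_n.+1 | \sum_i t 0 i = 1].
  apply/seteqP; split=> [t [t0 t1]|t [t0 t1]]; first by split=> // i _; exact: t0.
  by split=> // i; exact: (t0 i I).
apply: closedI; first apply: closed_bigI => i _.
  apply: (@preimage_closed _ _ (fun t : 'rV[R]_n.+1 => t 0 i) [set r | 0 <= r]).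
    by move=> x _; exact: cc.
  exact: closed_ge.
apply: (@preimage_closed _ _ (fun t : 'rV[R]_n.+1 => \sum_i t 0 i) [set r | r = 1]).
  by move=> x _; exact: continuous_sumr.
exact: closed_eq.
Qed.

End hulls.

(** * Measurability of the number of facets *)

Lemma card_le_injection {T : pointedType} (A : set T) n :
  (`I_n #<= A)%card <-> exists2 f : 'I_n -> T, injective f & forall j, A (f j).
Proof.
split=> [/card_subP[C Cn CA]|[f fi fA]].
  have : ([set: 'I_n] #= C)%card.
    by apply: card_eq_trans (card_esym Cn); rewrite card_eq_sym card_II.
  move=> /card_set_bijP[f [fC finj _]]; exists f => [i j|j].
    by apply: finj; rewrite inE.
  by apply: CA; exact: fC.
apply: card_le_trans (subset_card_le (A := range f) _); last by move=> _ [j _ <-].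
have fn : (range f #= `I_n)%card.
  apply: card_eq_trans (_ : [set: 'I_n] #= _)%card; last by rewrite card_eq_sym card_II.
  by apply: inj_card_eq => i j _ _; exact: fi.
by rewrite (card_le_eqr fn) card_lexx.
Qed.

Lemma card_eq_II_le {T : Type} (A : set T) n :
  (A #= `I_n)%card <-> (`I_n #<= A)%card /\ ~ (`I_n.+1 #<= A)%card.
Proof.
split=> [An|[nA nA1]].
  by rewrite !(card_le_eqr An) card_lexx card_le_II ltnn.
have fA : finite_set A.
  apply: contrapT => /infiniteP natA; apply: nA1; apply: card_le_trans natA.
  exact: card_leT.
have /finite_setP[m Am] := fA.
move: nA nA1; rewrite !(card_le_eqr Am) !card_le_II => nm /negP; rewrite -ltnNge ltnS => mn.
by have -> : n = m by apply/eqP; rewrite eqn_leq nm mn.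
Qed.

Section facet_parameters.
Context {R : realType} {d : nat}.
Implicit Types (u w x y : 'rV[R]_d).

Definition hull_body m (v : 'I_m.+1 -> 'rV[R]_d) : body R d := Body (hull_of_body v).

Lemma hull_body_dist m (v v' : 'I_m.+1 -> 'rV[R]_d) e :
  (forall i, enorm (v i - v' i) <= e) -> mdist (hull_body v) (hull_body v') <= e.
Proof.
have sumn (a : 'I_m.+1 -> 'rV[R]_d) : enorm (\sum_i a i) <= \sum_i enorm (a i).
  elim/big_ind2: _ => //; first by rewrite enorm0.
  by move=> x1 x2 y1 y2 xy1 xy2; apply: le_trans (enormD _ _) _; exact: lerD.
have ex (a b : 'I_m.+1 -> 'rV[R]_d) : (forall i, enorm (a i - b i) <= e) ->
    excess (hull_of a) (hull_of b) <= e.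
  move=> abe; apply: excess_le; first by exists (a ord0); exact: hull_of_in.
  move=> _ [t [t0 t1] ->].
  apply: (@le_trans _ _ (enorm (\sum_i t i *: a i - \sum_i t i *: b i))).
    by apply: point_dist_le; exists t.
  rewrite -sumrB; apply: le_trans (sumn _) _.
  rewrite -[leRHS]mul1r -t1 mulr_suml; apply: ler_sum => i _.
  by rewrite -scalerBr enormZ// ler_wpM2l.
move=> vv'; rewrite body_mdistE /hausdorff_dist ge_max !ex// => i.
by rewrite enormB_sym.
Qed.

Section parameters.
Variables (n m : nat).

(** A point configuration and [n] candidates for its facet hyperplanes, stored in
    one vector so that they range over a finite-dimensional space. *)
Definition param_index : finType := ('I_m.+1 * 'I_d + ('I_n * 'I_d + 'I_n))%type.

Local Notation param := 'rV[R]_#|param_index|.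

Definition coordinate (s : param_index) (th : param) : R := th 0 (enum_rank s).
Definition vertices (th : param) (i : 'I_m.+1) : 'rV[R]_d :=
  \row_k coordinate (inl (i, k)) th.
Definition normals (th : param) (j : 'I_n) : 'rV[R]_d :=
  \row_k coordinate (inr (inl (j, k))) th.
Definition offsets (th : param) (j : 'I_n) : R := coordinate (inr (inr j)) th.

Lemma coordinate_continuous s : continuous (coordinate s).
Proof. exact: (@coord_continuous R 1 #|param_index| 0 (enum_rank s)). Qed.

Lemma param_surj (v : 'I_m.+1 -> 'rV[R]_d) (u : 'I_n -> 'rV[R]_d) (c : 'I_n -> R) :
  exists th, [/\ vertices th = v, normals th = u & offsets th = c].
Proof.
exists (\row_s match enum_val s with
  | inl p => v p.1 0 p.2 | inr (inl p) => u p.1 0 p.2 | inr (inr j) => c j end).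
split; apply/funext => j; last by rewrite /offsets /coordinate mxE enum_rankK.
  by apply/rowP => k; rewrite mxE /coordinate mxE enum_rankK.
by apply/rowP => k; rewrite mxE /coordinate mxE enum_rankK.
Qed.

Lemma hull_body_continuous : continuous (fun th : param => hull_body (vertices th)).
Proof.
move=> th U /nbhs_ballP[e /= e0 eU].
have e20 : 0 < e / 2 by rewrite divr_gt0.
suff : \forall th' \near nbhs th, forall i, enorm (vertices th i - vertices th' i) <= e / 2.
  apply: filterS => th' near_th; apply: eU; rewrite ballEmdist /=.
  by apply: le_lt_trans (hull_body_dist near_th) _; rewrite ltr_pdivrMr// ltr_pMr// ltr1n.
apply: filter_forall => i.
pose f (th' : param) : R := enorm (vertices th i - vertices th' i).
have cf : continuous f.
  suff cd : continuous (fun s : param => dotp (vertices th i - vertices s i)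
      (vertices th i - vertices s i)).
    by move=> s; exact: (continuous_comp (cd s) (@sqrt_continuous R _)).
  rewrite /dotp; apply: continuous_sumr => k y.
  have ck : continuous_at y (fun s : param => (vertices th i - vertices s i) 0 k).
    rewrite (_ : (fun _ => _) = (fun s : param => vertices th i 0 k - coordinate (inl (i, k)) s)).
      by apply: (@cvgB _ _ _ _ (nbhs_filter y)); [exact: (@cvg_cst _ _ _ _ (nbhs_filter y))|exact: coordinate_continuous].
    by apply/funext => z; rewrite !mxE.
  exact: (@cvgM _ _ (nbhs y) (nbhs_filter y) _ _ _ _ ck ck).
have f0 : f th = 0 by rewrite /f subrr enorm0.
have := cf th; move=> /cvgrPdist_lt/(_ _ e20); apply: filterS => th' /=.
by rewrite f0 sub0r normrN => /(le_lt_trans (ler_norm _))/ltW.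
Qed.

(** The combinatorial type of [n] facets: their common dimension, and for each
    of them the set of its vertices together with one of these. *)
Definition facet_pattern : countType :=
  (nat * ({ffun 'I_n -> {set 'I_m.+1}} * {ffun 'I_n -> 'I_m.+1}))%type.

Definition realizes (D : facet_pattern) (th : param) : Prop :=
  let: (k, (J, i0)) := D in
  [/\ injective J, (forall j, i0 j \in J j),
    (forall j i, if i \in J j then dotp (normals th j) (vertices th i) = offsets th j
                 else dotp (normals th j) (vertices th i) < offsets th j),
    \rank (directions (vertices th) [set: 'I_m.+1]%SET ord0) = k.+1 &
    forall j, \rank (directions (vertices th) (J j) (i0 j)) = k].

Lemma realizes_Fsigma D : Fsigma [set th | realizes D th].
Proof.
case: D => k [J i0].
have [iI|nI] := pselect (injective J /\ forall j, i0 j \in J j); last first.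
  rewrite (_ : mkset _ = set0); first exact/closed_Fsigma/closed0.
  by apply/seteqP; split=> // th [Iinj Ii0 _ _ _]; apply: nI.
have -> : [set th | realizes (k, (J, i0)) th] =
  [set th | forall ji : 'I_n * 'I_m.+1, if ji.2 \in J ji.1
    then dotp (normals th ji.1) (vertices th ji.2) - offsets th ji.1 = 0
    else dotp (normals th ji.1) (vertices th ji.2) - offsets th ji.1 < 0] `&`
  ([set th | \rank (directions (vertices th) [set: 'I_m.+1]%SET ord0) = k.+1] `&`
  [set th | forall j, \rank (directions (vertices th) (J j) (i0 j)) = k]).
  apply/seteqP; split=> [th [_ _ uv rv rI]|th [uv [rv rI]]].
    split; last by split.
    by move=> [j i] /=; have := uv j i; case: ifP => _; [move=> ->; rewrite subrr|rewrite subr_lt0].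
  split; [exact: iI.1|exact: iI.2| |exact: rv|exact: rI].
  by move=> j i; have := uv (j, i); case: ifP => _ /=; [move/subr0_eq|rewrite subr_lt0].
have cdir (L : {set 'I_m.+1}) j0 i k' : continuous (fun th => directions (vertices th) L j0 i k').
  have [iJ|iJ] := boolP (i \in L).
    rewrite (_ : (fun _ => _) = (fun th => coordinate (inl (i, k')) th - coordinate (inl (j0, k')) th)).
      by move=> th; apply: (@cvgB _ _ _ _ (nbhs_filter th)); exact: coordinate_continuous.
    by apply/funext => th; rewrite !mxE iJ !mxE.
  rewrite (_ : (fun _ => _) = (fun th => 0)); first by move=> th; exact: (@cvg_cst _ _ _ _ (nbhs_filter th)).
  by apply/funext => th; rewrite !mxE (negbTE iJ) mxE.
have cdot j i : continuous (fun th => dotp (normals th j) (vertices th i) - offsets th j).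
  move=> th; apply: (@cvgB _ _ _ _ (nbhs_filter th)); last exact: coordinate_continuous.
  rewrite /dotp; apply: continuous_sumr => l y.
  rewrite (_ : (fun _ => _) = (fun th => coordinate (inr (inl (j, l))) th * coordinate (inl (i, l)) th)).
    by apply: (@cvgM _ _ (nbhs y) (nbhs_filter y)); exact: coordinate_continuous.
  by apply/funext => z; rewrite !mxE.
apply: FsigmaI.
  apply: Fsigma_forall => -[j i] /=; have [_|_] := boolP (i \in J j).
    exact: Fsigma_eq0.
  exact: Fsigma_lt0.
apply: FsigmaI; first exact: Fsigma_rank.
by apply: Fsigma_forall => j; exact: Fsigma_rank.
Qed.

End parameters.

Lemma face_hullP n (v : 'I_n -> 'rV[R]_d) u c w : (forall i, dotp u (v i) <= c) ->
  hull_of v w /\ dotp u w = c <->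
  exists2 t, simplex t & w = \sum_i t i *: v i /\ forall i, t i != 0 -> dotp u (v i) = c.
Proof.
move=> uv; split=> [[[t st ->] uc]|[t st [-> tc]]].
  by exists t => //; split => //; exact: hull_of_face uv st uc.
split; first by exists t.
rewrite dotp_sumr -[RHS]mul1r -st.2 mulr_suml; apply: eq_bigr => i _.
rewrite dotpZr; have [->|/tc ->//] := eqVneq (t i) 0.
by rewrite !mul0r.
Qed.

Lemma face_has_dim n (v : 'I_n -> 'rV[R]_d) (J : {set 'I_n}) i0 u c k : i0 \in J ->
  (forall i, if i \in J then dotp u (v i) = c else dotp u (v i) < c) ->
  has_dim k [set w | hull_of v w /\ dotp u w = c] <-> \rank (directions v J i0) = k.
Proof.
move=> i0J uJ; have uv i : dotp u (v i) <= c.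
  by have := uJ i; case: ifP => [_ ->//|_ /ltW].
apply: has_dim_directions => // [i iJ|w].
  by split; [exact: hull_of_in|have := uJ i; rewrite iJ].
move=> /(face_hullP w uv)[t st [wt tc]]; exists t => //; split => // i /tc uvc.
by have := uJ i; case: ifP => // _; rewrite uvc ltxx.
Qed.

Lemma hull_has_dim n (v : 'I_n.+1 -> 'rV[R]_d) k :
  has_dim k (hull_of v) <-> \rank (directions v [set: 'I_n.+1]%SET ord0) = k.
Proof.
apply: has_dim_directions => [|i _|w [t st ->]]; [by rewrite inE|exact: hull_of_in|].
by exists t => //; split => // i; rewrite inE.
Qed.

(** A polytope has at least [n] facets when it is the hull of a point
    configuration for which [n] supporting halfspaces cut out different facets. *)
Lemma many_facets_image n :
  [set K : body R d | polytope K /\ (`I_n.+1 #<= [set F | facet K F])%card] =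
  \bigcup_m \bigcup_(D : facet_pattern n.+1 m)
    ((fun th : 'rV[R]_#|param_index n.+1 m| => hull_body (vertices th)) @`
      [set th | realizes D th]).
Proof.
apply/seteqP; split=> [K [/polytopeP[m [v Kv]] /card_le_injection[F Finj KF]]|].
  have fF j : exists uc : 'rV[R]_d * R, (forall w, body_set K w -> dotp uc.1 w <= uc.2) /\
      F j = [set w | body_set K w /\ dotp uc.1 w = uc.2].
    by have [[u [c ucF]] _] := KF j; exists (u, c).
  have {fF}[uc ucF] := choice fF.
  pose u j := (uc j).1; pose c j := (uc j).2.
  have uv j i : dotp (u j) (v i) <= c j.
    by apply: (ucF j).1; rewrite Kv; exact: hull_of_in.
  have FE j : F j = [set w | hull_of v w /\ dotp (u j) w = c j].
    by rewrite (ucF j).2 Kv.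
  have [_ [k Kk _]] := KF ord0.
  have Fk j : has_dim k (F j).
    have [_ [k' Kk' Fk']] := KF j.
    by have [->] : k.+1 = k'.+1 by exact: flat_dim_uniq Kk Kk'.
  pose J := [ffun j => [set i | dotp (u j) (v i) == c j]%SET].
  have uJ j i : if i \in J j then dotp (u j) (v i) = c j else dotp (u j) (v i) < c j.
    rewrite ffunE inE; case: ifP => [/eqP//|uvc].
    by rewrite lt_neqAle uvc uv.
  have J0 j : exists i, i \in J j.
    have [w] := has_dim_ne (Fk j); rewrite FE => /(face_hullP w (uv j))[t [t0 t1] [_ tc]].
    apply: contrapT => /forallNP noi.
    have t00 i : t i = 0.
      apply/eqP; apply: contraT => /tc uvc; exfalso; apply: (noi i).
      by rewrite ffunE inE; apply/eqP.
    by move: t1; rewrite big1 // => /eqP; rewrite eq_sym oner_eq0.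
  have {J0}[i0 i0J] := choice J0.
  have [th [thv thu thc]] := param_surj v u c.
  exists m => //; exists (k, (J, finfun i0)) => //; exists th; last first.
    rewrite thv; case: K Kv {KF ucF Kk} => K cK /= Kv; rewrite /hull_body.
    by move: (hull_of_body v); rewrite -Kv => cK'; congr Body; exact: Prop_irrelevance.
  rewrite /= thv thu thc; split.
  - move=> i j Jij; apply: Finj; rewrite !FE; apply/seteqP.
    have sub a b : J a = J b -> [set w | hull_of v w /\ dotp (u a) w = c a] `<=`
        [set w | hull_of v w /\ dotp (u b) w = c b].
      move=> Jab w /= /(face_hullP w (uv a))[t st [wt tc]].
      apply/(face_hullP w (uv b)); exists t => //; split => // l /tc uvl.
      by have := uJ b l; rewrite -Jab ffunE inE uvl eqxx.
    by split; apply: sub.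
  - by move=> j; have -> : finfun i0 j = i0 j by rewrite ffunE.
  - by move=> j i; exact: uJ.
  - by apply/hull_has_dim; rewrite -Kv.
  - move=> j; have -> : finfun i0 j = i0 j by rewrite ffunE.
    by apply/(face_has_dim k (i0J j) (uJ j)); rewrite -FE.
move=> K [m _ [[k [J i0]] _ [th [Jinj i0J uJ rv rJ] <-]]]; split.
  by apply/polytopeP; exists m, (vertices th).
apply/card_le_injection.
pose F j := [set w | hull_of (vertices th) w /\ dotp (normals th j) w = offsets th j].
have uv j i : dotp (normals th j) (vertices th i) <= offsets th j.
  by have := uJ j i; case: ifP => [_ ->//|_ /ltW].
exists F => [i j Fij|j].
  apply: Jinj; apply/setP => l.
  have mem a : (l \in J a) <-> F a (vertices th l).
    have := uJ a l; case: (l \in J a) => ua; first by split=> // _; split => //; exact: hull_of_in.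
    by split=> // -[_ ua']; move: ua; rewrite ua' ltxx.
  by apply/idP/idP => /mem; [rewrite Fij|rewrite -Fij] => /mem.
split.
  exists (normals th j), (offsets th j); split => // w /= hw.
  exact: hull_of_dotp_le (uv j) _ hw.
exists k; first exact/hull_has_dim.
exact/(face_has_dim k (i0J j) (uJ j)).
Qed.

(** There are countably many combinatorial types, and each is described by
    equations, strict inequalities and ranks that depend continuously on the
    parameters. *)
Lemma borel_many_facets n :
  borel [set K : body R d | polytope K /\ (`I_n.+1 #<= [set F | facet K F])%card].
Proof.
rewrite many_facets_image; apply: Fsigma_borel; apply: Fsigma_bigcup => m.
apply: Fsigma_bigcup => D; apply: Fsigma_image.
- exact: metric_hausdorff.
- exact: hull_body_continuous.
- exact: realizes_Fsigma.
Qed.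

Lemma borel_polytope_with_facets n :
  borel [set K : body R d | polytope_with_facets n.+1 K].
Proof.
have -> : [set K : body R d | polytope_with_facets n.+1 K] =
    [set K : body R d | polytope K /\ (`I_n.+1 #<= [set F | facet K F])%card] `\`
    [set K : body R d | polytope K /\ (`I_n.+2 #<= [set F | facet K F])%card].
  apply/seteqP; split=> K /=.
    by move=> [pK /card_eq_II_le[nK nK1]]; split => // -[].
  move=> [[pK nK] nK1]; split => //; apply/card_eq_II_le; split => // nK2.
  exact: nK1.
by apply: borelD; exact: borel_many_facets.
Qed.

End facet_parameters.

(** * Integrals and volumes *)

Section integral_bounds.
Context {disp : measure_display} {T : measurableType disp} {R : realType}.
Variable mu : {measure set T -> \bar R}.
Local Open Scope ereal_scope.

(** The integral of a nonnegative function is a supremum over the simple functions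
    below it, which is monotone for arbitrary functions, such as the volumes of the
    slices of a set. *)
Lemma le_integral_ge0 (D : set T) (f g : T -> \bar R) :
  (forall x, D x -> 0 <= f x) -> (forall x, D x -> f x <= g x) ->
  \int[mu]_(x in D) f x <= \int[mu]_(x in D) g x.
Proof.
move=> f0 fg; rewrite !ge0_integralE//; last first.
  by move=> x Dx; apply: le_trans (f0 x Dx) (fg x Dx).
apply: ereal_sup_le => _ [h /= hf <-]; exists h => //= x.
apply: le_trans (hf x) _; rewrite /patch; case: ifPn => // /set_mem Dx.
exact: fg.
Qed.

Lemma le_integral_cst (D B : set T) (f : T -> \bar R) (c : R) :
  measurable B -> B `<=` D -> (0 <= c)%R ->
  (forall x, D x -> 0 <= f x) -> (forall x, B x -> c%:E <= f x) ->
  c%:E * mu B <= \int[mu]_(x in D) f x.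
Proof.
move=> mB BD c0 f0 fc.
rewrite -integral_cst// integral_mkcond [leRHS]integral_mkcond.
apply: le_integral_ge0 => x _; rewrite /patch.
  by case: ifPn => //= _; rewrite lee_fin.
case: ifPn => [/set_mem Bx|_]; last by case: ifPn => // /set_mem Dx; exact: f0.
by rewrite mem_set; [exact: fc|exact: BD].
Qed.

End integral_bounds.

Section lebesgue_rV_bounds.
Context {R : realType}.

Lemma lebesgue_rVS d (A : set 'rV[R]_d.+1) : lebesgue_rV A =
  (\int[lebesgue_measure]_t lebesgue_rV [set w : 'rV[R]_d | A (row_mx (t%:M : 'rV_1) w)])%E.
Proof. by []. Qed.

Lemma lebesgue_rV_ge0 d (A : set 'rV[R]_d) : (0 <= lebesgue_rV A)%E.
Proof.
elim: d A => [|d IH] A; first by rewrite /= lee_fin.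
by rewrite lebesgue_rVS; apply: integral_ge0 => t _; exact: IH.
Qed.

Lemma lebesgue_rV0 d : lebesgue_rV (set0 : set 'rV[R]_d) = 0%E.
Proof.
elim: d => [|d IH]; first by rewrite /= indicE in_set0.
by rewrite lebesgue_rVS; apply: integral0_eq => t _.
Qed.

Lemma lebesgue_itv_cc (a b : R) : a <= b ->
  lebesgue_measure (`[a, b]%classic : set R) = (b - a)%:E.
Proof. by move=> ab; rewrite lebesgue_measure_itv/= lte_fin; case: ltgtP ab => // -> _; rewrite subrr. Qed.

Lemma ord_max_or_widen e (i : 'I_e.+1) :
  i = ord_max \/ exists j, i = widen_ord (leqnSn e) j.
Proof.
have [->|im] := eqVneq i ord_max; [by left|right].
have ie : (i < e)%N.
  by have := ltn_ord i; rewrite ltnS leq_eqVlt => /orP[/eqP ie|//]; move: im; rewrite -val_eqE /= ie eqxx.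
by exists (Ordinal ie); exact: val_inj.
Qed.


(** The last coordinate belongs to the innermost integral, which leaves the
    endpoints of its range free to depend on the other coordinates. *)
Lemma lebesgue_rV_ge_graph e (A : set 'rV[R]_e.+1) (lo hi : 'I_e -> R) (W : R) :
  0 <= W -> (forall i, lo i <= hi i) ->
  (forall x : 'rV[R]_e, (forall i, lo i <= x 0 i <= hi i) ->
    exists a, forall v : 'rV[R]_e.+1,
      (forall i, v 0 (widen_ord (leqnSn e) i) = x 0 i) ->
      a <= v 0 ord_max <= a + W -> A v) ->
  (((\prod_i (hi i - lo i)) * W)%:E <= lebesgue_rV A)%E.
Proof.
elim: e A lo hi => [|e IH] A lo hi W0 lohi AP.
  have [|a aP] := AP 0; first by case.
  rewrite big_ord0 mul1r.
  have -> : W%:E = (1%:E * lebesgue_measure (`[a, (a + W)%R]%classic : set R))%E.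
    by rewrite lebesgue_itv_cc ?lerDl// mul1e addrAC subrr add0r.
  apply: le_integral_cst => //= t.
  rewrite in_itv/= => taW; rewrite lee_fin indicE mem_set//=.
  apply: aP => [[]//|]; rewrite mxE; case: splitP => // j.
  by rewrite (ord1 j) mxE mulr1n.
rewrite lebesgue_rVS big_ord_recl -mulrA mulrC.
have lh0 := lohi ord0.
rewrite EFinM -lebesgue_itv_cc//.
apply: le_integral_cst => //.
- by rewrite mulr_ge0// prodr_ge0// => i _; rewrite subr_ge0.
- by move=> t _; exact: lebesgue_rV_ge0.
move=> t; rewrite /mkset in_itv => t0.
have := IH [set w : 'rV[R]_e.+1 | A (row_mx (t%:M : 'rV_1) w)]
  (fun i => lo (lift ord0 i)) (fun i => hi (lift ord0 i)) W0 (fun i => lohi _).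
apply => x xP.
have [i|a aP] := AP (row_mx (t%:M : 'rV_1) x).
  rewrite mxE; case: splitP => j ij.
    have -> : i = ord0 by apply: val_inj; rewrite /= ij (ord1 j).
    by rewrite (ord1 j) mxE mulr1n.
  have -> : i = lift ord0 j by apply: val_inj; rewrite /= ij.
  exact: xP.
exists a => v vx va /=; apply: aP => [i|].
  rewrite !mxE; case: splitP => j /= ij; case: splitP => k /= ik.
  - by rewrite (ord1 j) (ord1 k).
  - by have := ltn_ord j; rewrite -ij ik.
  - by have := ltn_ord k; rewrite -ik ij.
  by rewrite -vx; congr (v 0 _); apply: val_inj => /=; move: ij; rewrite ik => -[].
rewrite mxE; case: splitP => j /= ij; first by have := ltn_ord j; rewrite -ij.
by have -> : j = ord_max by apply: val_inj => /=; case: ij.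
Qed.

Lemma lebesgue_rV_ge_box e (A : set 'rV[R]_e.+1) (x : 'rV[R]_e.+1) (r : R) : 0 <= r ->
  (forall v : 'rV[R]_e.+1, (forall i, x 0 i <= v 0 i <= x 0 i + r) -> A v) ->
  ((r ^+ e.+1)%:E <= lebesgue_rV A)%E.
Proof.
move=> r0 AP.
have -> : r ^+ e.+1 = (\prod_(i < e) ((x 0 (widen_ord (leqnSn e) i) + r) -
    x 0 (widen_ord (leqnSn e) i))) * r.
  rewrite (eq_bigr (fun=> r)); last by move=> i _; rewrite addrAC subrr add0r.
  by rewrite prodr_const card_ord exprSr.
apply: lebesgue_rV_ge_graph => // [i|y yP]; first by rewrite lerDl.
exists (x 0 ord_max) => v vy vm; apply: AP => i.
by have [->//|[j ->]] := ord_max_or_widen i; rewrite vy.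
Qed.

Lemma lebesgue_rV_le_box d (A : set 'rV[R]_d) (r : R) : 0 <= r ->
  (forall v, A v -> forall i, `|v 0 i| <= r) ->
  (lebesgue_rV A <= ((2 * r) ^+ d)%:E)%E.
Proof.
move=> r0; elim: d A => [|d IH] A AP.
  by rewrite /= expr0 lee_fin indicE; case: (_ \in _).
rewrite lebesgue_rVS; apply: (@le_trans _ _ (\int[lebesgue_measure]_(t in `[(- r)%R, r]) ((2 * r) ^+ d)%:E)%E); last first.
  rewrite integral_cst// [X in (_ * X)%E](_ : _ = (r - - r)%:E).
    by rewrite -EFinM lee_fin opprK exprSr; have -> : r + r = 2 * r by ring.
  by apply: lebesgue_itv_cc; lra.
rewrite [leRHS]integral_mkcond; apply: le_integral_ge0 => t _.
  exact: lebesgue_rV_ge0.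
rewrite /patch; case: ifPn => [_|/negP tr].
  apply: IH => w /= /AP wr i; have := wr (lift ord0 i).
  rewrite mxE; case: splitP => j /= ij; first by have := ltn_ord j; rewrite -ij.
  by have -> : j = i by apply: val_inj; case: ij.
have -> : [set w | A (row_mx t%:M w)] = set0; last by rewrite lebesgue_rV0.
apply/seteqP; split=> // w /= /AP/(_ ord0); rewrite mxE.
case: splitP => j // _; rewrite (ord1 j) mxE mulr1n ler_norml => tr'.
by apply: tr; rewrite mem_set//= in_itv.
Qed.

End lebesgue_rV_bounds.

(** * Intensities *)

Section powers.
Context {R : realType}.

Lemma integral_powR_ge (beta e H : R) : -1 < beta -> 0 < e < H ->
  (\int[lebesgue_measure]_(h in `[e, H]) (h `^ beta)%:E <=
   (H `^ (beta + 1) / (beta + 1))%:E)%E.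
Proof.
move=> b1 /andP[e0 eH]; have b10 : 0 < beta + 1 by lra.
pose F (x : R) := (beta + 1)^-1 * x `^ (beta + 1).
have dF (x : R) : 0 < x -> is_derive x (1 : R) F (x `^ beta).
  move=> x0; rewrite (_ : x `^ beta = (beta + 1)^-1 *: ((beta + 1) * x `^ (beta + 1 - 1))).
    by apply: is_deriveZ; exact: is_derive1_powR.
  by rewrite addrK /GRing.scale/= mulKf// gt_eqF.
have cF (x : R) : 0 < x -> {for x, continuous F}.
  move=> x0; apply: differentiable_continuous; apply/derivable1_diffP.
  by have [] := dF x x0.
rewrite (continuous_FTC2 (F := F))//.
- rewrite -EFinB lee_fin /F mulrC lerBlDr lerDl.
  by rewrite mulr_ge0 ?powR_ge0// invr_ge0 ltW.
- apply: derivable_within_continuous => x; rewrite in_itv/= => /andP[ex _].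
  by apply: derivable_powR; rewrite in_itv/= andbT; apply: lt_le_trans ex.
- split=> [x|//|//].
  + rewrite in_itv/= => /andP[ex _].
    by have [] := dF x (lt_trans e0 ex).
  + by apply: cvg_at_right_filter; exact: cF.
  + by apply: cvg_at_left_filter; apply: cF; exact: lt_trans eH.
- move=> x; rewrite in_itv/= => /andP[ex _].
  by rewrite derive1E; have [_ ->] := dF x (lt_trans e0 ex).
Qed.

(** The power may be unbounded at [0], so that the antiderivative is used on
    [[e, H]] with [e] tending to [0]. *)
Lemma integral_powR_le (beta H : R) : -1 < beta -> 0 < H ->
  (\int[lebesgue_measure]_(h in `[0%R, H]) (h `^ beta)%:E <=
   (H `^ (beta + 1) / (beta + 1))%:E)%E.
Proof.
move=> b1 H0.
have mp (D : set R) : measurable_fun D (fun h : R => (h `^ beta)%:E).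
  apply: measurable_funTS; apply/measurable_EFinP; exact: measurable_powR.
rewrite -integral_itv_obnd_cbnd//.
pose e (i : nat) : R := H / i.+2%:R.
have e0 i : 0 < e i by rewrite divr_gt0.
have -> : `]0, H]%classic = \bigcup_i `[e i, H]%classic.
  apply/seteqP; split=> [x|x [i _]]; rewrite /= !in_itv/= => /andP[]; last first.
    by move=> ex ->; rewrite (lt_le_trans (e0 i) ex).
  move=> x0 xH; exists (Num.truncn (H / x)) => //=; rewrite in_itv/= xH andbT.
  rewrite /e ler_pdivrMr// -ler_pdivrMl// mulrC.
  by apply: le_trans (ltW (truncnS_gt _)) _; rewrite ler_nat.
have cv : ((\int[lebesgue_measure]_(h in `[e i, H]) (h `^ beta)%:E) @[i --> \oo] -->
    \int[lebesgue_measure]_(h in \bigcup_i `[e i, H]%classic) (h `^ beta)%:E)%E.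
  apply: ge0_nondecreasing_set_cvg_integral => [i j ij|i|i|i x _].
  - apply/subsetPset => x /=; rewrite !in_itv/= => /andP[ex ->].
    rewrite andbT; apply: le_trans ex.
    by rewrite ler_pM2l// lef_pV2 ?posrE ?ltr0n// ler_nat.
  - exact: measurable_itv.
  - exact: mp.
  - by rewrite lee_fin powR_ge0.
apply: (cvge_to_le cv).
apply: nearW => i; apply: integral_powR_ge => //; rewrite e0/=.
by rewrite ltr_pdivrMr// ltr_pMr// ltr1n.
Qed.

End powers.

Section intensity_bounds.
Context {R : realType}.
Variables (d : nat) (gamma beta : R).
Hypothesis c_ge0 : 0 <= gamma * beta_const d.+1 beta.
Implicit Types (A : set ('rV[R]_d * R)%type).

Lemma beta_intensity_ge A (h1 h2 b c : R) : 0 <= h1 <= h2 -> 0 <= b -> 0 <= c ->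
  (forall h, h1 <= h <= h2 -> b <= h `^ beta) ->
  (forall h, h1 <= h <= h2 -> (c%:E <= lebesgue_rV [set v | A (v, h)])%E) ->
  ((gamma * beta_const d.+1 beta * b * c * (h2 - h1))%:E <= beta_intensity gamma beta A)%E.
Proof.
move=> /andP[h10 h12] b0 c0 bP cP; rewrite EFinM -lebesgue_itv_cc//.
apply: le_integral_cst => //.
- by move=> h /=; rewrite !in_itv/= andbT => /andP[h1h _]; exact: le_trans h1h.
- by rewrite mulr_ge0// mulr_ge0.
- move=> h _; apply: mule_ge0; last exact: lebesgue_rV_ge0.
  by rewrite lee_fin mulr_ge0// powR_ge0.
move=> h /=; rewrite in_itv/= => hh.
apply: (@le_trans _ _ ((gamma * beta_const d.+1 beta * b)%:E * lebesgue_rV [set v | A (v, h)])%E).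
  rewrite EFinM; apply: lee_wpmul2l; last exact: cP.
  by rewrite lee_fin mulr_ge0.
apply: lee_wpmul2r; first exact: lebesgue_rV_ge0.
by rewrite lee_fin ler_wpM2l// bP.
Qed.

(** The sites able to cut a cell that is contained in a ball around the origin:
    those close to the origin, and those of negative height, whose intensity is
    zero. *)
Definition region (r H : R) : set ('rV[R]_d * R)%type :=
  [set x : 'rV[R]_d * R | x.2 < 0 \/ (forall i : 'I_d, `|x.1 0 i| <= r) /\ x.2 <= H].

Lemma beta_intensity_region (r H : R) : -1 < beta -> 0 <= r -> 0 < H ->
  (beta_intensity gamma beta (region r H) <=
   (gamma * beta_const d.+1 beta * (2 * r) ^+ d * (H `^ (beta + 1) / (beta + 1)))%:E)%E.
Proof.
move=> b1 r0 H0.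
rewrite [leRHS]EFinM.
apply: (@le_trans _ _ (\int[lebesgue_measure]_(h in `[0%R, H])
   ((gamma * beta_const d.+1 beta * (2 * r) ^+ d)%:E * (h `^ beta)%:E))%E); last first.
  rewrite ge0_integralZl_EFin//.
  - apply: lee_wpmul2l; last exact: integral_powR_le.
    by rewrite lee_fin mulr_ge0// exprn_ge0// mulr_ge0.
  - by move=> h _; rewrite lee_fin powR_ge0.
  - by apply: measurable_funTS; apply/measurable_EFinP; exact: measurable_powR.
  - by rewrite mulr_ge0// exprn_ge0// mulr_ge0.
rewrite /beta_intensity integral_mkcond [leRHS]integral_mkcond.
apply: le_integral_ge0 => h _; rewrite /patch.
  case: ifPn => // _; apply: mule_ge0; last exact: lebesgue_rV_ge0.
  by rewrite lee_fin mulr_ge0// powR_ge0.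
case: ifPn => [/set_mem|_]; last first.
  case: ifPn => // _; rewrite -EFinM lee_fin.
  by rewrite mulr_ge0 ?powR_ge0// mulr_ge0// exprn_ge0// mulr_ge0.
rewrite /= in_itv/= andbT => h0; have [hH|Hh] := leP h H.
  rewrite mem_set; last by rewrite /= in_itv/= h0.
  rewrite -EFinM [X in (_ <= X%:E)%E]mulrAC [leRHS]EFinM; apply: lee_wpmul2l.
    by rewrite lee_fin mulr_ge0// powR_ge0.
  apply: lebesgue_rV_le_box => // v [/=|[]//].
  by rewrite ltNge h0.
rewrite memNset; last by rewrite /= in_itv/= h0/= leNgt Hh.
have -> : [set v | region r H (v, h)] = set0; last by rewrite lebesgue_rV0 mule0.
apply/seteqP; split=> // v [/=|[_ /=]]; first by rewrite ltNge h0.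
by rewrite leNgt Hh.
Qed.

Lemma continuous_coord i : continuous (fun x : 'rV[R]_d * R => x.1 0 i).
Proof.
move=> x; apply: (@continuous_comp _ _ _ fst (fun v : 'rV[R]_d => v 0 i)).
  exact: cvg_fst.
exact: (@coord_continuous R 1 d 0 i).
Qed.

Lemma borel_region (r H : R) : borel (region r H).
Proof.
have c2 : continuous (snd : 'rV[R]_d * R -> R) by move=> x; exact: cvg_snd.
have -> : region r H = (snd @^-1` [set t | t < 0]) `|`
  ((\bigcap_(i in setT) ((fun x : 'rV[R]_d * R => `|x.1 0 i|) @^-1` [set t | t <= r])) `&`
   (snd @^-1` [set t | t <= H])).
  apply/seteqP; split=> x /= [x0|[x1 x2]]; [by left| |by left|].
    by right; split=> // i _; exact: x1.
  by right; split=> // i; exact: (x1 i I).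
apply: borelU; first by apply: borel_open; apply: open_comp => [x _|]; [exact: c2|exact: open_lt].
apply: borelI; last first.
  by apply: borel_closed; apply: preimage_closed => [x _|]; [exact: c2|exact: closed_le].
apply: borel_closed; apply: closed_bigI => i _.
apply: preimage_closed => [x _|]; last exact: closed_le.
apply: (@continuous_comp _ _ _ (fun x : 'rV[R]_d * R => x.1 0 i) (fun t : R => `|t|)).
  exact: continuous_coord.
exact: norm_continuous.
Qed.

End intensity_bounds.

(** * Poisson processes with one point in each box *)

Section counting_points.
Context {R : realType} {T : choiceType}.

Lemma counting_eq0 (X : set T) : @counting T R X = 0%E -> X = set0.
Proof.
rewrite /counting; case: ifPn => [/asboolP fX [/eqP]|//].
by rewrite pnatr_eq0 cardfs_eq0 => /eqP/fset_set_set0 ->.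
Qed.

Lemma counting_eq1 (X : set T) : @counting T R X = 1%E -> exists x, X = [set x].
Proof.
rewrite /counting; case: ifPn => [/asboolP fX [/eqP]|//].
rewrite -[1]/(1%:R) eqr_nat => /cardfs1P[x Xx]; exists x.
rewrite -(fset_setK fX) Xx; apply/seteqP.
by split=> y /=; rewrite inE => /eqP.
Qed.

Lemma counting_ge1 (X : set T) x : X x -> (1 <= @counting T R X)%E.
Proof.
move=> Xx; rewrite /counting; case: ifPn => [/asboolP fX|_]; last exact: leey.
rewrite lee_fin -[1]/(1%:R) ler_nat lt0n cardfs_eq0; apply/eqP => X0.
by have := fset_setK fX; rewrite X0 => X0'; move: Xx; rewrite -X0'.
Qed.

Lemma counting_ge0 (X : set T) : (0 <= @counting T R X)%E.
Proof. by rewrite /counting; case: ifPn => _; rewrite ?leey// lee_fin. Qed.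

End counting_points.

Section poisson_event.
Context {R : realType} {disp : measure_display} {Omega : measurableType disp}.
Context {P : probability Omega R} {T : topologicalType}.
Variables (mu : set T -> \bar R) (eta : Omega -> set T).
Local Notation npt B := (fun omega : Omega => npoints eta B omega : \bar R).
Hypothesis pp : poisson_process P mu eta.

Lemma measurable_npoints_eq B (k : nat) : borel B ->
  measurable [set omega | npt B omega = k%:R%:E].
Proof.
case: pp => -[_ mN] _ _ bB; have := mN B bB measurableT _ (emeasurable_set1 k%:R%:E).
by rewrite setTI.
Qed.

Lemma measurable_pattern m (B : 'I_m -> set T) V : (forall i, borel (B i)) -> borel V ->
  measurable ([set omega | npt V omega = 0%E] `&`
    \bigcap_(i in setT) [set omega | npt (B i) omega = 1%E]).
Proof.
move=> bB bV; apply: measurableI; first exact: (measurable_npoints_eq 0 bV).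
apply: fin_bigcap_measurable => // i _.
exact: (measurable_npoints_eq 1 (bB i)).
Qed.

(** The exponential factors of the independent counts multiply to the probability
    that the whole region is empty: the Poisson law itself provides the additivity
    of [mu]. *)
Lemma poisson_pattern m (B : 'I_m -> set T) (U : set T) :
  (forall i, borel (B i)) -> borel U -> trivIset setT B ->
  (forall i, B i `<=` U) -> (forall i, mu (B i) < +oo)%E -> (mu U < +oo)%E ->
  (mu (U `\` \bigcup_i B i) < +oo)%E ->
  P ([set omega | npt (U `\` \bigcup_i B i) omega = 0%E] `&`
     \bigcap_(i in setT) [set omega | npt (B i) omega = 1%E]) =
  ((\prod_(i < m) fine (mu (B i))) * expR (- fine (mu U)))%:E.
Proof.
move=> bB bU tB BU muB muU muV.
case: (pp) => -[_ mN] pois indep.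
set V := U `\` _.
have bUB : borel (\bigcup_i B i) by exact: borel_bigcup_ord.
have bV : borel V by exact: borelD.
pose C (j : 'I_m.+1) := if unlift ord0 j is Some i then B i else V.
have bC j : borel (C j) by rewrite /C; case: unliftP.
have muC j : (mu (C j) < +oo)%E by rewrite /C; case: unliftP.
have tC : trivIset setT C.
  move=> i j _ _; rewrite /C; case: unliftP => [i' ->|->]; case: unliftP => [j' ->|->//].
  - by move=> /(tB _ _ I I) ->.
  - by move=> [x [Bx [_ nBx]]]; exfalso; apply: nBx; exists i'.
  - by move=> [x [[_ nBx] Bx]]; exfalso; apply: nBx; exists j'.
have poisE j (k : nat) : P (npt (C j) @^-1` [set k%:R%:E]) =
    (fine (mu (C j)) ^+ k / k`!%:R * expR (- fine (mu (C j))))%:E.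
  exact: pois.
(* [U] is empty exactly when its pieces are, and these are independent. *)
have E0 : P (npt U @^-1` [set 0%:R%:E]) =
    (\prod_(j < m.+1) expR (- fine (mu (C j))))%:E.
  have -> : npt U @^-1` [set 0%:R%:E] =
      \bigcap_(j in setT) (npt (C j) @^-1` [set 0%:R%:E]).
    apply/seteqP; split=> omega /=.
      move=> U0 j _ /=; rewrite /npoints.
      have -> : eta omega `&` C j = set0; last by rewrite /counting asboolT// fset_set0.
      apply/seteqP; split=> // x [ex Cx]; rewrite -(counting_eq0 U0); split => //.
      by move: Cx; rewrite /C; case: unliftP => [i _|_ []//]; exact: BU.
    move=> C0; rewrite /npoints.
    have -> : eta omega `&` U = set0; last by rewrite /counting asboolT// fset_set0.
    apply/seteqP; split=> // x [ex Ux].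
    have [[i _ Bx]|nBx] := pselect ((\bigcup_i B i) x).
      by rewrite -(counting_eq0 (C0 (lift ord0 i) I)) /C liftK.
    by rewrite -(counting_eq0 (C0 ord0 I)) /C unlift_none.
  rewrite indep//.
  rewrite -prodEFin; apply: eq_bigr => j _; rewrite poisE.
  by rewrite expr0 fact0 divr1 mul1r.
have E1 : P (npt U @^-1` [set 0%:R%:E]) = (expR (- fine (mu U)))%:E.
  by have := pois U bU muU 0%N; rewrite expr0 fact0 divr1 mul1r.
rewrite (_ : _ `&` _ = \bigcap_(j in setT) (npt (C j) @^-1`
    (if j == ord0 then [set 0%:R%:E] else [set 1%:R%:E]))); last first.
  apply/seteqP; split=> [omega [V0 B1] j _|omega CC].
    rewrite /C; case: unliftP => [i ->|->]; last by rewrite eqxx.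
    by rewrite eq_sym (negbTE (neq_lift _ _)); exact: (B1 i I).
  split; first by have := CC ord0 I; rewrite /C unlift_none eqxx.
  move=> i _; have := CC (lift ord0 i) I.
  by rewrite /C liftK eq_sym (negbTE (neq_lift _ _)).
rewrite indep// => [|j]; last by case: ifP => _; exact: emeasurable_set1.
move: E0; rewrite E1 => -[->].
rewrite !big_ord_recl eqxx mulrCA EFinM; congr (_ * _)%E.
  by rewrite poisE expr0 fact0 divr1 mul1r.
rewrite -big_split -prodEFin; apply: eq_bigr => i _.
rewrite eq_sym (negbTE (neq_lift _ _)) poisE expr1 (_ : 1`!%:R = 1 :> R)// divr1.
by rewrite /C liftK.
Qed.

End poisson_event.

(** * Polytopes with prescribed facets *)

Section cell_geometry.
Context {R : realType} {e m : nat}.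
Local Notation d := e.+1.
Local Notation D := (d%:R : R).
Implicit Types w x y : 'rV[R]_d.

Lemma D_ge1 : 1 <= D. Proof. by rewrite ler1n. Qed.

Lemma sum_le_card (F : 'I_d -> R) (c : R) : (forall i, F i <= c) -> \sum_i F i <= D * c.
Proof.
move=> Fc; apply: le_trans (ler_sum _ (fun i _ => Fc i)) _.
by rewrite sumr_const card_ord mulr_natl.
Qed.

Lemma dotp_le_sup x w (c M : R) : 0 <= c -> (forall i, `|x 0 i| <= c) ->
  (forall i, `|w 0 i| <= M) -> `|dotp x w| <= D * (c * M).
Proof.
move=> c0 xc wM; apply: le_trans (ler_norm_sum _ _ _) _.
by apply: sum_le_card => i; rewrite normrM ler_pM.
Qed.

Lemma enorm_le_sup x (c : R) : 0 <= c -> (forall i, `|x 0 i| <= c) -> enorm x <= D * c.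
Proof.
move=> c0 xc; have D1 := D_ge1.
rewrite -(ler_pXn2r (n := 2))// ?nnegrE ?enorm_ge0 ?mulr_ge0//.
rewrite sqr_enorm; apply: le_trans (ler_norm _) _.
apply: le_trans (dotp_le_sup c0 xc xc) _; rewrite exprMn expr2.
by rewrite -expr2 ler_wpM2r ?sqr_ge0//; nra.
Qed.

(** The cosine of an angle in terms of the distance of the unit vectors. *)
Lemma dotp_unit x y : x != 0 -> y != 0 ->
  dotp x y / (enorm x * enorm y) =
  1 - dotp ((enorm x)^-1 *: x - (enorm y)^-1 *: y) ((enorm x)^-1 *: x - (enorm y)^-1 *: y) / 2.
Proof.
have en z : z != 0 -> enorm z != 0.
  by apply: contra_neq => z0; apply: dotp_eq0; rewrite -sqr_enorm z0 expr0n.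
move=> /en x0 /en y0.
rewrite !dotpBr !dotpBl !dotpZl !dotpZr -!sqr_enorm (dotpC y x).
by field; rewrite x0 y0.
Qed.

(** A cell seen from its site, divided by the scale [rho]: the constraints are
    [2 <a, w> <= b]. The [d] coarse ones have [a] close to [- e_k] and bound a
    slightly tilted orthant. The [m] fine ones have [a] in the positive orthant,
    and their hyperplanes are tangent to the unit sphere up to an error of order
    [delta ^ 2], at points whose mutual distance is of order [delta]. *)
Variables (ca : 'I_d -> 'rV[R]_d) (cb : 'I_d -> R) (fa : 'I_m -> 'rV[R]_d) (fb : 'I_m -> R).
Variable delta : R.
Let eps : R := (48 * D ^+ 3)^-1.

Hypothesis delta01 : 0 < delta <= 1.
Hypothesis caP : forall k i, `|ca k 0 i + (i == k)%:R| <= eps.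
Hypothesis cbP : forall k, 2^-1 <= cb k <= 5.
Hypothesis faP : forall p i, (8 * D)^-1 <= fa p 0 i <= 3.
Hypothesis frP : forall p, 2^-1 <= enorm (fa p).
Hypothesis fbP : forall p, `|fb p - 2 * enorm (fa p)| <= delta ^+ 2 / 32.
Hypothesis fsep : forall p p', p != p' -> exists i,
  delta / 2 <= `|fa p 0 i / enorm (fa p) - fa p' 0 i / enorm (fa p')|.

Let D1 : 1 <= D. Proof. exact: D_ge1. Qed.

Let D0 : 0 < D. Proof. by rewrite ltr0n. Qed.

Let c00 : 0 < (8 * D)^-1. Proof. by rewrite invr_gt0 mulr_gt0. Qed.

Let eps0 : 0 < eps.
Proof. by rewrite invr_gt0 mulr_gt0// exprn_gt0//; lra. Qed.

Let Deps : D ^+ 3 * eps = 48^-1.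
Proof. by rewrite /eps; field; rewrite gt_eqF//; lra. Qed.

Let Deps1 : D * eps <= 48^-1.
Proof.
rewrite -Deps ler_pM2r// -[leLHS]mulr1 exprS (ler_pM2l D0).
exact: exprn_ege1.
Qed.

Let fa_neq0 p : fa p != 0.
Proof.
apply/eqP => f0; have := frP p; rewrite f0 enorm0.
by rewrite leNgt invr_gt0 ltr0n.
Qed.

Let ca_dotp k w (M : R) : (forall i, `|w 0 i| <= M) ->
  `|dotp (ca k) w + w 0 k| <= D * (eps * M).
Proof.
move=> wM; have -> : dotp (ca k) w + w 0 k = dotp (ca k + delta_mx 0 k) w.
  rewrite dotpDl; congr (_ + _); rewrite /dotp (bigD1 k)//= mxE !eqxx mul1r.
  by rewrite big1 ?addr0// => i ik; rewrite mxE eqxx (negbTE ik) mul0r.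
apply: dotp_le_sup => //; first exact: ltW.
by move=> i; rewrite !mxE eqxx.
Qed.

(** The cap beyond the hyperplane tangent to the unit sphere at some point has its
    pole there, and a point slightly above the pole is still outside the caps whose
    poles are at distance at least [delta / 2]. *)
Definition fine_witness p : 'rV[R]_d := ((1 + delta ^+ 2 / 16) / enorm (fa p)) *: fa p.
(** Far out on a negative axis, only the corresponding coarse constraint fails. *)
Definition coarse_witness (k : 'I_d) : 'rV[R]_d := (- 5) *: delta_mx 0 k.

Let r0 p : 0 < enorm (fa p). Proof. by have := frP p; lra. Qed.

Let delta2 : 0 < delta ^+ 2 <= 1.
Proof. by case/andP: delta01 => d0 d1; rewrite exprn_gt0//= exprn_ile1// ltW. Qed.

Lemma fine_witness_own p : fb p < 2 * dotp (fa p) (fine_witness p).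
Proof.
rewrite /fine_witness dotpZr -sqr_enorm.
have -> : (1 + delta ^+ 2 / 16) / enorm (fa p) * enorm (fa p) ^+ 2 =
   (1 + delta ^+ 2 / 16) * enorm (fa p) by field; rewrite gt_eqF.
have := fbP p; have := frP p; rewrite ler_norml; case/andP: delta2; nra.
Qed.

Lemma fine_witness_other p p' : p' != p -> 2 * dotp (fa p') (fine_witness p) < fb p'.
Proof.
move=> pp; rewrite /fine_witness dotpZr.
have -> : (1 + delta ^+ 2 / 16) / enorm (fa p) * dotp (fa p') (fa p) =
    (1 + delta ^+ 2 / 16) * enorm (fa p') *
    (dotp (fa p') (fa p) / (enorm (fa p') * enorm (fa p))).
  by field; rewrite !gt_eqF.
rewrite dotp_unit ?fa_neq0//.
set z := (_ *: _ - _); have [i iz] := fsep pp.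
(* The cosine of the angle between the two normals is [1 - |z|^2 / 2]. *)
have zz : delta ^+ 2 / 4 <= dotp z z.
  apply: (@le_trans _ _ (`|z 0 i| ^+ 2)); last first.
    by rewrite -sqr_enorm ler_pXn2r ?nnegrE ?enorm_ge0// coord_le_enorm.
  have -> : delta ^+ 2 / 4 = (delta / 2) ^+ 2 by field.
  case/andP: delta01 => d0 _.
  rewrite ler_pXn2r ?nnegrE//; last by lra.
  by rewrite !mxE ![_^-1 * _]mulrC.
have := fbP p'; have := frP p'; rewrite ler_norml; case/andP: delta2.
set r := enorm _; set t := dotp z z in zz *; move: zz; set s := delta ^+ 2.
move=> zz s0 s1 rr /andP[b1 b2].
have : (1 + s / 16) * (1 - t / 2) <= 1 - s / 16 by nra.
nra.
Qed.

Let fine_witness_coord p i : 0 <= fine_witness p 0 i <= 2.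
Proof.
rewrite mxE; have /andP[f0 f3] := faP p i.
have fi0 : 0 < fa p 0 i by apply: lt_le_trans f0.
have fr : fa p 0 i / enorm (fa p) <= 1.
  rewrite ler_pdivrMr ?r0// mul1r; apply: le_trans (coord_le_enorm _ i).
  exact: ler_norm.
have fr0 : 0 <= fa p 0 i / enorm (fa p) by rewrite divr_ge0// ltW.
rewrite mulrAC -mulrA; case/andP: delta2 => s0 s1; nra.
Qed.

Lemma fine_witness_coarse p k : 2 * dotp (ca k) (fine_witness p) < cb k.
Proof.
have := @ca_dotp k (fine_witness p) 2.
have wk i := fine_witness_coord p i.
have wk2 i : `|fine_witness p 0 i| <= 2 by have /andP[w0 w2] := wk i; rewrite ger0_norm.
move=> /(_ wk2); rewrite ler_norml => /andP[_].
have /andP[w0 _] := wk k; have /andP[b1 _] := cbP k; have := Deps1.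
rewrite mulrA; lra.
Qed.

Let coarse_coord k i : `|coarse_witness k 0 i| <= 5.
Proof.
rewrite !mxE eqxx /=; case: eqP => _; last by rewrite mulr0 normr0.
by rewrite mulr1 normrN ger0_norm.
Qed.

Lemma coarse_witness_own k : cb k < 2 * dotp (ca k) (coarse_witness k).
Proof.
have := ca_dotp k (coarse_coord k); have /andP[_ b5] := cbP k; have := Deps1.
by rewrite ler_norml mulrA !mxE !eqxx /=; lra.
Qed.

Lemma coarse_witness_other k k' : k' != k -> 2 * dotp (ca k') (coarse_witness k) < cb k'.
Proof.
move=> kk; have := ca_dotp k' (coarse_coord k); have /andP[b5 _] := cbP k'; have := Deps1.
by rewrite ler_norml mulrA !mxE eqxx (negbTE kk) /=; lra.
Qed.

Lemma fb_gt p : 2^-1 < fb p < 8 * D.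
Proof.
have := fbP p; have := frP p; rewrite ler_norml; case/andP: delta2 => s0 s1 r /andP[b1 b2].
have f3 i : `|fa p 0 i| <= 3.
  have /andP[f0 f3] := faP p i.
  by rewrite ger0_norm//; apply: le_trans f0; exact: ltW.
have := @enorm_le_sup (fa p) 3 _ f3; lra.
Qed.

Lemma coarse_witness_fine k p : 2 * dotp (fa p) (coarse_witness k) < fb p.
Proof.
have /andP[b _] := fb_gt p.
have -> : dotp (fa p) (coarse_witness k) = - 5 * fa p 0 k.
  rewrite dotpZr; congr (_ * _); rewrite /dotp (bigD1 k)//= mxE !eqxx mulr1.
  by rewrite big1 ?addr0// => i ik; rewrite mxE eqxx (negbTE ik) mulr0.
have /andP[f0 _] := faP p k.
have : 0 < fa p 0 k by apply: lt_le_trans f0.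
lra.
Qed.

(** The coarse constraints bound the coordinates of [w] from below, up to a small
    multiple of the largest one; a fine constraint, whose normal is positive,
    then bounds them from above. *)
Lemma cell_bounded w p : (forall k, 2 * dotp (ca k) w <= cb k) ->
  2 * dotp (fa p) w <= fb p -> forall i, `|w 0 i| <= 400 * D ^+ 2.
Proof.
move=> cw fw.
pose M : R := \big[Num.max/0]_i `|w 0 i|.
have wM i : `|w 0 i| <= M by exact: le_bigmax.
have M0 : 0 <= M by apply: le_trans (wM ord0).
suff : M <= 400 * D ^+ 2 by move=> MD i; exact: le_trans (wM i) MD.
(* The coarse constraints give the lower bound [- N] for every coordinate. *)
have [N NE] : exists N : R, N = 5 / 2 + D * eps * M by eexists.
have N0 : 0 <= N by rewrite NE addr_ge0// !mulr_ge0// ltW.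
have wN k : - N <= w 0 k.
  have := ca_dotp k wM; have := cw k; have /andP[_ b5] := cbP k.
  rewrite ler_norml mulrA NE; lra.
have /andP[_ fb8] := fb_gt p.
have up i : w 0 i <= 8 * D * (4 * D + 3 * D * N).
  have sumN : - (D * (3 * N)) + fa p 0 i * w 0 i <= dotp (fa p) w.
    have -> : D * (3 * N) = \sum_(j < d) 3 * N by rewrite sumr_const card_ord mulr_natl.
    rewrite addrC lerBlDr /dotp -big_split /= (bigD1 i)//= -addrA lerDl.
    have fN j : 0 <= fa p 0 j * w 0 j + 3 * N.
      have /andP[f0 f3] := faP p j.
      have {}f0 : 0 < fa p 0 j by apply: lt_le_trans f0.
      by have := wN j; nra.
    by rewrite addr_ge0 ?mulr_ge0// sumr_ge0.
  have /andP[f0 f3] := faP p i.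
  have [wi|wi] := leP (w 0 i) 0.
    by apply: le_trans wi _; rewrite !mulr_ge0// ?addr_ge0 ?mulr_ge0//; lra.
  have : (8 * D)^-1 * w 0 i <= 4 * D + 3 * D * N.
    apply: (@le_trans _ _ (fa p 0 i * w 0 i)); first by rewrite ler_wpM2r// ltW.
    move: sumN fw fb8; set dp := dotp _ _; set x := fa _ _ _ * _; set b := fb p; set DD := D.
    lra.
  by rewrite ler_pdivrMl// mulr_gt0.
have Deps3 : D ^+ 3 * eps = 48^-1 := Deps.
move: D1 N0 NE up wN Deps3; set DD := D; set ep := eps => DD1 N0 NE up wN Deps3.
have DN : N <= 8 * DD * (4 * DD + 3 * DD * N) by nra.
have MN : M <= 8 * DD * (4 * DD + 3 * DD * N).
  apply: bigmax_le => [|i _]; first exact: le_trans DN.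
  by rewrite ler_norml up andbT; apply: le_trans (wN i); rewrite lerN2.
(* [eps] was chosen such that the feedback of [M] in its own bound is [M / 2]. *)
have E : 24 * DD ^+ 2 * (DD * ep * M) = M / 2.
  have -> : 24 * DD ^+ 2 * (DD * ep * M) = 24 * (DD ^+ 3 * ep) * M by ring.
  by rewrite Deps3; field.
have : 8 * DD * (4 * DD + 3 * DD * N) = 32 * DD ^+ 2 + 60 * DD ^+ 2 +
    24 * DD ^+ 2 * (DD * ep * M) by rewrite NE; field.
rewrite E => EN; rewrite EN in MN; nra.
Qed.

End cell_geometry.

Section cell_polytope.
Context {R : realType} {e m : nat}.
Local Notation d := e.+1.
Local Notation D := (d%:R : R).

(** Each constraint is violated by a witness that satisfies all the others
    strictly, so every constraint contributes a facet. *)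
Lemma cell_polytope (rho delta : R) (ca : 'I_d -> 'rV[R]_d) (cb : 'I_d -> R)
    (fa : 'I_m -> 'rV[R]_d) (fb : 'I_m -> R) (a : 'I_(d + m) -> 'rV[R]_d) (b : 'I_(d + m) -> R) :
  0 < rho -> (0 < m)%N -> 0 < delta <= 1 ->
  (forall k i, `|ca k 0 i + (i == k)%:R| <= (48 * D ^+ 3)^-1) ->
  (forall k, 2^-1 <= cb k <= 5) ->
  (forall p i, (8 * D)^-1 <= fa p 0 i <= 3) ->
  (forall p, 2^-1 <= enorm (fa p)) ->
  (forall p, `|fb p - 2 * enorm (fa p)| <= delta ^+ 2 / 32) ->
  (forall p p', p != p' -> exists i,
    delta / 2 <= `|fa p 0 i / enorm (fa p) - fa p' 0 i / enorm (fa p')|) ->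
  (forall k, a (lshift m k) = (2 * rho) *: ca k /\ b (lshift m k) = rho ^+ 2 * cb k) ->
  (forall p, a (rshift d p) = (2 * rho) *: fa p /\ b (rshift d p) = rho ^+ 2 * fb p) ->
  [/\ polytope_with_facets (d + m) (polyhedron a b), convex_body (polyhedron a b) &
    forall w, polyhedron a b w -> forall i, `|w 0 i| <= 400 * D ^+ 2 * rho].
Proof.
move=> rho0 m0 d01 caP cbP faP frP fbP fsep aL aR.
have rho2 : 0 < rho ^+ 2 by rewrite exprn_gt0.
have scale x (w : 'rV[R]_d) : dotp ((2 * rho) *: x) (rho *: w) = rho ^+ 2 * (2 * dotp x w).
  by rewrite dotpZl dotpZr; ring.
have b0 j : 0 < b j.
  case: (splitP j) => k jk.
    have -> : j = lshift m k by exact: val_inj.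
    rewrite (aL k).2 mulr_gt0//; have /andP[+ _] := cbP k; apply: lt_le_trans.
    by rewrite invr_gt0.
  have -> : j = rshift d k by exact: val_inj.
  rewrite (aR k).2 mulr_gt0//.
  have /andP[+ _] := fb_gt d01 faP frP fbP k; apply: lt_trans.
  by rewrite invr_gt0.
have bd w : polyhedron a b w -> forall i, `|w 0 i| <= 400 * D ^+ 2 * rho.
  move=> Pw i; pose w1 := rho^-1 *: w.
  have ww : w = rho *: w1 by rewrite scalerA divff ?scale1r// gt_eqF.
  have c1 k : 2 * dotp (ca k) w1 <= cb k.
    by have := Pw (lshift m k); rewrite (aL k).1 (aL k).2 ww scale ler_pM2l.
  have f1 : 2 * dotp (fa (Ordinal m0)) w1 <= fb (Ordinal m0).
    by have := Pw (rshift d (Ordinal m0)); rewrite (aR _).1 (aR _).2 ww scale ler_pM2l.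
  have := cell_bounded d01 caP cbP faP frP fbP c1 f1 i.
  have -> : w 0 i = rho * w1 0 i by rewrite {1}ww mxE.
  by rewrite normrM (gtr0_norm rho0) [X in _ -> _ <= X]mulrC ler_pM2l.
pose x (j : 'I_(d + m)) : 'rV[R]_d := rho *: (match fintype.split j with inl k => coarse_witness k | inr p => fine_witness fa delta p end).
have sL k : fintype.split (lshift m k) = inl k by exact: (unsplitK (inl k)).
have sR p : fintype.split (rshift d p) = inr p by exact: (unsplitK (inr p)).
split=> //; last exact: (polyhedron_body b0 bd).
apply: (@polyhedron_facets _ _ _ _ _ b0 x _ _ _ bd).
- move=> j; case: (splitP j) => k jk.
    have -> : j = lshift m k by exact: val_inj.
    rewrite (aL k).1 (aL k).2 /x sL scale ltr_pM2l//.
    exact: coarse_witness_own.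
  have -> : j = rshift d k by exact: val_inj.
  rewrite (aR k).1 (aR k).2 /x sR scale ltr_pM2l//.
  exact: fine_witness_own.
move=> i j; case: (splitP j) => k jk.
  have -> : j = lshift m k by exact: val_inj.
  case: (splitP i) => l il.
    have -> : i = lshift m l by exact: val_inj.
    rewrite (inj_eq (@lshift_inj _ _)) => lk.
    rewrite (aL l).1 (aL l).2 /x sL scale ltr_pM2l//.
    exact: coarse_witness_other.
  have -> : i = rshift d l by exact: val_inj.
  move=> _; rewrite (aR l).1 (aR l).2 /x sL scale ltr_pM2l//.
  exact: (coarse_witness_fine d01).
have -> : j = rshift d k by exact: val_inj.
case: (splitP i) => l il.
  have -> : i = lshift m l by exact: val_inj.
  move=> _; rewrite (aL l).1 (aL l).2 /x sR scale ltr_pM2l//.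
  exact: fine_witness_coarse.
have -> : i = rshift d l by exact: val_inj.
rewrite (inj_eq (@rshift_inj _ _)) => lk.
rewrite (aR l).1 (aR l).2 /x sR scale ltr_pM2l//.
exact: fine_witness_other.
Qed.

End cell_polytope.

(** * Sites that produce the prescribed facets *)

Section perturbation.
Context {R : realType} {e : nat}.
Local Notation d := e.+1.
Local Notation D := (d%:R : R).
Implicit Types v z : 'rV[R]_d.
(** The site of the cell is itself uncertain: [z] and [t] are its position and
    height, divided by [rho] and [rho ^ 2]. An uncertainty small against
    [delta ^ 2] does not destroy the tangency. *)
Variables (delta : R) (z : 'rV[R]_d) (t : R).
Let theta := delta ^+ 2 / (256 * D).
Hypothesis d2 : (1 < d)%N.
Hypothesis deltaP : 0 < delta <= (4 * D)^-1.
Hypothesis zP : forall i, 0 <= z 0 i <= theta.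
Hypothesis tP : 0 <= t <= theta.

Let D2 : 2 <= D. Proof. by rewrite ler_nat. Qed.

Let Dn0 : D != 0. Proof. by rewrite pnatr_eq0. Qed.

Let inv4 : D * (4 * D)^-1 = 4^-1.
Proof. by move: Dn0; set DD := D => DD0; field. Qed.

Let Dtheta : D * theta = delta ^+ 2 / 256.
Proof. by rewrite /theta; move: Dn0; set DD := D => DD0; field. Qed.

Let theta0 : 0 <= theta.
Proof. by apply: divr_ge0; [exact: sqr_ge0|apply: mulr_ge0; exact: ler0n]. Qed.

Let delta8 : delta <= 8^-1.
Proof.
case/andP: deltaP => _ /le_trans; apply.
by rewrite lef_pV2 ?posrE ?mulr_gt0 ?ltr0n//; move: D2; set DD := D; lra.
Qed.

Let theta_le : theta <= delta ^+ 2 / 512.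
Proof. by move: Dtheta D2 theta0; set DD := D; set th := theta; nra. Qed.

Let z_enorm : enorm z <= delta ^+ 2 / 256.
Proof.
rewrite -Dtheta; apply: enorm_le_sup => // i.
by have /andP[z0 z1] := zP i; rewrite ger0_norm.
Qed.

(** Half of the tolerance for the normal is left to the coarse site, half to the
    core. *)
Lemma coarse_perturb v (h : R) k :
  (forall i, `|v 0 i + (i == k)%:R| <= (48 * D ^+ 3)^-1 / 2) -> 1 <= h <= 2 ->
  (forall i, `|(v - z) 0 i + (i == k)%:R| <= (48 * D ^+ 3)^-1) /\
  2^-1 <= enorm (v - z) ^+ 2 + h - t <= 5.
Proof.
move=> vP hP; set ep := (48 * D ^+ 3)^-1 in vP *.
have ep0 : 0 < ep by rewrite invr_gt0 mulr_gt0// exprn_gt0.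
have Dep : D ^+ 3 * ep = 48^-1 by rewrite /ep; move: Dn0; set DD := D => DD0; field.
have thep : theta <= ep / 2.
  have : D ^+ 3 * theta <= D ^+ 3 * (ep / 2).
    have -> : D ^+ 3 * theta = (D * delta) ^+ 2 / 256.
      by rewrite exprSr -mulrA Dtheta exprMn; ring.
    have Dd : 0 <= D * delta <= 4^-1.
      case/andP: deltaP => d0 d1; apply/andP; split.
        by apply: mulr_ge0 => //; exact: ltW.
      by rewrite -inv4 ler_pM2l.
    by rewrite mulrA Dep; move: Dd; set x := D * delta => /andP[x0 x1]; nra.
  by rewrite ler_pM2l// exprn_gt0.
have aP i : `|(v - z) 0 i + (i == k)%:R| <= ep.
  have := vP i; have /andP[z0 z1] := zP i; rewrite !mxE !ler_norml.
  move: thep theta0 z0 z1; set th := theta; set b := (i == k)%:R; move: b => b.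
  by move=> t1 t2 z0 z1 /andP[b1 b2]; apply/andP; split; lra.
split=> //.
have Dep1 : D * ep <= 48^-1.
  rewrite -Dep ler_pM2r// -[leLHS]mulr1 exprS ler_pM2l//.
  by apply: exprn_ege1; move: D2; set DD := D; lra.
have ep1 : ep <= 48^-1 by apply: le_trans Dep1; rewrite ler_peMl ?ltW//; move: D2; set DD := D; lra.
have aa : enorm (v - z) <= 1 + D * ep.
  have -> : v - z = (v - z + delta_mx 0 k) - delta_mx 0 k by rewrite addrK.
  apply: le_trans (enormD _ _) _; rewrite enormN addrC; apply: lerD.
    rewrite /enorm /dotp (bigD1 k)//= mxE !eqxx mul1r big1 ?addr0 ?sqrtr1// => i ik.
    by rewrite mxE eqxx (negbTE ik) mul0r.
  apply: enorm_le_sup => [|i]; first exact: ltW.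
  by have := aP i; rewrite !mxE eqxx.
have a0 := enorm_ge0 (v - z).
have := theta_le; have := delta8; case/andP: deltaP => d0 _; case/andP: hP => h1 h2.
case/andP: tP; move: theta Dep1 aa => th; set x := D * ep => x1 aa; nra.
Qed.

(** The height of a fine point is tuned so that its bisector with the origin is
    almost tangent to the unit sphere, in the direction of the point. *)
Lemma fine_perturb v (h : R) (q : 'I_e -> R) :
  2^-1 <= h <= 3 / 4 ->
  (forall i, (4 * D)^-1 <= q i <= (2 * D)^-1) ->
  (forall i, `|v 0 (widen_ord (leqnSn e) i) - enorm v * q i| <= delta / 16) ->
  0 <= v 0 ord_max -> 1 <= enorm v ->
  0 <= enorm v ^+ 2 - 2 * enorm v + h <= delta ^+ 2 / 64 ->
  [/\ forall i, (8 * D)^-1 <= (v - z) 0 i <= 3, 2^-1 <= enorm (v - z),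
    `|enorm (v - z) ^+ 2 + h - t - 2 * enorm (v - z)| <= delta ^+ 2 / 32 &
    forall i, `|(v - z) 0 (widen_ord (leqnSn e) i) / enorm (v - z) - q i| <= delta / 4].
Proof.
move=> hP qP vq ve0 r1 rh.
have d0 : 0 < delta by case/andP: deltaP.
have th512 := theta_le.
have rr1 : `|enorm (v - z) - enorm v| <= delta ^+ 2 / 256.
  apply: le_trans z_enorm; rewrite ler_norml; apply/andP; split.
    have := enormD (v - z) z; rewrite subrK; lra.
  by have := enormD v (- z); rewrite enormN; lra.
have r2 : enorm v <= 2.
  case/andP: hP => h1 h2; case/andP: rh => rh0 rh1; move: delta8 => d8; nra.
set r := enorm (v - z) in rr1 *; set s := enorm v in vq r1 rh rr1 r2.
have inv42 : (2 * D)^-1 = 2 * (4 * D)^-1 by move: Dn0; set DD := D => DD0; field.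
have inv48 : (8 * D)^-1 = (4 * D)^-1 / 2 by move: Dn0; set DD := D => DD0; field.
have kD := inv4; move: qP; rewrite inv42 inv48; case/andP: deltaP => _.
set ka := (4 * D)^-1 in kD * => dka qP.
have vle (i : 'I_e) : `|v 0 (widen_ord (leqnSn e) i)| <= s * (3 * ka).
  have /andP[q1 q2] := qP i; have := vq i; rewrite !ler_norml => /andP[v1 v2].
  apply/andP; split; nra.
have ka0 : 0 < ka by rewrite invr_gt0 mulr_gt0.
have ka8 : ka <= 8^-1 by move: kD D2; set DD := D; nra.
have ve : 2^-1 <= v 0 ord_max.
  have sle : s ^+ 2 <= \sum_(i < e) (s * (3 * ka)) ^+ 2 + v 0 ord_max ^+ 2.
    rewrite /s sqr_enorm /dotp big_ord_recr /= -expr2 lerD2r.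
    apply: ler_sum => i _.
    by have := vle i; rewrite -/s ler_norml => /andP[]; set y := s * _; nra.
  have ele : \sum_(i < e) (s * (3 * ka)) ^+ 2 <= 9 / 32 * s ^+ 2.
    rewrite sumr_const card_ord -[_ *+ e]mulr_natl.
    have eD : e%:R <= D by rewrite ler_nat.
    have ek : e%:R * ka <= 4^-1 by rewrite -kD ler_pM2r.
    have -> : e%:R * (s * (3 * ka)) ^+ 2 = 9 * s ^+ 2 * (e%:R * ka * ka) by ring.
    have -> : 9 / 32 * s ^+ 2 = 9 * s ^+ 2 * 32^-1 by ring.
    apply: ler_wpM2l; first by rewrite mulr_ge0 ?sqr_ge0.
    apply: (@le_trans _ _ (4^-1 * ka)); last by lra.
    by rewrite ler_wpM2r// ltW.
  have : s ^+ 2 <= 9 / 32 * s ^+ 2 + v 0 ord_max ^+ 2.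
    by apply: le_trans sle _; rewrite lerD2r.
  move: ve0; set y := v 0 ord_max => ve0 sy; nra.
have rle3 : r <= 3.
  by move: rr1 delta8; rewrite ler_norml => /andP[_ rr]; nra.
have rge2 : 2^-1 <= r.
  by move: rr1 delta8; rewrite ler_norml => /andP[rr _]; nra.
have thd : theta <= delta / 512 by move: delta8 th512; set th := theta; nra.
split=> //.
- move=> i; apply/andP; split; last first.
    by apply: le_trans rle3; apply: le_trans (coord_le_enorm _ i); exact: ler_norm.
  have [->|[j ->]] := ord_max_or_widen i.
    have /andP[_] := zP ord_max; rewrite !mxE; move: thd delta8; set th := theta; lra.
  have /andP[_] := zP (widen_ord (leqnSn e) j).
  rewrite !mxE; move: thd; set th := theta => thd zi.
  have /andP[q1 q2] := qP j; have := vq j; rewrite ler_norml => /andP[v1 _].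
  have : ka <= s * q j by nra.
  move: v1 zi; set w := v 0 _; set y := s * q j; lra.
- have rs : -(3 * (delta ^+ 2 / 256)) <= (r - s) * (r + s - 2) <= 3 * (delta ^+ 2 / 256).
    move: rr1 delta8; rewrite ler_norml => /andP[rr0 rr2] d8.
    have d2s : 0 <= delta ^+ 2 / 256.
      by apply: divr_ge0; [exact: sqr_ge0|exact: ler0n].
    by apply/andP; split; nra.
  have -> : r ^+ 2 + h - t - 2 * r = s ^+ 2 - 2 * s + h + (r - s) * (r + s - 2) - t by ring.
  rewrite ler_norml; case/andP: rh rs => rh0 rh1 /andP[rs0 rs1]; case/andP: tP => t0 t1.
  move: rs0 rs1 t1 th512; set x := _ * (r + s - 2); set y := s ^+ 2 - _ + h in rh0 rh1 *.
  by set th := theta; set z2 := delta ^+ 2 in rh1 *; move=> rs0 rs1 t1 th512; apply/andP; split; lra.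
move=> i; have r0 : 0 < r by lra.
have -> : (v - z) 0 (widen_ord (leqnSn e) i) / r - q i =
    ((v - z) 0 (widen_ord (leqnSn e) i) - r * q i) / r by field; rewrite gt_eqF.
rewrite normrM normfV (gtr0_norm r0) ler_pdivrMr//.
have /andP[q1 q2] := qP i; have := vq i; have := zP (widen_ord (leqnSn e) i).
rewrite !mxE; set vi := v 0 _; set zi := z 0 _; move: thd; set th := theta => thd /andP[z0 z1].
have d2d : delta ^+ 2 / 256 <= delta / 2048 by move: delta8; nra.
have : `|(r - s) * q i| <= delta / 2048.
  rewrite normrM; have q0 : 0 <= q i <= 1 by lra.
  case/andP: q0 => q00 q01; rewrite (ger0_norm q00); have := normr_ge0 (r - s); nra.
rewrite !ler_norml; set y := (r - s) * q i.
have -> : vi - zi - r * q i = vi - s * q i - y - zi by rewrite /y; ring.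
set x := vi - s * q i.
move=> /andP[y0 y1] /andP[x0 x1].
have : delta / 8 <= delta / 4 * r by nra.
by set w := _ * r => dw; apply/andP; split; move: z1; rewrite -/th => z1; lra.
Qed.

End perturbation.

Section configuration.
Context {R : realType} {e : nat}.
Local Notation d := e.+1.
Local Notation D := (d%:R : R).
Local Notation point := ('rV[R]_d * R)%type.
Variables (rho delta : R).

Definition tolerance : R := delta ^+ 2 / (256 * D).

(** The cell will be that of the point in [core_box]. *)
Definition core_box : set point :=
  [set x : point | (forall i, 0 <= x.1 0 i <= tolerance) /\ tolerance / 2 <= x.2 <= tolerance].

Definition coarse_box (k : 'I_d) : set point :=
  [set x : point | (forall i, `|x.1 0 i + rho * (i == k)%:R| <= rho * ((48 * D ^+ 3)^-1 / 2)) /\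
    rho ^+ 2 <= x.2 <= 2 * rho ^+ 2].

(** The sites in a direction close to the one with leading coordinates [q] whose
    bisector with the origin is nearly tangent to the sphere of radius [rho]: the
    last condition is [2 rho |v| <= |v|^2 + h] up to an error. *)
Definition fine_shell (q : 'I_e -> R) : set point :=
  [set x : point | [/\ rho ^+ 2 / 2 <= x.2 <= 3 / 4 * rho ^+ 2,
    forall i, `|x.1 0 (widen_ord (leqnSn e) i) - enorm x.1 * q i| <= rho * (delta / 16),
    0 <= x.1 0 ord_max, rho <= enorm x.1 &
    0 <= enorm x.1 ^+ 2 - 2 * rho * enorm x.1 + x.2 <= rho ^+ 2 * (delta ^+ 2 / 64)]].

(** A point of the cell has coordinates at most [M rho], where [M = 400 d ^ 2]. Its
    power with respect to the core is at most a constant times [rho ^ 2], and its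
    power with respect to a site beyond this radius or height exceeds that bound. *)
Definition far_radius : R := (400 * D ^+ 2 * (D + 1) + 2) * rho.
Definition far_height : R := (D * (400 * D ^+ 2) ^+ 2 + 2) * rho ^+ 2.

Hypothesis d2 : (1 < d)%N.
Hypothesis rho1 : 1 <= rho.
Hypothesis deltaP : 0 < delta <= (4 * D)^-1.

Let rho0 : 0 < rho. Proof. exact: lt_le_trans rho1. Qed.
Let D2 : 2 <= D. Proof. by rewrite ler_nat. Qed.
Let delta8 : delta <= 8^-1.
Proof.
case/andP: deltaP => _ /le_trans; apply.
by rewrite lef_pV2 ?posrE ?mulr_gt0 ?ltr0n//; move: D2; set DD := D; lra.
Qed.
Let delta01 : 0 < delta <= 1.
Proof. by case/andP: deltaP => -> _ /=; move: delta8; lra. Qed.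

Lemma tolerance_gt0 : 0 < tolerance.
Proof.
case/andP: deltaP => d0 _; apply: divr_gt0; first by rewrite exprn_gt0.
by apply: mulr_gt0; rewrite ltr0n.
Qed.

Lemma tolerance_le : tolerance <= 512^-1.
Proof.
rewrite /tolerance ler_pdivrMr; last by apply: mulr_gt0; rewrite ltr0n.
move: D2 delta01; set DD := D => DD2 /andP[d0 d1].
have : delta ^+ 2 <= 1 by rewrite exprn_ile1// ltW.
lra.
Qed.

Let tol_le1 : tolerance <= 1. Proof. by have := tolerance_le; lra. Qed.

Section cell.
Variables (m : nat) (q : 'I_m -> 'I_e -> R).
Hypothesis m0 : (0 < m)%N.
Hypothesis qP : forall p i, (4 * D)^-1 <= q p i <= (2 * D)^-1.
Hypothesis qsep : forall p p', p != p' -> exists i, delta <= `|q p i - q p' i|.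

Definition site_box (j : 'I_(d + m)) : set point :=
  match fintype.split j with inl k => coarse_box k | inr p => fine_shell (q p) end.

Lemma site_boxL k : site_box (lshift m k) = coarse_box k.
Proof. by rewrite /site_box (unsplitK (inl k)). Qed.

Lemma site_boxR p : site_box (rshift d p) = fine_shell (q p).
Proof. by rewrite /site_box (unsplitK (inr p)). Qed.

(** After expansion of the squares, the cell seen from its site [x0] is a polyhedron
    with normals [2 (y - x0)]. It is bounded by the sites [y j], and the remaining
    sites of [X] are too far away to cut it further. *)
Lemma laguerre_cell_pattern (X : set point) (x0 : point) (y : 'I_(d + m) -> point) :
  core_box x0 -> (forall j, site_box j (y j)) -> (forall j, X (y j)) ->
  (forall x, X x -> region far_radius far_height x -> x = x0 \/ exists j, x = y j) ->
  exists K : set 'rV[R]_d, [/\ polytope_with_facets (d + m) K, convex_body K &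
    laguerre_cell X x0 = [set w + x0.1 | w in K]].
Proof.
move=> [x0P1 x0P2] yP Xy Xreg.
pose a j : 'rV[R]_d := 2 *: ((y j).1 - x0.1).
pose b j : R := enorm ((y j).1 - x0.1) ^+ 2 + (y j).2 - x0.2.
pose z : 'rV[R]_d := rho^-1 *: x0.1.
pose t : R := (rho ^+ 2)^-1 * x0.2.
have ir0 : 0 < rho^-1 by rewrite invr_gt0.
have ir1 : rho^-1 <= 1 by rewrite invf_le1.
have rho2 : 0 < rho ^+ 2 by rewrite exprn_gt0.
have rho21 : 1 <= rho ^+ 2 by rewrite exprn_ege1.
have ir20 : 0 < (rho ^+ 2)^-1 by rewrite invr_gt0.
have ir21 : (rho ^+ 2)^-1 <= 1 by rewrite invf_le1.
have zP i : 0 <= z 0 i <= tolerance.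
  by rewrite mxE; have /andP[x1 x2] := x0P1 i; move: tolerance x2 => to x2; nra.
have tP : 0 <= t <= tolerance.
  by rewrite /t; case/andP: x0P2; move: tolerance tolerance_gt0 => to to0 x1 x2; nra.
pose v j : 'rV[R]_d := rho^-1 *: (y j).1.
pose h j : R := (rho ^+ 2)^-1 * (y j).2.
have yv j : (y j).1 - x0.1 = rho *: (v j - z).
  by rewrite scalerBr !scalerA divff ?gt_eqF// !scale1r.
have aE j : a j = (2 * rho) *: (v j - z) by rewrite /a yv scalerA.
have bE j : b j = rho ^+ 2 * (enorm (v j - z) ^+ 2 + h j - t).
  by rewrite /b yv enormZ ?ltW// /h /t; field; rewrite gt_eqF.
have cP k : (forall i, `|(v (lshift m k) - z) 0 i + (i == k)%:R| <= (48 * D ^+ 3)^-1) /\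
    2^-1 <= enorm (v (lshift m k) - z) ^+ 2 + h (lshift m k) - t <= 5.
  have := yP (lshift m k); rewrite site_boxL => -[y1 y2].
  apply: (coarse_perturb d2 deltaP zP tP) => [i|].
    have := y1 i; rewrite /v mxE => yi.
    rewrite -(ler_pM2l rho0); apply: le_trans yi.
    by rewrite -{1}(gtr0_norm rho0) -normrM mulrDr mulrA divff ?mul1r// gt_eqF.
  rewrite /h; case/andP: y2 => y21 y22.
  by rewrite ler_pdivlMl// mulr1 y21/= ler_pdivrMl// mulrC.
have fP p : [/\ forall i, (8 * D)^-1 <= (v (rshift d p) - z) 0 i <= 3,
    2^-1 <= enorm (v (rshift d p) - z),
    `|enorm (v (rshift d p) - z) ^+ 2 + h (rshift d p) - t - 2 * enorm (v (rshift d p) - z)|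
      <= delta ^+ 2 / 32 &
    forall i, `|(v (rshift d p) - z) 0 (widen_ord (leqnSn e) i) / enorm (v (rshift d p) - z)
       - q p i| <= delta / 4].
  have := yP (rshift d p); rewrite site_boxR; set j := rshift d p => -[y1 y2 y3 y4 y5].
  have enE : enorm (y j).1 = rho * enorm (v j).
    by rewrite -enormZ ?ltW// scalerA divff ?scale1r// gt_eqF.
  have hE : (y j).2 = rho ^+ 2 * h j by rewrite /h mulrA divff ?mul1r// gt_eqF.
  have vE i : (y j).1 0 i = rho * v j 0 i by rewrite mxE mulrA divff ?mul1r// gt_eqF.
  apply: (fine_perturb d2 deltaP zP tP) => // [|i|||].
  - by move: y1; rewrite hE ler_pM2l// [3 / 4 * _]mulrC ler_pM2l.
  - have := y2 i; rewrite vE enE -mulrA -mulrBr normrM (gtr0_norm rho0).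
    by rewrite ler_pM2l.
  - by move: y3; rewrite vE pmulr_rge0.
  - by move: y4; rewrite enE -[leLHS]mulr1 ler_pM2l.
  - move: y5; rewrite hE enE.
    have -> : (rho * enorm (v j)) ^+ 2 - 2 * rho * (rho * enorm (v j)) + rho ^+ 2 * h j =
       rho ^+ 2 * (enorm (v j) ^+ 2 - 2 * enorm (v j) + h j) by ring.
    by rewrite pmulr_rge0// ler_pM2l.
have fsep p p' : p != p' -> exists i, delta / 2 <=
    `|(v (rshift d p) - z) 0 i / enorm (v (rshift d p) - z) -
      (v (rshift d p') - z) 0 i / enorm (v (rshift d p') - z)|.
  move=> /qsep[i qi]; exists (widen_ord (leqnSn e) i).
  have [_ _ _ /(_ i) f] := fP p; have [_ _ _ /(_ i) f'] := fP p'.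
  move: f f'; set A := _ / _; set A' := _ / enorm (v (rshift d p') - z) => f f'.
  have -> : A - A' = (q p i - q p' i) + ((A - q p i) - (A' - q p' i)) by ring.
  have := lerB_normD (q p i - q p' i) ((A - q p i) - (A' - q p' i)).
  have := ler_normB (A - q p i) (A' - q p' i); lra.
have [facets body bounded] := @cell_polytope R e m rho delta
  (fun k => v (lshift m k) - z) (fun k => enorm (v (lshift m k) - z) ^+ 2 + h (lshift m k) - t)
  (fun p => v (rshift d p) - z) (fun p => enorm (v (rshift d p) - z) ^+ 2 + h (rshift d p) - t)
  a b rho0 m0 delta01 (fun k => (cP k).1) (fun k => (cP k).2)
  (fun p => let: And4 f1 _ _ _ := fP p in f1) (fun p => let: And4 _ f2 _ _ := fP p in f2)
  (fun p => let: And4 _ _ f3 _ := fP p in f3) fsep (fun k => conj (aE _) (bE _))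
  (fun p => conj (aE _) (bE _)).
exists (polyhedron a b); split => //.
(* The comparison of two powers is a linear inequality. *)
have key (w : 'rV[R]_d) (x : point) : (enorm (w - x0.1) ^+ 2 + x0.2 <= enorm (w - x.1) ^+ 2 + x.2) <->
    (dotp (2 *: (x.1 - x0.1)) (w - x0.1) <= enorm (x.1 - x0.1) ^+ 2 + x.2 - x0.2).
  have -> : w - x.1 = (w - x0.1) - (x.1 - x0.1) by rewrite opprB addrA subrK.
  move: (w - x0.1) (x.1 - x0.1) => u s.
  have -> : enorm (u - s) ^+ 2 = enorm u ^+ 2 - dotp (2 *: s) u + enorm s ^+ 2.
    rewrite !sqr_enorm dotpBr !dotpBl dotpZl (dotpC u s); ring.
  by split; lra.
apply/seteqP; split=> [w Cw|_ [w Pw <-] x Xx].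
  exists (w - x0.1); last by rewrite subrK.
  by move=> j; apply/key; exact: Cw.
have [/(Xreg x Xx)[->//|[j ->]]|nreg] := pselect (region far_radius far_height x).
  by apply/key; rewrite addrK; exact: Pw.
have bw := bounded w Pw.
have x2 : 0 <= x.2 by rewrite leNgt; apply/negP => x2; apply: nreg; left.
rewrite addrK.
pose M : R := 400 * D ^+ 2.
have M0 : 0 <= M by apply: mulr_ge0; [exact: ler0n|exact: sqr_ge0].
have Mr0 : 0 <= M * rho by rewrite mulr_ge0// ltW.
have w2 : enorm w ^+ 2 + x0.2 <= (D * M ^+ 2 + 1) * rho ^+ 2.
  have : enorm w ^+ 2 <= D * M ^+ 2 * rho ^+ 2.
    rewrite sqr_enorm; apply: le_trans (ler_norm _) _.
    by apply: le_trans (dotp_le_sup Mr0 bw bw) _; rewrite -expr2 exprMn mulrA.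
  have : x0.2 <= rho ^+ 2.
    by case/andP: x0P2 => _ x2t; exact: le_trans x2t (le_trans tol_le1 rho21).
  set A := D * M ^+ 2; lra.
have [xh|xh] := ltP far_height x.2.
  apply: (le_trans w2); apply: le_trans (_ : x.2 <= _); last by rewrite lerDr sqr_ge0.
  by move: (ltW xh); rewrite /far_height -/M; move: rho2; set A := D * M ^+ 2; lra.
have [i xi] : exists i, far_radius < `|x.1 0 i|.
  apply: contrapT => /forallNP xr; apply: nreg; right; split => // i.
  by rewrite leNgt; apply/negP; exact: xr.
have : (D * M + 1) * rho <= enorm (w + x0.1 - x.1).
  apply: le_trans (coord_le_enorm _ i); rewrite !mxE.
  have := lerB_normD (x.1 0 i) (- (w 0 i + x0.1 0 i)).
  rewrite distrC normrN.
  have : `|w 0 i + x0.1 0 i| <= M * rho + rho.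
    apply: le_trans (ler_normD _ _) _; apply: lerD; first exact: bw.
    have /andP[z0 z1] := x0P1 i; rewrite ger0_norm//.
    exact: le_trans z1 (le_trans tol_le1 rho1).
  have -> : (D * M + 1) * rho = far_radius - (M * rho + rho) by rewrite /far_radius -/M; ring.
  move: xi; move: `|x.1 0 i| `|w 0 i + x0.1 0 i| (M * rho + rho) far_radius => s1 s2 s3 s4 s5 s6.
  by apply: le_trans; lra.
have DM0 : 0 <= D * M + 1 by rewrite addr_ge0// mulr_ge0.
move=> eb; apply: (le_trans w2); apply: (@le_trans _ _ (((D * M + 1) * rho) ^+ 2)).
  rewrite [leRHS]exprMn; apply: ler_wpM2r; first exact: sqr_ge0.
  by move: D2 M0; set DD := D => DD2 MM0; nra.
rewrite -[leLHS]addr0; apply: lerD => //.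
by rewrite ler_pXn2r ?nnegrE ?enorm_ge0// mulr_ge0// ltW.
Qed.
End cell.
End configuration.

(** * Topology and layout of the boxes *)

Section box_topology.
Context {R : realType} {e : nat}.
Local Notation d := e.+1.
Local Notation D := (d%:R : R).
Local Notation point := ('rV[R]_d * R)%type.
Variables (rho delta : R).

Lemma continuous_enorm : continuous (@enorm R d).
Proof.
have cd : continuous (fun v : 'rV[R]_d => dotp v v).
  rewrite /dotp; apply: continuous_sumr => i v.
  have ci := @coord_continuous R 1 d 0 i v.
  exact: (@cvgM _ _ (nbhs v) (nbhs_filter v) _ _ _ _ ci ci).
by move=> v; exact: (continuous_comp (cd v) (@sqrt_continuous R _)).
Qed.

Lemma continuous_enorm_fst : continuous (fun x : point => enorm x.1).
Proof.
move=> x; apply: (@continuous_comp _ _ _ fst (@enorm R d)); first exact: cvg_fst.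
exact: continuous_enorm.
Qed.

Lemma continuous_snd_point : continuous (snd : point -> R).
Proof. by move=> x; exact: cvg_snd. Qed.

Lemma closed_le_fun {T : topologicalType} (f g : T -> R) :
  continuous f -> continuous g -> closed [set x | f x <= g x].
Proof.
move=> cf cg.
have -> : [set x | f x <= g x] = (fun x => f x - g x) @^-1` [set t | t <= 0].
  by apply/seteqP; split=> x /=; rewrite subr_le0.
apply: preimage_closed => [x _|]; last exact: closed_le.
by apply: cvgB; [exact: cf|exact: cg].
Qed.

Lemma closed_forall {T : topologicalType} {J : Type} (S : J -> set T) :
  (forall i, closed (S i)) -> closed [set x | forall i, S i x].
Proof.
move=> cS; have -> : [set x | forall i, S i x] = \bigcap_(i in setT) S i.
  by apply/seteqP; split=> x Sx i; [move=> _; exact: Sx|exact: (Sx i I)].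
by apply: closed_bigI => i _.
Qed.

Lemma closed_between {T : topologicalType} (f : T -> R) (a b : R) :
  continuous f -> closed [set x | a <= f x <= b].
Proof.
move=> cf; have -> : [set x | a <= f x <= b] = [set x | a <= f x] `&` [set x | f x <= b].
  by apply/seteqP; split=> x /=; [move=> /andP[]|move=> [-> ->]].
by apply: closedI; apply: closed_le_fun => // x; exact: cvg_cst.
Qed.

Lemma closed_norm_le {T : topologicalType} (f : T -> R) (b : R) :
  continuous f -> closed [set x | `|f x| <= b].
Proof.
move=> cf; have -> : [set x | `|f x| <= b] = [set x | - b <= f x <= b].
  by apply/seteqP; split=> x /=; rewrite ler_norml.
exact: closed_between.
Qed.

Lemma borel_core_box : borel (core_box delta : set point).
Proof.
apply: borel_closed; apply: closedI.
  by apply: closed_forall => i; apply: closed_between; exact: continuous_coord.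
by apply: closed_between; exact: continuous_snd_point.
Qed.

Lemma borel_coarse_box k : borel (coarse_box rho k : set point).
Proof.
apply: borel_closed; apply: closedI.
  apply: closed_forall => i; apply: closed_norm_le => x.
  by apply: (@cvgD _ _ _ _ (nbhs_filter x)); [exact: continuous_coord|exact: (@cvg_cst _ _ _ _ (nbhs_filter x))].
by apply: closed_between; exact: continuous_snd_point.
Qed.

Lemma borel_fine_shell q : borel (fine_shell rho delta q : set point).
Proof.
have -> : (fine_shell rho delta q : set point) =
  [set x : point | rho ^+ 2 / 2 <= x.2 <= 3 / 4 * rho ^+ 2] `&`
  ([set x : point | forall i, `|x.1 0 (widen_ord (leqnSn e) i) - enorm x.1 * q i| <= rho * (delta / 16)] `&`
  ([set x : point | 0 <= x.1 0 ord_max] `&` ([set x : point | rho <= enorm x.1] `&`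
   [set x : point | 0 <= enorm x.1 ^+ 2 - 2 * rho * enorm x.1 + x.2 <= rho ^+ 2 * (delta ^+ 2 / 64)]))).
  by apply/seteqP; split=> x /= => [[]|[? [? [? []]]]].
have cn (c : R) : continuous (fun _ : point => c).
  by move=> x; exact: (@cvg_cst _ _ _ _ (nbhs_filter x)).
apply: borel_closed; apply: closedI.
  by apply: closed_between; exact: continuous_snd_point.
apply: closedI.
  apply: closed_forall => i; apply: closed_norm_le => x.
  apply: (@cvgB _ _ _ _ (nbhs_filter x)); first exact: continuous_coord.
  by apply: (@cvgM _ _ (nbhs x) (nbhs_filter x)); [exact: continuous_enorm_fst|exact: cn].
apply: closedI; first by apply: closed_le_fun; [exact: cn|exact: continuous_coord].
apply: closedI; first by apply: closed_le_fun; [exact: cn|exact: continuous_enorm_fst].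
apply: closed_between => x.
apply: (@cvgD _ _ _ _ (nbhs_filter x)); last exact: continuous_snd_point.
apply: (@cvgB _ _ _ _ (nbhs_filter x)).
  apply: (@cvgM _ _ (nbhs x) (nbhs_filter x)); exact: continuous_enorm_fst.
by apply: (@cvgM _ _ (nbhs x) (nbhs_filter x)); [exact: cn|exact: continuous_enorm_fst].
Qed.

End box_topology.

Section box_layout.
Context {R : realType} {e m : nat}.
Local Notation d := e.+1.
Local Notation D := (d%:R : R).
Local Notation point := ('rV[R]_d * R)%type.
Variables (rho delta : R) (q : 'I_m -> 'I_e -> R).
Hypothesis d2 : (1 < d)%N.
Hypothesis rho1 : 1 <= rho.
Hypothesis deltaP : 0 < delta <= (4 * D)^-1.
Hypothesis qP : forall p i, (4 * D)^-1 <= q p i <= (2 * D)^-1.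
Hypothesis qsep : forall p p', p != p' -> exists i, delta <= `|q p i - q p' i|.

Let rho0 : 0 < rho. Proof. exact: lt_le_trans rho1. Qed.
Let D2 : 2 <= D. Proof. by rewrite ler_nat. Qed.

Let eps_le : (48 * D ^+ 3)^-1 / 2 <= 4^-1 :> R.
Proof.
have D3 : 1 <= D ^+ 3 by apply: exprn_ege1; apply: le_trans D2; rewrite ler1n.
have : (48 * D ^+ 3)^-1 <= 48^-1 :> R.
  by rewrite lef_pV2 ?posrE ?mulr_gt0 ?exprn_gt0 ?ltr0n//; move: D3; set y := D ^+ 3; lra.
by set y := (48 * D ^+ 3)^-1; lra.
Qed.

Lemma fine_shell_coord p x i : fine_shell rho delta (q p) x -> 0 <= x.1 0 i.
Proof.
move=> [_ xq xe xr _]; have [->//|[j ->]] := ord_max_or_widen i.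
have := xq j; rewrite ler_norml => /andP[+ _].
have /andP[q1 _] := qP p j; case/andP: deltaP => d0 dq.
have : rho * delta <= enorm x.1 * q p j.
  by apply: ler_pM => //; [exact: ltW|exact: ltW|exact: le_trans dq q1].
have : 0 < rho * delta by rewrite mulr_gt0.
rewrite mulrA; set y := rho * delta; set z := enorm _ * _; lra.
Qed.

(** This separates the coarse boxes from each other and from the other boxes. *)
Lemma coarse_box_coord k (x : point) : coarse_box rho k x -> 2 * x.1 0 k < - rho /\
  forall i, i != k -> - rho < 2 * x.1 0 i.
Proof.
move=> [xk _]; set ep := (48 * D ^+ 3)^-1 / 2 in xk.
have el : rho * ep <= rho * 4^-1 by rewrite ler_pM2l//; exact: eps_le.
split=> [|i ik].
  have := xk k; rewrite eqxx mulr1 ler_norml => /andP[_].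
  by move: rho0 el; set y := rho * ep; lra.
have := xk i; rewrite (negbTE ik) mulr0 addr0 ler_norml => /andP[+ _].
by move: rho0 el; set y := rho * ep; lra.
Qed.

Definition pattern_box (j : 'I_(d + m).+1) : set point :=
  if unlift ord0 j is Some i then site_box rho delta q i else core_box delta.

Lemma site_box_cases (i : 'I_(d + m)) :
  (exists2 k, i = lshift m k & site_box rho delta q i = (coarse_box rho k : set point)) \/
  (exists2 p, i = rshift d p & site_box rho delta q i = (fine_shell rho delta (q p) : set point)).
Proof.
case: (splitP i) => k ik; [left|right]; exists k.
- exact: val_inj.
- by rewrite -(site_boxL rho delta q); congr site_box; exact: val_inj.
- exact: val_inj.
- by rewrite -(site_boxR rho delta q); congr site_box; exact: val_inj.
Qed.

Lemma site_box_disjoint i j x : i != j ->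
  site_box rho delta q i x -> site_box rho delta q j x -> False.
Proof.
have coarse_fine k p (y : point) : coarse_box rho k y -> fine_shell rho delta (q p) y -> False.
  move=> /coarse_box_coord[yk _] yf; have := fine_shell_coord k yf.
  by move: rho0; lra.
case: (site_box_cases i) => -[k -> ->]; case: (site_box_cases j) => -[l -> ->].
- rewrite (inj_eq (@lshift_inj _ _)) => kl /coarse_box_coord[xk _].
  by move=> /coarse_box_coord[_ /(_ _ kl)]; lra.
- by move=> _; exact: coarse_fine.
- by move=> _ xk xl; exact: coarse_fine xl xk.
rewrite (inj_eq (@rshift_inj _ _)) => /qsep[t kl] [_ xk _ xr _] [_ xl _ _ _].
have := xk t; have := xl t; case/andP: deltaP => d0 _.
set c := x.1 0 _ => cl ck.
have : enorm x.1 * `|q k t - q l t| <= rho * (delta / 8).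
  have x0 := enorm_ge0 x.1.
  rewrite -{1}(ger0_norm x0) -normrM mulrBr.
  have -> : enorm x.1 * q k t - enorm x.1 * q l t =
    (c - enorm x.1 * q l t) - (c - enorm x.1 * q k t) by ring.
  apply: le_trans (ler_normB _ _) _.
  have -> : rho * (delta / 8) = rho * (delta / 16) + rho * (delta / 16) by field.
  exact: lerD.
apply/negP; rewrite -ltNge; apply: lt_le_trans (_ : rho * delta <= _).
  by rewrite ltr_pM2l//; lra.
by apply: ler_pM => //; exact: ltW.
Qed.

Lemma core_site_disjoint i x : core_box delta x -> site_box rho delta q i x -> False.
Proof.
move=> [x1 /andP[_ x2]]; case: (site_box_cases i) => -[k _ ->].
  by move=> /coarse_box_coord[xk _]; have /andP[+ _] := x1 k; move: rho0; lra.
move=> [/andP[+ _] _ _ _ _]; have := tolerance_le d2 deltaP.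
have : 1 <= rho ^+ 2 by exact: exprn_ege1.
by move: x2; set t := tolerance (e := e) delta; lra.
Qed.

Lemma pattern_box_disjoint : trivIset setT pattern_box.
Proof.
move=> i j _ _ [x [+ +]]; rewrite /pattern_box.
case: unliftP => [i' ->|->]; case: unliftP => [j' ->|->] //.
- have [->//|ij] := eqVneq i' j'.
  by move=> xi xj; have := site_box_disjoint ij xi xj.
- by move=> xi x0; have := core_site_disjoint x0 xi.
- by move=> x0 xi; have := core_site_disjoint x0 xi.
Qed.

Lemma pattern_box_region j : pattern_box j `<=` region (far_radius (e := e) rho) (far_height (e := e) rho).
Proof.
have rad : 2 * rho <= far_radius (e := e) rho :> R.
  rewrite /far_radius ler_pM2r// lerDr; apply: mulr_ge0; last by rewrite addr_ge0.
  by apply: mulr_ge0; [exact: ler0n|exact: sqr_ge0].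
have hei : 2 * rho ^+ 2 <= far_height (e := e) rho :> R.
  rewrite /far_height ler_pM2r ?exprn_gt0// lerDr; apply: mulr_ge0; first exact: ler0n.
  exact: sqr_ge0.
have rho21 : 1 <= rho ^+ 2 by exact: exprn_ege1.
move=> x; rewrite /pattern_box.
suff H : (forall i, `|x.1 0 i| <= 2 * rho) -> x.2 <= 2 * rho ^+ 2 ->
    region (far_radius (e := e) rho) (far_height (e := e) rho) x.
  case: unliftP => [i _|_].
    case: (site_box_cases i) => -[k _ ->].
      move=> [x1 /andP[_ x2]]; apply: H => // l.
      have el : rho * ((48 * D ^+ 3)^-1 / 2) <= rho * 4^-1 by rewrite ler_pM2l//; exact: eps_le.
      have := le_trans (x1 l) el; rewrite !ler_norml.
      by case: eqP => _; rewrite ?mulr1 ?mulr0 => /andP[y1 y2]; apply/andP; split; move: rho0; lra.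
    move=> [/andP[x1 x2] _ _ xr /andP[_ x3]]; apply: H => [l|]; last by lra.
    apply: le_trans (coord_le_enorm _ l) _.
    have d1 : delta ^+ 2 <= 1.
      case/andP: deltaP => d0 dl; apply: exprn_ile1; first exact: ltW.
      apply: le_trans dl _; rewrite invf_le1 ?mulr_gt0 ?ltr0n//.
      by move: D2; set DD := D; lra.
    have : rho ^+ 2 * (delta ^+ 2 / 64) <= rho ^+ 2 / 64.
      by rewrite ler_pM2l ?exprn_gt0//; lra.
    by move: x3 xr x1; set E := enorm x.1; set z := rho ^+ 2 * (_ / _); move: rho0; nra.
  move=> [x1 /andP[_ x2]]; have t1 := tolerance_le d2 deltaP.
  have t2 : tolerance (e := e) delta <= 2 by move: t1; set t := tolerance (e := e) delta; lra.
  apply: H => [l|].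
    have /andP[y0 y1] := x1 l; rewrite ger0_norm//; apply: le_trans y1 _.
    by apply: le_trans t2 _; move: rho1; lra.
  by apply: le_trans x2 _; apply: le_trans t2 _; move: rho21; lra.
move=> x1 x2; right; split=> [i|]; first exact: le_trans rad.
exact: le_trans hei.
Qed.

Lemma borel_pattern_box j : borel (pattern_box j).
Proof.
rewrite /pattern_box; case: unliftP => [i _|_]; last exact: borel_core_box.
case: (site_box_cases i) => -[k _ ->]; first exact: borel_coarse_box.
exact: borel_fine_shell.
Qed.

End box_layout.

(** * Intensities of the boxes *)

Section dyadic_powers.
Context {R : realType}.

(** The two terms serve positive and negative exponents. *)
Definition dyadic_factor (beta : R) : R := Num.min (2^-1 `^ beta) (2 `^ beta).

Lemma dyadic_factor_gt0 beta : 0 < dyadic_factor beta.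
Proof. by rewrite lt_min !powR_gt0// invr_gt0. Qed.

Lemma powR_dyadic (beta c h : R) : 0 < c -> c / 2 <= h <= 2 * c ->
  c `^ beta * dyadic_factor beta <= h `^ beta.
Proof.
move=> c0 /andP[ch hc]; have h0 : 0 < h by apply: lt_le_trans ch; rewrite divr_gt0.
have -> : h = c * (h / c) by rewrite mulrC divfK// gt_eqF.
have t1 : 2^-1 <= h / c by rewrite ler_pdivlMr// mulrC.
have t2 : h / c <= 2 by rewrite ler_pdivrMr.
have t0 : 0 < h / c by rewrite divr_gt0.
rewrite (powRM beta (ltW c0) (ltW t0)); apply: ler_wpM2l; first exact: powR_ge0.
have t0' := ltW t0; have h20 : 0 <= 2^-1 :> R by rewrite invr_ge0.
rewrite /dyadic_factor ge_min; have [b0|b0] := leP 0 beta.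
  by rewrite ge0_ler_powR.
apply/orP; right; rewrite -[beta]opprK !(powRN _ (- beta)) lef_pV2 ?posrE ?powR_gt0//.
by rewrite ge0_ler_powR ?oppr_ge0//; exact: ltW.
Qed.

End dyadic_powers.

Section box_measures.
Context {R : realType} {e : nat}.
Local Notation d := e.+1.
Local Notation D := (d%:R : R).
Local Notation point := ('rV[R]_d * R)%type.
Variables (rho delta gamma beta : R).
Hypothesis d2 : (1 < d)%N.
Hypothesis rho1 : 1 <= rho.
Hypothesis deltaP : 0 < delta <= (4 * D)^-1.
Local Notation c := (gamma * beta_const d.+1 beta).
Hypothesis c0 : 0 <= c.

Let rho0 : 0 < rho. Proof. exact: lt_le_trans rho1. Qed.
Let rho0' : 0 <= rho. Proof. exact: ltW. Qed.
Let rho20 : 0 < rho ^+ 2. Proof. by rewrite exprn_gt0. Qed.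
Let D2 : 2 <= D. Proof. by rewrite ler_nat. Qed.
Let Dn0 : D != 0. Proof. by rewrite pnatr_eq0. Qed.
Let delta0 : 0 < delta. Proof. by case/andP: deltaP. Qed.
Let delta0' : 0 <= delta. Proof. exact: ltW. Qed.
Let delta8 : delta <= 8^-1.
Proof.
case/andP: deltaP => _ /le_trans; apply.
by rewrite lef_pV2 ?posrE ?mulr_gt0 ?ltr0n//; move: D2; set DD := D; lra.
Qed.

(** At a fixed height [h] the shell lies over a small cube of first coordinates,
    the last coordinate being confined to an interval next to the sphere of
    radius [rho + sqrt (rho ^ 2 - h)]. *)
Lemma fine_shell_slice (q : 'I_e -> R) (h : R) :
  (forall i, (4 * D)^-1 <= q i <= (2 * D)^-1) ->
  rho ^+ 2 / 2 <= h <= 3 / 4 * rho ^+ 2 ->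
  (((rho * (delta / 32)) ^+ e * (rho * (delta ^+ 2 / 256)))%:E <=
   lebesgue_rV [set v : 'rV[R]_d | fine_shell rho delta q (v, h)])%E.
Proof.
move=> qP hP; pose s := Num.sqrt (rho ^+ 2 - h).
have h1 : 0 <= rho ^+ 2 - h by case/andP: hP => h0 h1; lra.
have s2 : s ^+ 2 = rho ^+ 2 - h by rewrite sqr_sqrtr.
have s0 : 0 <= s by exact: sqrtr_ge0.
have srho : s <= rho.
  rewrite -(ler_pXn2r (n := 2)) ?nnegrE// s2; case/andP: hP => h0 _.
  by move: rho20; lra.
pose r := rho + s.
have r_rho : rho <= r by rewrite lerDl.
have r0 : 0 < r by exact: lt_le_trans r_rho.
have r0' := ltW r0.
have dd : 0 < rho * (delta / 32) by rewrite mulr_gt0 ?divr_gt0.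
pose W := rho * (delta ^+ 2 / 256).
have W0 : 0 < W.
  by apply: mulr_gt0 => //; apply: divr_gt0; [exact: exprn_gt0|exact: ltr0n].
have W0' := ltW W0.
have inv42 : (2 * D)^-1 = 2 * (4 * D)^-1.
  by move: Dn0; set DD := D => DD0; field.
have kD : D * (4 * D)^-1 = 4^-1.
  by move: Dn0; set DD := D => DD0; field.
have ka0 : 0 < (4 * D)^-1 by rewrite invr_gt0 mulr_gt0// ltr0n.
move: qP deltaP; rewrite inv42; set ka := (4 * D)^-1 in kD ka0 * => qP /andP[_ dka].
have ka8 : ka <= 8^-1 by move: kD D2; set DD := D; nra.
have -> : (rho * (delta / 32)) ^+ e = \prod_(i < e) ((r * q i + rho * (delta / 32)) - r * q i).
  rewrite (eq_bigr (fun=> rho * (delta / 32))); last by move=> i _; rewrite addrAC subrr add0r.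
  by rewrite prodr_const card_ord.
apply: lebesgue_rV_ge_graph => [|i|x xP]; [exact: ltW|by rewrite lerDl ltW|].
have xle i : 0 <= x 0 i <= r * (3 * ka).
  have /andP[q1 q2] := qP i; have /andP[x1 x2] := xP i.
  have rq : 0 <= r * q i by apply: mulr_ge0 => //; apply: le_trans q1; exact: ltW.
  rewrite (le_trans rq x1)/=; apply: le_trans x2 _.
  have : rho * (delta / 32) <= r * ka.
    by apply: ler_pM => //; [rewrite divr_ge0|move: delta0; lra].
  have : r * q i <= r * (2 * ka) by rewrite ler_pM2l.
  have -> : r * (3 * ka) = r * (2 * ka) + r * ka by ring.
  by move=> rq1 rq2; exact: lerD.
(* The directions [q] have norm below [1], which leaves room for the last
   coordinate [a] of the sphere of radius [r] above [x]. *)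
have xr : dotp x x <= r ^+ 2.
  have : dotp x x <= \sum_(i < e) (r * (3 * ka)) ^+ 2.
    apply: ler_sum => i _; have /andP[x0 x1] := xle i.
    by rewrite expr2; apply: ler_pM.
  rewrite sumr_const card_ord -[_ *+ e]mulr_natl => /le_trans; apply.
  have eD : e%:R <= D by rewrite ler_nat.
  have ek : e%:R * ka <= 4^-1 by rewrite -kD ler_pM2r.
  have -> : e%:R * (r * (3 * ka)) ^+ 2 = r ^+ 2 * (9 * (e%:R * ka * ka)) by ring.
  rewrite -[leRHS]mulr1; apply: ler_wpM2l; first exact: sqr_ge0.
  have : e%:R * ka * ka <= 4^-1 * ka by rewrite ler_wpM2r// ltW.
  by set y := e%:R * ka * ka; move: ka8; lra.
pose a := Num.sqrt (r ^+ 2 - dotp x x).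
have a2 : a ^+ 2 = r ^+ 2 - dotp x x by rewrite sqr_sqrtr// subr_ge0.
have a0 : 0 <= a by exact: sqrtr_ge0.
have ar : a <= r.
  by rewrite -(ler_pXn2r (n := 2)) ?nnegrE// a2 lerBlDr lerDl dotp_ge0.
exists a => v vx /andP[av vW].
have E2 : enorm v ^+ 2 = dotp x x + v 0 ord_max ^+ 2.
  rewrite sqr_enorm {1}/dotp big_ord_recr /= -expr2; congr (_ + _).
  by apply: eq_bigr => i _; rewrite vx.
have v0 : 0 <= v 0 ord_max by exact: le_trans av.
have E0 := enorm_ge0 v.
have rE : r <= enorm v.
  rewrite -(ler_pXn2r (n := 2)) ?nnegrE// E2 -lerBlDl -a2.
  by rewrite ler_pXn2r ?nnegrE.
have Er : enorm v <= r + W.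
  rewrite -(ler_pXn2r (n := 2)) ?nnegrE ?addr_ge0// E2.
  have : v 0 ord_max ^+ 2 <= (a + W) ^+ 2 by rewrite ler_pXn2r ?nnegrE ?addr_ge0.
  have : a * W <= r * W by rewrite ler_pM2r.
  have -> : (a + W) ^+ 2 = r ^+ 2 - dotp x x + 2 * (a * W) + W ^+ 2 by rewrite -a2; ring.
  have -> : (r + W) ^+ 2 = r ^+ 2 + 2 * (r * W) + W ^+ 2 by ring.
  by move: (a * W) (r * W) (r ^+ 2) (W ^+ 2) (dotp x x) (_ ^+ 2) => *; lra.
have Wd : W <= rho * (delta / 256).
  rewrite ler_pM2l// ler_pM2r ?invr_gt0 ?ltr0n//.
  by move: delta0 delta8; nra.
split=> //=.
- move=> i; rewrite vx; have /andP[x1 x2] := xP i; have /andP[q1 q2] := qP i.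
  have q0 : 0 <= q i <= 1 by apply/andP; split; move: ka0 ka8; lra.
  case/andP: q0 => q0 q01.
  have e1 : r * q i <= enorm v * q i by rewrite ler_wpM2r.
  have e2 : enorm v * q i <= r * q i + W.
    apply: (@le_trans _ _ ((r + W) * q i)); first by rewrite ler_wpM2r.
    by rewrite mulrDl lerD2l ler_piMr// ltW.
  have e3 : rho * (delta / 32) + rho * (delta / 32) = rho * (delta / 16) by field.
  have e4 : rho * (delta / 256) <= rho * (delta / 16).
    by rewrite ler_pM2l//; move: delta0; lra.
  rewrite ler_norml; move: e1 e2 e3 e4 Wd x1 x2 dd.
  move: (enorm v * q i) (r * q i) (rho * (delta / 32)) (rho * (delta / 16)) (rho * (delta / 256)) (x 0 i).
  by clear; move: W => w *; apply/andP; split; lra.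
- exact: le_trans rE.
have -> : enorm v ^+ 2 - 2 * rho * enorm v + h = (enorm v - rho) ^+ 2 - s ^+ 2.
  by rewrite s2; ring.
have sE : s <= enorm v - rho by rewrite lerBrDl.
have Es : enorm v - rho <= s + W by move: Er; rewrite /r; lra.
rewrite subr_ge0 ler_pXn2r ?nnegrE ?subr_ge0 ?(le_trans r_rho)//= ?sE//=.
rewrite lerBlDr; apply: (@le_trans _ _ ((s + W) ^+ 2)).
  by rewrite ler_pXn2r ?nnegrE ?subr_ge0 ?(le_trans r_rho)// addr_ge0.
have -> : (s + W) ^+ 2 = 2 * (s * W) + W * W + s ^+ 2 by ring.
rewrite lerD2r.
have : s * W <= rho * W by rewrite ler_pM2r.
have : W * W <= rho * W.
  rewrite ler_pM2r//; apply: le_trans Wd _; rewrite -[leRHS]mulr1 ler_pM2l//.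
  by move: delta8; lra.
have -> : rho ^+ 2 * (delta ^+ 2 / 64) = 4 * (rho * W) by rewrite /W; field.
have : 0 <= rho * W by rewrite mulr_ge0.
by move: (s * W) (W * W) (rho * W) => *; lra.
Qed.

Lemma fine_shell_measure (q : 'I_e -> R) :
  (forall i, (4 * D)^-1 <= q i <= (2 * D)^-1) ->
  ((c * ((rho ^+ 2) `^ beta * dyadic_factor beta) *
    ((rho * (delta / 32)) ^+ e * (rho * (delta ^+ 2 / 256))) * (rho ^+ 2 / 4))%:E <=
   beta_intensity gamma beta (fine_shell rho delta q : set point))%E.
Proof.
move=> qP; have -> : rho ^+ 2 / 4 = 3 / 4 * rho ^+ 2 - rho ^+ 2 / 2 by field.
apply: beta_intensity_ge => //.
- by move: rho20; set y := rho ^+ 2; lra.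
- by rewrite mulr_ge0 ?powR_ge0// ltW// dyadic_factor_gt0.
- apply: mulr_ge0; first by rewrite exprn_ge0// mulr_ge0// divr_ge0.
  by apply: mulr_ge0; [exact: rho0'|apply: divr_ge0; [exact: sqr_ge0|exact: ler0n]].
- move=> h /andP[h1 h2]; apply: powR_dyadic => //; rewrite h1/=; apply: le_trans h2 _.
  by move: rho20; set y := rho ^+ 2; lra.
- by move=> h hP; exact: fine_shell_slice.
Qed.

Lemma coarse_box_measure k :
  ((c * ((rho ^+ 2) `^ beta * dyadic_factor beta) *
    (rho * (48 * D ^+ 3)^-1) ^+ d * rho ^+ 2)%:E <=
   beta_intensity gamma beta (coarse_box rho k : set point))%E.
Proof.
have -> : (c * ((rho ^+ 2) `^ beta * dyadic_factor beta) *
    (rho * (48 * D ^+ 3)^-1) ^+ d * rho ^+ 2) = (c * ((rho ^+ 2) `^ beta * dyadic_factor beta) *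
    (rho * (48 * D ^+ 3)^-1) ^+ d * (2 * rho ^+ 2 - rho ^+ 2)).
  by congr (_ * _); ring.
have ep0 : 0 < (48 * D ^+ 3)^-1.
  by rewrite invr_gt0; apply: mulr_gt0; [exact: ltr0n|rewrite exprn_gt0// ltr0n].
set ep := (48 * D ^+ 3)^-1 in ep0 *; have ep0' := ltW ep0.
apply: beta_intensity_ge => //.
- by move: rho20; set y := rho ^+ 2; lra.
- by rewrite mulr_ge0 ?powR_ge0// ltW// dyadic_factor_gt0.
- by rewrite exprn_ge0// mulr_ge0.
- move=> h /andP[h1 h2]; apply: powR_dyadic => //; rewrite h2 andbT; apply: le_trans h1.
  by move: rho20; set y := rho ^+ 2; lra.
move=> h hP.
apply: (@lebesgue_rV_ge_box _ _ _ (\row_i (- (rho * (i == k)%:R) - rho * (ep / 2)))).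
  by rewrite mulr_ge0.
move=> v vP; split=> //= i; have := vP i; rewrite !mxE -/ep ler_norml.
have -> : rho * ep = rho * (ep / 2) + rho * (ep / 2) by field.
by move: (rho * (ep / 2)) (rho * _) (v 0 i) => *; apply/andP; split; lra.
Qed.

(** The heights are below [1], so that an integer exponent above [beta] bounds the
    density from below; it keeps the estimate a power of the tolerance. *)
Lemma core_box_measure (N : nat) : beta <= N%:R ->
  ((c * (tolerance (e := e) delta / 2) ^+ N * tolerance (e := e) delta ^+ d * (tolerance (e := e) delta / 2))%:E <=
   beta_intensity gamma beta (core_box delta : set point))%E.
Proof.
move=> bN; have t0 := tolerance_gt0 deltaP; have t1 := tolerance_le d2 deltaP.
set t := tolerance delta in t0 t1 *.
have -> : c * (t / 2) ^+ N * t ^+ d * (t / 2) = c * (t / 2) ^+ N * t ^+ d * (t - t / 2).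
  by congr (_ * _); field.
apply: beta_intensity_ge => //.
- by apply/andP; split; lra.
- by rewrite exprn_ge0// divr_ge0// ltW.
- by rewrite exprn_ge0// ltW.
- move=> h /andP[h1 h2].
  have h0 : 0 < h by lra.
  apply: (@le_trans _ _ (h ^+ N)).
    by rewrite lerXn2r ?nnegrE//; [rewrite divr_ge0// ltW|exact: ltW].
  rewrite -powR_mulrn; last exact: ltW.
  apply: ger_powR => //.
  by rewrite h0/=; lra.
move=> h hP; apply: (@lebesgue_rV_ge_box _ _ _ 0); first exact: ltW.
by move=> v vP; split=> //= i; have := vP i; rewrite mxE add0r.
Qed.

End box_measures.

(** * The normalisation of the typical cell *)

Section intensity_positive.
Context {R : realType} {d : nat}.
Context {disp disp' : measure_display}.
Context {Omega : measurableType disp} {Omega' : measurableType disp'}.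
Variables (P : probability Omega R) (eta : Omega -> set ('rV[R]_d * R)%type).
Variable P' : probability Omega' R.
Variable Zhat : Omega' -> ('rV[R]_d * R * body R d)%type.
Implicit Types D : set ('rV[R]_d * R * body R d)%type.

(** The integrand in the distribution of the typical cell. *)
Definition cell_count D (omega : Omega) : \bar R :=
  counting [set x | [/\ eta omega x, unit_cube x.1 &
    translate D x.1 (x, laguerre_cell (eta omega) x)]].

Hypothesis ZP : typical_cell P eta P' Zhat.

Lemma closed_centred_bodies : closed (@centred_bodies R d).
Proof.
have -> : @centred_bodies R d = \bigcap_(i in setT)
    ((fun z : 'rV[R]_d * R * body R d => z.1.1 0 i) @^-1` [set t | t = 0]).
  apply/seteqP; split=> [z z0 i _|z z0] /=; first by rewrite z0 mxE.
  by apply/rowP => i; rewrite mxE; exact: (z0 i I).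
apply: closed_bigI => i _; apply: preimage_closed => [z _|]; last exact: closed_eq.
apply: (@continuous_comp _ _ _ fst (fun x : 'rV[R]_d * R => x.1 0 i)); first exact: cvg_fst.
exact: continuous_coord.
Qed.

Lemma le_counting {T : choiceType} (A B : set T) : A `<=` B ->
  (@counting T R A <= @counting T R B)%E.
Proof.
move=> AB; rewrite /counting; case: (asboolP (finite_set B)) => fB; last exact: leey.
have fA := sub_finite_set AB fB.
rewrite asboolT// lee_fin ler_nat; apply: fsubset_leq_card.
by rewrite -fset_set_sub//; exact: AB.
Qed.

(** As the typical cell has total mass one, the definition of its distribution
    makes sense only if the expected number of cells is positive and finite. *)
Lemma cell_intensity_fin_pos : (0 < cell_intensity P eta < +oo)%E.
Proof.
have [Z0 _ ZD] := ZP; have := ZD _ (borel_closed closed_centred_bodies) (@subset_refl _ _).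
have -> : Zhat @^-1` (@centred_bodies R d) = setT.
  by apply/seteqP; split=> // omega _; exact: Z0.
rewrite probability_setT.
have Il : (\int[P]_omega cell_count (@centred_bodies R d) omega <= cell_intensity P eta)%E.
  apply: le_integral_ge0 => omega _; first exact: counting_ge0.
  apply: le_counting => x [ex cx [z _ zE]]; split => //.
  have /= <- := congr1 snd zE.
  have [[w zw] _ _] := body_setP z.2.
  by exists (w + x.1), w.
have I0 : (0 <= \int[P]_omega cell_count (@centred_bodies R d) omega)%E.
  by apply: integral_ge0 => omega _; exact: counting_ge0.
have L0 : (0 <= cell_intensity P eta)%E := le_trans I0 Il.
move: Il I0 L0; rewrite /cell_count; set I := (\int[P]_omega _)%E; set L := cell_intensity P eta.
move=> Il I0 L0 E; apply/andP; split.
  rewrite lt_neqAle L0 andbT; apply/eqP => L00; move: E.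
  have -> : I = 0%E by apply/eqP; rewrite eq_le I0 andbT L00.
  by rewrite mule0 => -[/eqP]; rewrite oner_eq0.
rewrite ltey; apply/eqP => Ly; move: E; rewrite Ly invey mul0e => -[/eqP].
by rewrite oner_eq0.
Qed.


Variables gamma beta : R.
Hypothesis gamma0 : 0 < gamma.
Hypothesis pp : poisson_process P (@beta_intensity R d gamma beta) eta.

Lemma beta_const_ge0 : 0 <= beta_const d.+1 beta.
Proof.
have G0 (s : R) : 0 <= Gamma s.
  apply: Rintegral_ge0 => t _; apply: mulr_ge0; first exact: powR_ge0.
  exact: expR_ge0.
by rewrite divr_ge0// mulr_ge0 ?powR_ge0.
Qed.

(** If the normalising constant vanished there would be no points, hence no
    cells. *)
Lemma intensity_factor_gt0 : 0 < gamma * beta_const d.+1 beta.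
Proof.
rewrite lt_neqAle mulr_ge0 ?beta_const_ge0 ?ltW// andbT; apply/eqP => c0.
have mu0 : @beta_intensity R d gamma beta setT = 0%E :> \bar R.
  by rewrite /beta_intensity; apply: integral0_eq => h _; rewrite -c0 mul0r mul0e.
have [[_ mN] pois _] := pp.
have bT : borel (setT : set ('rV[R]_d * R)%type) by apply: borel_closed; exact: closedT.
have PA := pois setT bT; rewrite mu0 in PA.
have {PA} := PA (ltry 0) 0%N.
rewrite /= expr0 fact0 divr1 mul1r oppr0 expR0.
set A := [set omega | _] => PA.
have mA : measurable A by exact: (measurable_npoints_eq pp 0 bT).
have PAC : P (~` A) = 0%E.
  by rewrite probability_setC// PA subee.
have [L0 _] := andP cell_intensity_fin_pos.
suff : (cell_intensity P eta <= 0)%E by rewrite leNgt L0.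
apply: (@le_trans _ _ (\int[P]_(omega in ~` A) (cst +oo%E) omega)%E); last first.
  by rewrite (integral_cst P (measurableC mA)) [X in (_ * X)%E](_ : _ = 0%E) ?mule0.
rewrite /cell_intensity [leRHS]integral_mkcond; apply: le_integral_ge0 => omega _.
  exact: counting_ge0.
rewrite /patch; case: ifPn => [_|]; first exact: leey.
rewrite notin_setE /= => /contrapT Aw.
have e0 : eta omega = set0.
  by apply: (@counting_eq0 R); rewrite -[eta omega]setIT.
rewrite (_ : [set x | _] = set0); first by rewrite /counting asboolT// fset_set0.
by apply/seteqP; split=> // x []; rewrite e0.
Qed.

End intensity_positive.

(** * Probability of the configuration *)

Section facet_bodies.
Context {R : realType} {d : nat}.

Definition bodies_with_facets (n : nat) : set ('rV[R]_d * R * body R d)%type :=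
  [set z | centred_bodies z /\ polytope_with_facets n (body_set z.2)].

Lemma borel_bodies_with_facets n : borel (bodies_with_facets n.+1).
Proof.
apply: borelI; first exact: borel_closed closed_centred_bodies.
apply: (@borel_preimage _ _ (snd : _ -> body R d)
  [set K : body R d | polytope_with_facets n.+1 (body_set K)]); last exact: borel_polytope_with_facets.
by move=> z; exact: cvg_snd.
Qed.

End facet_bodies.

Section pattern_probability.
Context {R : realType} {e m : nat}.
Local Notation d := e.+1.
Local Notation D := (d%:R : R).
Local Notation point := ('rV[R]_d * R)%type.
Context {disp : measure_display} {Omega : measurableType disp}.
Variables (P : probability Omega R) (eta : Omega -> set point).
Variables (gamma beta rho delta : R) (q : 'I_m -> 'I_e -> R).
Local Notation c := (gamma * beta_const d.+1 beta).
Hypothesis pp : poisson_process P (@beta_intensity R d gamma beta) eta.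
Hypothesis d2 : (1 < d)%N.
Hypothesis m0 : (0 < m)%N.
Hypothesis beta1 : -1 < beta.
Hypothesis c0 : 0 <= c.
Hypothesis rho1 : 1 <= rho.
Hypothesis deltaP : 0 < delta <= (4 * D)^-1.
Hypothesis qP : forall p i, (4 * D)^-1 <= q p i <= (2 * D)^-1.
Hypothesis qsep : forall p p', p != p' -> exists i, delta <= `|q p i - q p' i|.

Let box := pattern_box rho delta q.
Let U : set point := region (far_radius (e := e) rho) (far_height (e := e) rho).
Local Notation mu := (@beta_intensity R d gamma beta).

Lemma beta_intensity_ge0 A : (0 <= mu A)%E.
Proof.
apply: integral_ge0 => h _; apply: mule_ge0; last exact: lebesgue_rV_ge0.
by rewrite lee_fin mulr_ge0// powR_ge0.
Qed.

Lemma le_lebesgue_rV k (A B : set 'rV[R]_k) : A `<=` B -> (lebesgue_rV A <= lebesgue_rV B)%E.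
Proof.
elim: k A B => [|k IH] A B AB.
  rewrite /= lee_fin !indicE; have [/set_mem A0|_] := boolP (0 \in A).
    by rewrite mem_set//; exact: AB.
  by case: (_ \in _).
rewrite !lebesgue_rVS; apply: le_integral_ge0 => t _; first exact: lebesgue_rV_ge0.
by apply: IH => w; exact: AB.
Qed.

Lemma le_beta_intensity A B : A `<=` B -> (mu A <= mu B)%E.
Proof.
move=> AB; apply: le_integral_ge0 => h _.
  apply: mule_ge0; last exact: lebesgue_rV_ge0.
  by rewrite lee_fin mulr_ge0// powR_ge0.
apply: lee_wpmul2l; first by rewrite lee_fin mulr_ge0// powR_ge0.
by apply: le_lebesgue_rV => v; exact: AB.
Qed.

Let rho0 : 0 < rho. Proof. exact: lt_le_trans rho1. Qed.

Lemma far_radius_ge0 : 0 <= far_radius (e := e) rho.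
Proof.
apply: mulr_ge0; last exact: ltW; apply: addr_ge0; last exact: ler0n.
apply: mulr_ge0; last by rewrite addr_ge0.
by apply: mulr_ge0; [exact: ler0n|exact: sqr_ge0].
Qed.

Lemma far_height_gt0 : 0 < far_height (e := e) rho.
Proof.
apply: mulr_gt0; last exact: exprn_gt0; apply: ltr_wpDl; last exact: ltr0n.
by apply: mulr_ge0; [exact: ler0n|exact: sqr_ge0].
Qed.

Let muU : (mu U < +oo)%E.
Proof.
apply: le_lt_trans (beta_intensity_region c0 beta1 far_radius_ge0 far_height_gt0) _.
exact: ltry.
Qed.

(** The core point lies in the unit cube, and its cell is that of
    [laguerre_cell_pattern]. *)
Lemma pattern_cell_count omega : npoints eta (U `\` \bigcup_j box j) omega = 0%E :> \bar R ->
  (forall j, npoints eta (box j) omega = 1%E :> \bar R) ->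
  (1 <= cell_count eta (bodies_with_facets (d + m)) omega :> \bar R)%E.
Proof.
move=> V0 B1; have [x xP] := choice (fun j => counting_eq1 (B1 j)).
have xe j : eta omega (x j) /\ box j (x j).
  by have : [set x j] (x j) by []; rewrite -xP.
have xreg y : eta omega y -> U y -> exists j, y = x j.
  move=> ey Uy; have [[j _ By]|nB] := pselect ((\bigcup_j box j) y).
    by exists j; have : (eta omega `&` box j) y by []; rewrite xP.
  by have : (eta omega `&` (U `\` \bigcup_j box j)) y by []; rewrite (counting_eq0 V0).
have boxS j : box (lift ord0 j) = site_box rho delta q j.
  by rewrite /box /pattern_box liftK.
have box0 : box ord0 = core_box delta by rewrite /box /pattern_box unlift_none.
have [x0e x0b] := xe ord0; rewrite box0 in x0b.
have [|||K [facets cK cellE]] := laguerre_cell_pattern d2 rho1 deltaP m0 qP qsep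
  (X := eta omega) (x0 := x ord0) (y := fun j => x (lift ord0 j)) x0b.
- by move=> j; rewrite -boxS; exact: (xe _).2.
- by move=> j; exact: (xe _).1.
- move=> y ey /(xreg y ey)[j ->]; case: (unliftP ord0 j) => [i ->|->]; [right|by left].
  by exists i.
apply: (counting_ge1 (x := x ord0)); split => //.
  move=> i; have [/(_ i)/andP[z0 z1] _] := x0b.
  rewrite z0/=; apply: le_trans z1 _; apply: le_trans (tolerance_le d2 deltaP) _.
  by lra.
exists ((0, (x ord0).2), Body cK); first by split.
by rewrite /= add0r cellE; case: (x ord0).
Qed.

Lemma pattern_integral_bound :
  (((\prod_j fine (mu (box j))) * expR (- fine (mu U)))%:E <=
   \int[P]_omega cell_count eta (bodies_with_facets (d + m)) omega)%E.
Proof.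
have bB j : borel (box j) by exact: borel_pattern_box.
have bU : borel U by exact: borel_region.
have BU j : box j `<=` U by apply: pattern_box_region.
have muB j : (mu (box j) < +oo)%E by apply: le_lt_trans muU; exact: le_beta_intensity.
have muV : (mu (U `\` \bigcup_j box j) < +oo)%E.
  by apply: le_lt_trans muU; apply: le_beta_intensity; exact: subDsetl.
have tB : trivIset setT box by apply: pattern_box_disjoint.
rewrite -(poisson_pattern pp bB bU tB BU muB muU muV).
rewrite -[leLHS]mul1e.
set A := (_ `&` _).
have mA : measurable A.
  apply: (measurable_pattern pp bB); apply: borelD => //; exact: borel_bigcup_ord.
apply: le_integral_cst => //.
  by move=> omega _; exact: counting_ge0.
move=> omega [V0 B1]; apply: pattern_cell_count => // j.
exact: (B1 j I).
Qed.

End pattern_probability.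

(** * Separated directions *)

Section grid.

Lemma root_bounds (e m : nat) : (0 < e)%N -> (0 < m)%N ->
  exists k, [/\ (0 < k)%N, (m <= k ^ e)%N & (k ^ e <= 2 ^ e * m)%N].
Proof.
move=> e0 m0; have ex : exists k, (m <= k ^ e)%N.
  by exists m; rewrite -{1}(expn1 m) leq_pexp2l.
case: (ex_minnP ex) => k mk kmin.
have k0 : (0 < k)%N by rewrite lt0n; apply: contraTneq mk => ->; rewrite exp0n// -ltnNge.
exists k; split => //.
have [k1|k1] := leqP k 1.
  have -> : k = 1%N by apply/eqP; rewrite eqn_leq k1.
  by rewrite exp1n muln_gt0 expn_gt0.
have km : (k.-1 ^ e < m)%N.
  rewrite ltnNge; apply/negP => /kmin; rewrite -ltnS prednK// ltnn//.
apply: (@leq_trans ((2 * k.-1) ^ e)); last by rewrite expnMn leq_pmul2l ?expn_gt0// ltnW.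
by rewrite leq_exp2r//; lia.
Qed.

Lemma grid_labels (e m k : nat) : (m <= k ^ e)%N ->
  exists g : 'I_m -> {ffun 'I_e -> 'I_k}, injective g.
Proof.
move=> mk; have card : #|{: {ffun 'I_e -> 'I_k}}| = (k ^ e)%N.
  by rewrite card_ffun !card_ord.
have mc : (m <= #|{: {ffun 'I_e -> 'I_k}}|)%N by rewrite card.
exists (fun i => enum_val (widen_ord mc i)) => i j /enum_val_inj ij.
by apply: val_inj; have := congr1 val ij.
Qed.

(** These are points of the grid with [k ^ e] points in a cube of side [(4 d)^-1],
    where [k] is least with [m <= k ^ e]; so the mesh [delta] is of the order
    [m ^ (- 1 / e)] of the best possible separation. *)
Lemma separated_directions {R : realType} (e m : nat) : (0 < e)%N -> (0 < m)%N ->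
  exists (y : R) (q : 'I_m -> 'I_e -> R),
    let delta := (8 * e.+1%:R)^-1 / y in
    [/\ 0 < y, y ^+ e <= m%:R, 0 < delta <= (4 * e.+1%:R)^-1,
      forall p i, (4 * e.+1%:R)^-1 <= q p i <= (2 * e.+1%:R)^-1 &
      forall p p', p != p' -> exists i, delta <= `|q p i - q p' i|].
Proof.
move=> e0 m0; have [k [k0 mk km]] := root_bounds e0 m0.
have [g ginj] := grid_labels mk.
have k0' : 0 < k%:R :> R by rewrite ltr0n.
have D0 : 0 < e.+1%:R :> R by rewrite ltr0n.
pose y : R := k%:R / 2.
pose delta := (8 * e.+1%:R)^-1 / y.
have y0 : 0 < y by rewrite divr_gt0.
have dk : delta * k%:R = (4 * e.+1%:R)^-1.
  rewrite /delta /y; move: D0 k0'; set DD := e.+1%:R; set kk := k%:R => DD0 kk0.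
  by field; rewrite !gt_eqF.
have delta0 : 0 < delta by rewrite divr_gt0// invr_gt0 mulr_gt0.
have delta0' := ltW delta0.
have k4 : 0 < (4 * e.+1%:R)^-1 :> R by rewrite invr_gt0 mulr_gt0.
exists y, (fun p i => (4 * e.+1%:R)^-1 + (g p i)%:R * delta); split => //=.
- rewrite /y exprMn exprVn ler_pdivrMr ?exprn_gt0// mulrC.
  by rewrite -!natrX -natrM ler_nat.
- by rewrite delta0/= -dk ler_peMr// ler1n.
- move=> p i; rewrite lerDl mulr_ge0//=.
  have -> : (2 * e.+1%:R)^-1 = (4 * e.+1%:R)^-1 + (4 * e.+1%:R)^-1 :> R.
    by move: D0; set DD := e.+1%:R => DD0; field; rewrite gt_eqF.
  by rewrite lerD2l -dk mulrC ler_pM2l// ler_nat ltnW.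
move=> p p' pp; have [i gi] : exists i, g p i != g p' i.
  apply/existsP; apply: contraNT pp; rewrite negb_exists => /forallP gi.
  by apply/eqP/ginj/ffunP => i; apply/eqP; have := gi i; rewrite negbK.
exists i; have -> : (4 * e.+1%:R)^-1 + (g p i)%:R * delta - ((4 * e.+1%:R)^-1 + (g p' i)%:R * delta)
    = ((g p i)%:R - (g p' i)%:R) * delta by ring.
rewrite normrM (gtr0_norm delta0) ler_peMl//.
have dist a b : (a < b)%N -> 1 <= `|a%:R - b%:R| :> R.
  by move=> ab; rewrite distrC -(natrB _ (ltnW ab)) (ger0_norm (ler0n _ _)) ler1n subn_gt0.
have [gg|gg|gg] := ltngtP (g p i) (g p' i); first exact: dist.
- by rewrite distrC; exact: dist.
- by move: gi; rewrite -val_eqE /= gg eqxx.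
Qed.

End grid.

(** * The lower bound *)

Section final_bound.
Context {R : realType}.

Lemma prodr_ge_exp (I : finType) (F : I -> R) (b : R) : 0 <= b -> (forall i, b <= F i) ->
  b ^+ #|I| <= \prod_i F i.
Proof.
move=> b0 bF; rewrite -prodr_const.
by apply: ler_prod => i _; rewrite b0 bF.
Qed.

Lemma fine_ge (x : \bar R) (r : R) : (r%:E <= x)%E -> (x < +oo)%E -> r <= fine x.
Proof. by case: x => [s||] //=; rewrite ?lee_fin// leeNy_eq. Qed.

(** A set of width [rho] and height [rho ^ 2] at height [rho ^ 2] has intensity of
    this order; [rho] is chosen such that it equals the number [n] of facets. *)
Lemma scale_exponent (beta rho : R) (d : nat) : 0 < rho ->
  (rho ^+ 2) `^ beta * rho ^+ d * rho ^+ 2 = rho `^ (2 * beta + d%:R + 2).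
Proof.
move=> rho0; have rn : rho != 0 by rewrite gt_eqF.
rewrite (@powRD _ _ (2 * beta + d%:R)) ?rn ?implybT// (@powRD _ _ (2 * beta)) ?rn ?implybT//.
by rewrite powRrM -(powR_mulrn 2 (ltW rho0)) -(powR_mulrn d (ltW rho0)).
Qed.

(** [y ^- 2] is of the order of the square of the separation [delta]. The middle
    inequality absorbs fixed powers of [n] into exponentials. *)
Lemma facet_exponent_bounds (e n : nat) (y : R) : (0 < e)%N -> (0 < n)%N -> 0 < y ->
  y ^+ e <= n%:R -> let x := n%:R `^ (- (2 / e%:R)) in
  [/\ 0 < x <= 1, 4^-1 ^+ n <= x & x * y ^+ 2 <= 1].
Proof.
move=> e0 n0 y0 yn x; have n1 : 1 <= n%:R :> R by rewrite ler1n.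
have np : 0 < n%:R :> R by rewrite ltr0n.
have ep : 0 < e%:R :> R by rewrite ltr0n.
have te : 0 <= 2 / e%:R :> R by rewrite divr_ge0.
have xE : x = (n%:R `^ (2 / e%:R))^-1 by rewrite /x powRN.
have z1 : 1 <= n%:R `^ (2 / e%:R) :> R.
  by apply: (@le_trans _ _ (n%:R `^ 0)); [rewrite powRr0|exact: ler_powR].
have z0 : 0 < n%:R `^ (2 / e%:R) :> R by exact: lt_le_trans z1.
have z2 : n%:R `^ (2 / e%:R) <= 4 ^+ n :> R.
  apply: (@le_trans _ _ (n%:R `^ 2)).
    apply: ler_powR => //; rewrite ler_pdivrMr// ler_peMr//.
    by rewrite ler1n.
  rewrite (powR_mulrn 2 (ltW np)).
  have -> : (4 : R) = 2 ^+ 2 by rewrite expr2; lra.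
  rewrite -exprM mulnC exprM lerXn2r ?nnegrE ?ler0n ?exprn_ge0//.
  by rewrite -natrX ler_nat ltnW// ltn_expl.
split.
- by rewrite xE invr_gt0 z0/= invf_le1.
- by rewrite xE exprVn lef_pV2 ?posrE ?exprn_gt0.
rewrite xE mulrC ler_pdivrMr// mul1r.
have -> : y ^+ 2 = (y ^+ e) `^ (2 / e%:R).
  by rewrite -(powR_mulrn e (ltW y0)) -powRrM mulrC divfK ?gt_eqF// (powR_mulrn 2 (ltW y0)).
by apply: ge0_ler_powR; rewrite ?nnegrE ?exprn_ge0// ltW.
Qed.

End final_bound.

Section facet_probability.
Context {R : realType} {e : nat}.
Local Notation d := e.+1.
Local Notation D := (d%:R : R).
Local Notation point := ('rV[R]_d * R)%type.
Context {disp : measure_display} {Omega : measurableType disp}.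
Variables (P : probability Omega R) (eta : Omega -> set point).
Variables (gamma beta : R).
Local Notation c := (gamma * beta_const d.+1 beta).
Hypothesis pp : poisson_process P (@beta_intensity R d gamma beta) eta.
Hypothesis e0 : (0 < e)%N.
Hypothesis beta1 : -1 < beta.
Hypothesis c0 : 0 < c.
Local Notation mu := (@beta_intensity R d gamma beta).

Let ka : R := (8 * D)^-1.
Let ep : R := (48 * D ^+ 3)^-1.
Let kappa : R := dyadic_factor beta.
Let N : nat := (Num.truncn `|beta|).+1.
Let T : R := ka ^+ 2 / (256 * D).
Let expo : R := 2 * beta + d%:R + 2.
Let Cr : R := 400 * D ^+ 2 * (D + 1) + 2.
Let Ch : R := D * (400 * D ^+ 2) ^+ 2 + 2.

Let fine_const : R := c * kappa / (32 ^+ e * 1024) * ka ^+ e * ka ^+ 2.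
Let coarse_const : R := c * kappa * ep ^+ d.
Let core_const : R := c * (T / 2) ^+ (N + d + 1).
Let region_const : R := c * (2 * Cr) ^+ d * (Ch `^ (beta + 1) / (beta + 1)).

Let D0 : 0 < D. Proof. by rewrite ltr0n. Qed.
Let c0' : 0 <= c. Proof. exact: ltW. Qed.
Let ka0 : 0 < ka. Proof. by rewrite invr_gt0 mulr_gt0// ltr0n. Qed.
Let ep0 : 0 < ep.
Proof. by rewrite invr_gt0; apply: mulr_gt0; [exact: ltr0n|exact: exprn_gt0]. Qed.
Let kappa0 : 0 < kappa. Proof. exact: dyadic_factor_gt0. Qed.
Let T0 : 0 < T.
Proof. by apply: divr_gt0; [exact: exprn_gt0|apply: mulr_gt0; [exact: ltr0n|exact: D0]]. Qed.
Let expo0 : 0 < expo.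
Proof. have := D0; rewrite /expo -natr1; have := ler0n R e; move: beta1; set z := e%:R; lra. Qed.
Let fine_const0 : 0 < fine_const.
Proof.
apply: mulr_gt0; last exact: exprn_gt0; apply: mulr_gt0; last exact: exprn_gt0.
apply: divr_gt0; first exact: mulr_gt0.
by apply: mulr_gt0; [apply: exprn_gt0; exact: ltr0n|exact: ltr0n].
Qed.
Let coarse_const0 : 0 < coarse_const.
Proof. by apply: mulr_gt0; [exact: mulr_gt0|exact: exprn_gt0]. Qed.
Let core_const0 : 0 < core_const.
Proof. by apply: mulr_gt0 => //; apply: exprn_gt0; apply: divr_gt0. Qed.

Section one_size.
Variables (m : nat) (y : R) (q : 'I_m -> 'I_e -> R).
Hypothesis m0 : (0 < m)%N.
Let n : R := (d + m)%:R.
Let x : R := n `^ (- (2 / e%:R)).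
Let delta : R := ka / y.
Let rho : R := n `^ expo^-1.
Hypothesis y0 : 0 < y.
Hypothesis ym : y ^+ e <= m%:R.
Hypothesis deltaP : 0 < delta <= (4 * D)^-1.
Hypothesis qP : forall p i, (4 * D)^-1 <= q p i <= (2 * D)^-1.
Hypothesis qsep : forall p p', p != p' -> exists i, delta <= `|q p i - q p' i|.

Let yn : y ^+ e <= n.
Proof. by apply: le_trans ym _; rewrite /n ler_nat leq_addl. Qed.
Let n1 : 1 <= n. Proof. by rewrite /n ler1n. Qed.
Let n0 : 0 < n. Proof. exact: lt_le_trans n1. Qed.
Let rho1 : 1 <= rho.
Proof.
apply: (@le_trans _ _ (n `^ 0)); first by rewrite powRr0.
by apply: ler_powR => //; rewrite invr_ge0 ltW.
Qed.
Let rho0 : 0 < rho. Proof. exact: lt_le_trans rho1. Qed.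
Let scale : (rho ^+ 2) `^ beta * rho ^+ d * rho ^+ 2 = n.
Proof.
rewrite scale_exponent// /rho -powRrM mulVf ?gt_eqF//.
by rewrite powRr1 ?ltW.
Qed.

Let xP : [/\ 0 < x <= 1, 4^-1 ^+ (d + m) <= x & x * y ^+ 2 <= 1].
Proof. by apply: facet_exponent_bounds. Qed.

Let delta2 : ka ^+ 2 * x <= delta ^+ 2.
Proof.
have [_ _ xy] := xP; rewrite /delta expr_div_n ler_pdivlMr ?exprn_gt0// -mulrA.
by rewrite ler_piMr// sqr_ge0.
Qed.

Let ndelta : ka ^+ e <= n * delta ^+ e.
Proof.
rewrite /delta expr_div_n mulrCA ler_peMr//; first by rewrite exprn_ge0// ltW.
by rewrite ler_pdivlMr ?exprn_gt0// mul1r.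
Qed.

Let d2 : (1 < d)%N. Proof. by []. Qed.

Let muU : (mu (region (far_radius (e := e) rho) (far_height (e := e) rho)) <= (region_const * n)%:E)%E.
Proof.
have := beta_intensity_region c0' beta1 (far_radius_ge0 (e := e) rho1) (far_height_gt0 (e := e) rho1).
move=> /le_trans; apply; rewrite lee_fin /far_radius /far_height -/Cr -/Ch.
have Ch0 : 0 <= Ch.
  apply: addr_ge0; last exact: ler0n.
  by apply: mulr_ge0; [exact: ler0n|exact: sqr_ge0].
rewrite powRM ?sqr_ge0// (mulrA 2) exprMn.
have -> : (rho ^+ 2) `^ (beta + 1) = (rho ^+ 2) `^ beta * rho ^+ 2.
  rewrite powRD; last by apply/implyP => _; rewrite gt_eqF// exprn_gt0.
  by rewrite (powRr1 (sqr_ge0 rho)).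
rewrite -scale /region_const.
set u := (rho ^+ 2) `^ beta; set v := Ch `^ (beta + 1); set w := (beta + 1)^-1.
rewrite le_eqVlt; apply/orP; left; apply/eqP; ring.
Qed.

Let finite_mu A : A `<=` region (far_radius (e := e) rho) (far_height (e := e) rho) -> (mu A < +oo)%E.
Proof.
move=> AU; apply: le_lt_trans (le_beta_intensity c0' AU) _.
by apply: le_lt_trans muU _; exact: ltry.
Qed.

Let box_finite j : (mu (pattern_box rho delta q j) < +oo)%E.
Proof. by apply: finite_mu; apply: pattern_box_region. Qed.

Let site_finite j : (mu (site_box rho delta q j) < +oo)%E.
Proof. by have := box_finite (lift ord0 j); rewrite /pattern_box liftK. Qed.

Let fine_bound p : fine_const * x <= fine (mu (fine_shell rho delta (q p))).
Proof.
have fin : (mu (fine_shell rho delta (q p)) < +oo)%E.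
  by have := site_finite (rshift d p); rewrite site_boxR.
apply: fine_ge fin.
have E := fine_shell_measure d2 rho1 deltaP c0' (qP p). apply: le_trans E.
rewrite lee_fin -/kappa.
have -> : c * ((rho ^+ 2) `^ beta * kappa) *
   ((rho * (delta / 32)) ^+ e * (rho * (delta ^+ 2 / 256))) * (rho ^+ 2 / 4) =
   c * kappa / (32 ^+ e * 1024) * ((n * delta ^+ e) * delta ^+ 2).
  rewrite -scale exprMn expr_div_n (exprS rho e).
  have : (32 : R) ^+ e != 0 by rewrite expf_neq0// pnatr_eq0.
  by set z := 32 ^+ e => z0; field.
set K := c * kappa / (32 ^+ e * 1024).
have K0 : 0 <= K.
  apply: divr_ge0; first by apply: mulr_ge0 => //; exact: ltW.
  by apply: mulr_ge0; [apply: exprn_ge0; exact: ler0n|exact: ler0n].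
have -> : fine_const * x = K * (ka ^+ e * (ka ^+ 2 * x)) by rewrite /fine_const -/K; ring.
have [/andP[x0 _] _ _] := xP.
apply: ler_wpM2l => //; apply: ler_pM => //.
- by apply: exprn_ge0; exact: ltW.
- by apply: mulr_ge0; [exact: sqr_ge0|exact: ltW].
Qed.

Let coarse_bound k : coarse_const <= fine (mu (coarse_box rho k)).
Proof.
have fin : (mu (coarse_box rho k) < +oo)%E.
  by have := site_finite (lshift m k); rewrite site_boxL.
apply: fine_ge fin.
have E := coarse_box_measure rho1 c0' k; apply: le_trans E.
rewrite lee_fin -/kappa -/ep.
have -> : c * ((rho ^+ 2) `^ beta * kappa) * (rho * ep) ^+ d * rho ^+ 2 = coarse_const * n.
  by rewrite -scale exprMn /coarse_const; ring.
by rewrite ler_peMr// ltW.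
Qed.

Let core_bound : core_const * (4^-1 ^+ (N + d + 1)) ^+ (d + m) <= fine (mu (core_box delta)).
Proof.
have fin : (mu (core_box delta) < +oo)%E.
  by have := box_finite ord0; rewrite /pattern_box unlift_none.
apply: fine_ge fin.
have bN : beta <= N%:R.
  by apply: le_trans (ler_norm _) _; rewrite ltW// /N truncnS_gt.
have E := core_box_measure d2 deltaP c0' bN; apply: le_trans E.
rewrite lee_fin; have [/andP[x0 _] zx _] := xP.
set z := 4^-1 ^+ (d + m) in zx; set t := tolerance delta.
have z0 : 0 <= z by apply: exprn_ge0; rewrite invr_ge0.
have Tt : T * z <= t.
  apply: (@le_trans _ _ (T * x)); first by rewrite ler_pM2l.
  rewrite /T /t /tolerance mulrAC; apply: ler_wpM2r; last exact: delta2.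
  by rewrite invr_ge0; apply: mulr_ge0; exact: ler0n.
have Tz0 : 0 <= T * z by apply: mulr_ge0 => //; exact: ltW.
have t0 : 0 <= t by exact: le_trans Tt.
have -> : core_const * (4^-1 ^+ (N + d + 1)) ^+ (d + m) = c * (T * z / 2) ^+ (N + d + 1).
  rewrite exprAC -/z /core_const -mulrA -exprMn; congr (_ * _ ^+ _).
  by ring.
have -> : c * (t / 2) ^+ N * t ^+ d * (t / 2) = c * ((t / 2) ^+ N * t ^+ d * (t / 2)) by ring.
apply: ler_wpM2l => //; rewrite addn1 exprSr exprD.
have Ttz : 0 <= T * z / 2 <= t / 2.
  by apply/andP; split; [apply: divr_ge0|rewrite ler_pM2r// invr_gt0].
case/andP: Ttz => Tz1 Tz2.
have le_exp j : (T * z / 2) ^+ j <= (t / 2) ^+ j.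
  by rewrite lerXn2r ?nnegrE//; exact: le_trans Tz2.
apply: ler_pM => //.
  by apply: mulr_ge0; exact: exprn_ge0.
apply: ler_pM => //; [exact: exprn_ge0|exact: exprn_ge0|].
rewrite lerXn2r ?nnegrE//; apply: le_trans Tt.
by rewrite ler_pdivrMr// ler_peMr// ler1n.
Qed.

Let F1 : R := Num.min 1 fine_const.

(** Of the factors in the probability of the pattern, only those of the fine shells
    decrease with [n], and each is at least a multiple of [x]. The core box and the
    emptiness of the rest of the region cost an exponential. *)
Lemma pattern_lower_bound :
  ((core_const * coarse_const ^+ d *
    (4^-1 ^+ (N + d + 1) * expR (- region_const) * F1 * x) ^+ (d + m))%:E <=
   \int[P]_omega cell_count eta (bodies_with_facets (d + m)) omega)%E.
Proof.
apply: le_trans (pattern_integral_bound pp d2 m0 beta1 c0' rho1 deltaP qP qsep).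
rewrite lee_fin.
have [/andP[x0 x1] _ _] := xP.
have F10 : 0 < F1 by rewrite lt_min ltr01.
have expE : expR (- region_const) ^+ (d + m) <=
    expR (- fine (mu (region (far_radius (e := e) rho) (far_height (e := e) rho)))).
  rewrite -expRM_natl ler_expR mulrN lerN2 mulrC.
  have := muU; case: (mu _) (beta_intensity_ge0 c0' (region (far_radius (e := e) rho) (far_height (e := e) rho))) => [s||]//=.
have sites : coarse_const ^+ d * (F1 * x) ^+ (d + m) <=
    \prod_j fine (mu (site_box rho delta q j)).
  rewrite big_split_ord /=; apply: ler_pM.
  - by apply: exprn_ge0; exact: ltW.
  - by apply: exprn_ge0; apply: mulr_ge0; exact: ltW.
  - have := @prodr_ge_exp R 'I_d (fun k : 'I_d => fine (mu (coarse_box rho k))) _ (ltW coarse_const0) coarse_bound.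
    rewrite card_ord => /le_trans; apply; rewrite le_eqVlt; apply/orP; left; apply/eqP.
    by apply: eq_bigr => k _; rewrite site_boxL.
  apply: (@le_trans _ _ ((fine_const * x) ^+ m)).
    apply: (@le_trans _ _ ((F1 * x) ^+ m)).
      apply: ler_wiXn2l; [by apply: mulr_ge0; exact: ltW| |exact: leq_addl].
      apply: mulr_ile1 => //; [exact: ltW|exact: ltW|].
      by rewrite /F1 ge_min lexx.
    have F1x : F1 * x <= fine_const * x by rewrite ler_pM2r// /F1 ge_min lexx orbT.
    by rewrite lerXn2r ?nnegrE//; apply: mulr_ge0; exact: ltW.
  have fx0 : 0 <= fine_const * x by apply: mulr_ge0; exact: ltW.
  have := prodr_ge_exp fx0 fine_bound.
  rewrite card_ord => /le_trans; apply; rewrite le_eqVlt; apply/orP; left; apply/eqP.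
  by apply: eq_bigr => k _; rewrite site_boxR.
set G := 4^-1 ^+ (N + d + 1); set Ex := expR (- region_const) in expE *.
have -> : core_const * coarse_const ^+ d * (G * Ex * F1 * x) ^+ (d + m) =
    (core_const * G ^+ (d + m)) * (coarse_const ^+ d * (F1 * x) ^+ (d + m)) * Ex ^+ (d + m).
  have expand (a1 a2 a3 a4 a5 a6 : R) k : a1 * a2 * (a3 * a4 * a5 * a6) ^+ k =
      (a1 * a3 ^+ k) * (a2 * (a5 * a6) ^+ k) * a4 ^+ k by rewrite !exprMn; ring.
  exact: expand.
have Ex0 : 0 <= Ex ^+ (d + m) by apply: exprn_ge0; exact: expR_ge0.
have s0 : 0 <= coarse_const ^+ d * (F1 * x) ^+ (d + m).
  by apply: mulr_ge0; apply: exprn_ge0; [exact: ltW|apply: mulr_ge0; exact: ltW].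
have G0 : 0 <= core_const * G ^+ (d + m).
  apply: mulr_ge0; first exact: ltW.
  by apply: exprn_ge0; apply: exprn_ge0; rewrite invr_ge0.
apply: ler_pM => //; first exact: mulr_ge0.
rewrite big_ord_recl; apply: ler_pM => //.
  by rewrite /pattern_box unlift_none.
apply: le_trans sites _; rewrite le_eqVlt; apply/orP; left; apply/eqP.
by apply: eq_bigr => j _; rewrite /pattern_box liftK.
Qed.

End one_size.
Lemma cell_count_bound : exists A B : R, [/\ 0 < A, 0 < B & forall n : nat, (d < n)%N ->
  ((A * (B * n%:R `^ (- (2 / e%:R))) ^+ n)%:E <=
    \int[P]_omega cell_count eta (bodies_with_facets n) omega)%E].
Proof.
exists (core_const * coarse_const ^+ d),
  (4^-1 ^+ (N + d + 1) * expR (- region_const) * Num.min 1 fine_const); split.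
- by apply: mulr_gt0 => //; exact: exprn_gt0.
- apply: mulr_gt0; last by rewrite lt_min ltr01.
  by apply: mulr_gt0; [apply: exprn_gt0; rewrite invr_gt0|exact: expR_gt0].
move=> n dn; have [m [m0 ->]] : exists m, (0 < m)%N /\ n = (d + m)%N.
  by exists (n - d)%N; rewrite subn_gt0 dn subnKC// ltnW.
have [y [q [y0 ym deltaP qP qsep]]] := @separated_directions R e m e0 m0.
exact: (pattern_lower_bound m0 y0 ym deltaP qP qsep).
Qed.

End facet_probability.

Theorem theorem5p6 (R : realType) (d : nat) (gamma beta : R)
    (disp disp' : measure_display)
    (Omega : measurableType disp) (P : probability Omega R)
    (eta : Omega -> set ('rV[R]_d * R)%type)
    (Omega' : measurableType disp') (P' : probability Omega' R)
    (Zhat : Omega' -> ('rV[R]_d * R * body R d)%type) :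
  (2 <= d)%N -> 0 < gamma -> -1 < beta ->
  poisson_process P (@beta_intensity R d gamma beta) eta ->
  typical_cell P eta P' Zhat ->
  exists2 c : R, 0 < c &
    forall n : nat, (d.+1 <= n)%N ->
      (((c * n%:R `^ (- (2 / (d%:R - 1)))) ^+ n)%:E <
       P' [set omega | polytope_with_facets n (body_set (Zhat omega).2)])%E.
Proof.
case: d eta Zhat => [//|e] eta Zhat d2 gamma0 beta1 pp ZP.
have /andP[L0 Ly] := cell_intensity_fin_pos ZP.
have c0 := intensity_factor_gt0 ZP gamma0 pp.
have [A [B [A0 B0 AB]]] := cell_count_bound pp d2 beta1 c0.
have [l l0 LE] : exists2 l : R, 0 < l & cell_intensity P eta = l%:E.
  move: L0 Ly; case: (cell_intensity P eta) => [l||]//=.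
  by rewrite lte_fin => l0 _; exists l.
(* The constant [A / l] in front of the [n]-th power exceeds [t], hence [t ^ n]. *)
pose t : R := Num.min 1 (A / l) / 2.
have t0 : 0 < t by rewrite divr_gt0// lt_min ltr01 divr_gt0.
have t1 : t < 1.
  by rewrite ltr_pdivrMr// mul1r; apply: le_lt_trans (_ : 1 < 2); rewrite ?ge_min ?lexx// ltr1n.
have tA : t < A / l.
  rewrite ltr_pdivrMr//; apply: le_lt_trans (_ : A / l < _); first by rewrite ge_min lexx orbT.
  by rewrite ltr_pMr ?divr_gt0// ltr1n.
exists (B * t) => [|n dn]; first exact: mulr_gt0.
have -> : e.+1%:R - 1 = e%:R :> R by rewrite -natr1 addrK.
set x := n%:R `^ _.
have n0 : (0 < n)%N by exact: leq_trans dn.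
have x0 : 0 < x by rewrite powR_gt0// ltr0n.
have -> : [set omega | polytope_with_facets n (body_set (Zhat omega).2)] =
    Zhat @^-1` bodies_with_facets n.
  have [Z0 _ _] := ZP.
  by apply/seteqP; split=> omega /= => [Zn|[]//]; split => //; exact: Z0.
have [_ _ ZD] := ZP; rewrite ZD; last by move=> z [].
  rewrite LE inver gt_eqF//.
  apply: (@lt_le_trans _ _ ((l^-1)%:E * (A * (B * x) ^+ n)%:E)%E); last first.
    by apply: lee_wpmul2l; [rewrite lee_fin invr_ge0 ltW|exact: AB].
  rewrite -EFinM lte_fin mulrAC exprMn mulrC mulrA [l^-1 * A]mulrC.
  rewrite ltr_pM2r; last by apply: exprn_gt0; exact: mulr_gt0.
  apply: le_lt_trans tA; rewrite -[leRHS]expr1; apply: ler_wiXn2l => //; exact: ltW.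
by case: n n0 {dn x x0} => // n _; exact: borel_bodies_with_facets.
Qed.
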